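(* Assume the Riemann Hypothesis. Let $s=\sigma+i t$ with $1/2<\sigma\le 3/2$, and let $T\ge \tfrac{2}{3}\exp(e^{10})$ and $2\exp(e^2)\le t\le T$. Then \[ \log\left|\frac{1}{\zeta(s)}\right| \le \frac{1.756\log(2T)}{\log\log(2T)}\log\left(1+\frac{37.345}{(\sigma-\frac12)\log\log T}\right)+\frac{2.51\log(2T)}{\log\log(2T)} \] and \[ \log|\zeta(s)| \le \frac{8.45\log(2T)}{\log\log(2T)}. \]
   Context: $\zeta$ denotes the Riemann zeta-function. The Riemann Hypothesis (RH) is the assertion that all nontrivial zeros of $\zeta$ have real part $1/2$. *)

(* Defs.v *)
From Stdlib Require Import Reals.
From Coquelicot Require Import Coquelicot.
Open Scope R_scope.

Definition npow_neg (n : nat) (s : C) : C :=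
  let l := ln (INR n) in
  (exp (- (fst s) * l) * cos (snd s * l), - (exp (- (fst s) * l) * sin (snd s * l))).

Definition npow_one_minus (N : nat) (s : C) : C :=
  let l := ln (INR N) in
  (exp ((1 - fst s) * l) * cos (snd s * l), - (exp ((1 - fst s) * l) * sin (snd s * l))).

Definition zeta_approx (s : C) (N : nat) : C :=
  Cminus (sum_n (fun k => npow_neg (S k) s) (pred N))
         (Cdiv (npow_one_minus N s) (Cminus (RtoC 1) s)).

(* The Riemann zeta function on the half plane Re s > 0, s <> 1, given by
   zeta(s) = lim_{N -> oo} ( sum_{n<=N} n^{-s} - N^{1-s}/(1-s) ),
   which is the analytic continuation of sum n^{-s} to Re s > 0
   (the remainder is s * int_N^oo {x} x^{-s-1} dx = O(|s| N^{-sigma}/sigma)). *)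
Definition zeta (s : C) : C :=
  (real (Lim_seq (fun N => fst (zeta_approx s N))),
   real (Lim_seq (fun N => snd (zeta_approx s N)))).

Definition RH : Prop :=
  forall s : C, 0 < fst s < 1 -> zeta s = RtoC 0 -> fst s = 1 / 2.

(* Main.v *)
(** The logarithmic derivative [F = zeta'/zeta] is estimated by the maximum principle alone.
    Reflecting in a line [Re s = c > 1/2] and comparing [log |zeta|] at mirror points, where the zeros of
    the left point do no harm, gives [- Re F <= L + O(1)] on [Re s > 1/2], [L = log 2T]; no functional
    equation is needed.  With [D = (4/3) log L] and [z = s - 1/2 - i t], the function
    [- F (1 +- cosh (D z))] then has real part at most [(L + O(1)) (1 +- cos (D y))] at height [y] of the critical line,
    and it is of size [L^(2/3) log L] on the line [Re s = 1 + 1/D], by the Dirichlet series.  Comparing it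
    with [(L + O(1)) (1 +- exp (- D z))] and putting [z = x > 0] real yields, up to small errors,
    [Re F <= 2 L / (exp (D x) - 1)] and [- Re F <= 2 L / (exp (D x) + 1)].
    Integrating in [x] gives the two inequalities. *)

Require Import Defs.
From Stdlib Require Import Reals Lra Lia List Classical ClassicalChoice ClassicalDescription.
From Coquelicot Require Import Coquelicot.
From mathcomp Require ssreflect ssrfun ssrbool eqtype ssrnat seq div prime.
Open Scope R_scope.

(** Only one side of [Re F] is bounded near the critical line, because the zeros there are poles of
    [F]. A multiplier must therefore be real and nonnegative on that line, and [1 +- cosh (D z)] is,
    being even in [z]. The comparison function [1 +- exp (- D z)] has the same real part there but
    stays bounded to the right, where [cosh] grows; the quotient of the two is the gain. [D] is a
    compromise: the final bounds carry [L / D], while [cosh] magnifies the bound for [F] on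
    [Re s = 1 + 1/D] by about [exp (D/2)], and the result must stay well below [L]. The bound
    [L + O(1)] comes from [|zeta| = O(t^2)] on [Re s = -1/2]. Reflected in [Re s = c], this allows
    the difference of [log |zeta|] at mirror points a slope of about [2 L / (c + 1/2)], less than
    [2 L] for [c > 1/2], and that slope is [- 2 Re F]. The maximum principle is applied on
    rectangles, so the horizontal sides need harmonic barriers, and these need a crude bound for [F]
    up to the critical line; a gradient estimate for [M - log |zeta|] supplies it. Integration takes
    the form of monotonicity of explicit antiderivatives. *)

Lemma Cmod_sq (z : C) : Cmod z * Cmod z = fst z * fst z + snd z * snd z.
Proof.
  unfold Cmod. rewrite sqrt_sqrt; [ring|].
  nra.
Qed.

Lemma fst_le_Cmod (z : C) : Rabs (fst z) <= Cmod z.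
Proof. generalize (Rmax_Cmod z) (Rmax_l (Rabs (fst z)) (Rabs (snd z))). lra. Qed.

Lemma snd_le_Cmod (z : C) : Rabs (snd z) <= Cmod z.
Proof. generalize (Rmax_Cmod z) (Rmax_r (Rabs (fst z)) (Rabs (snd z))). lra. Qed.

Lemma Cmod_le_abs (z : C) : Cmod z <= Rabs (fst z) + Rabs (snd z).
Proof.
  apply Rsqr_incr_0_var; [|generalize (Rabs_pos (fst z)) (Rabs_pos (snd z)); lra].
  unfold Rsqr. rewrite Cmod_sq.
  generalize (Rabs_pos (fst z)) (Rabs_pos (snd z)).
  assert (H : forall x, x * x = Rabs x * Rabs x) by (intro x; rewrite <- Rabs_mult, Rabs_right; [ring|nra]).
  rewrite (H (fst z)), (H (snd z)). nra.
Qed.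

Lemma Cmod_minus_sym (z w : C) : Cmod (z - w)%C = Cmod (w - z)%C.
Proof. rewrite <- Cmod_opp. f_equal. ring. Qed.

Lemma Cmod_triangle_inv (z w : C) : Cmod z - Cmod w <= Cmod (z - w)%C.
Proof.
  generalize (Cmod_triangle (z - w)%C w). replace (z - w + w)%C with z by ring. lra.
Qed.

(** Componentwise, so that the real calculus of [is_derive] and [auto_derive] applies to each
    coordinate. *)
Definition is_Rder (phi : R -> C) (x : R) (l : C) : Prop :=
  is_derive (fun r => fst (phi r)) x (fst l) /\ is_derive (fun r => snd (phi r)) x (snd l).

(** A vector-valued function has no mean value point of its own: the real theorem is applied to the
    scalar product of [phi] with the increment [d = phi b - phi a], followed by Cauchy-Schwarz and
    division by [|d|]. *)
Lemma mvt_ineq (phi phi' : R -> C) (a b K : R) :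
  a <= b ->
  (forall x, a <= x <= b -> is_Rder phi x (phi' x)) ->
  (forall x, a <= x <= b -> Cmod (phi' x) <= K) ->
  Cmod (phi b - phi a)%C <= K * (b - a).
Proof.
  intros Hab Hd HK.
  set (d := (phi b - phi a)%C).
  destruct (MVT_gen (fun x => fst d * fst (phi x) + snd d * snd (phi x)) a b
     (fun x => fst d * fst (phi' x) + snd d * snd (phi' x))) as [c [Hc He]].
  - intros x Hx. rewrite Rmin_left, Rmax_right in Hx by lra.
    destruct (Hd x) as [H1 H2]; [lra|].
    apply @is_derive_plus; apply is_derive_scal; assumption.
  - intros x Hx. rewrite Rmin_left, Rmax_right in Hx by lra.
    destruct (Hd x) as [H1 H2]; [lra|].
    apply derivable_continuous_pt.
    exists (fst d * fst (phi' x) + snd d * snd (phi' x)).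
    apply is_derive_Reals.
    apply @is_derive_plus; apply is_derive_scal; assumption.
  - rewrite Rmin_left, Rmax_right in Hc by lra.
    assert (Hd2 : Cmod d * Cmod d = (fst d * fst (phi' c) + snd d * snd (phi' c)) * (b - a)).
    { rewrite <- He, Cmod_sq. unfold d; simpl; ring. }
    assert (Hcs : fst d * fst (phi' c) + snd d * snd (phi' c) <= Cmod d * Cmod (phi' c)).
    { apply Rsqr_incr_0_var; [|apply Rmult_le_pos; apply Cmod_ge_0].
      unfold Rsqr.
      replace (Cmod d * Cmod (phi' c) * (Cmod d * Cmod (phi' c)))
        with ((Cmod d * Cmod d) * (Cmod (phi' c) * Cmod (phi' c))) by ring.
      rewrite !Cmod_sq. generalize (Rle_0_sqr (fst d * snd (phi' c) - snd d * fst (phi' c))).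
      unfold Rsqr; nra. }
    specialize (HK c Hc). generalize (Cmod_ge_0 d) (Cmod_ge_0 (phi' c)); intros.
    destruct (Req_dec (Cmod d) 0) as [Hz|Hz].
    + rewrite Hz. apply Rmult_le_pos; lra.
    + apply Rmult_le_reg_l with (Cmod d); [lra|].
      rewrite Hd2.
      apply Rle_trans with (Cmod d * Cmod (phi' c) * (b - a)).
      * apply Rmult_le_compat_r; lra.
      * rewrite !Rmult_assoc. apply Rmult_le_compat_l; [lra|].
        apply Rmult_le_compat_r; lra.
Qed.

(** * Complex differentiability *)

Definition near (z : C) (P : C -> Prop) : Prop :=
  exists d, 0 < d /\ forall w, Cmod (w - z)%C < d -> P w.

Lemma near_and (z : C) (P Q : C -> Prop) : near z P -> near z Q -> near z (fun w => P w /\ Q w).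
Proof.
  intros [d1 [H1 P1]] [d2 [H2 P2]]. exists (Rmin d1 d2). split; [apply Rmin_pos; assumption|].
  intros w Hw. split; [apply P1|apply P2]; (eapply Rlt_le_trans; [exact Hw|]); [apply Rmin_l|apply Rmin_r].
Qed.

Lemma near_imp (z : C) (P Q : C -> Prop) : (forall w, P w -> Q w) -> near z P -> near z Q.
Proof. intros H [d [H1 P1]]. exists d; split; [exact H1|]. intros; apply H, P1; assumption. Qed.

Lemma near_true (z : C) (P : C -> Prop) : (forall w, P w) -> near z P.
Proof. intros H. exists 1; split; [lra|]. intros; apply H. Qed.

Lemma near_at (z : C) (P : C -> Prop) : near z P -> P z.
Proof. intros [d [H1 P1]]. apply P1. replace (z - z)%C with (RtoC 0) by ring. rewrite Cmod_0; lra. Qed.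

Lemma near_close (z : C) (e : R) : 0 < e -> near z (fun w => Cmod (w - z)%C < e).
Proof. intros He. exists e; split; [exact He|]. intros; assumption. Qed.

(** The error is compared by [<=] and not divided by [|w - z|], so the centre [w = z] needs no
    exception and errors simply add. *)
Definition is_Cder (f : C -> C) (z l : C) : Prop :=
  forall eps, 0 < eps -> near z (fun w => Cmod (f w - f z - l * (w - z))%C <= eps * Cmod (w - z)%C).

Definition Ccont (f : C -> C) (z : C) : Prop :=
  forall eps, 0 < eps -> near z (fun w => Cmod (f w - f z)%C < eps).

Lemma is_Cder_lip (f : C -> C) (z l : C) : is_Cder f z l ->
  near z (fun w => Cmod (f w - f z)%C <= (Cmod l + 1) * Cmod (w - z)%C).
Proof.
  intros H. generalize (H 1 Rlt_0_1). apply near_imp. intros w Hw.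
  replace (f w - f z)%C with ((f w - f z - l * (w - z)) + l * (w - z))%C by ring.
  eapply Rle_trans; [apply Cmod_triangle|]. rewrite Cmod_mult. lra.
Qed.

Lemma is_Cder_cont (f : C -> C) (z l : C) : is_Cder f z l -> Ccont f z.
Proof.
  intros H eps Heps. assert (Hl := Cmod_ge_0 l).
  generalize (near_and _ _ _ (is_Cder_lip _ _ _ H)
    (near_close z (eps / (Cmod l + 1)) ltac:(apply Rdiv_lt_0_compat; lra))).
  apply near_imp. intros w [H1 H2].
  eapply Rle_lt_trans; [exact H1|].
  apply (Rmult_lt_compat_l (Cmod l + 1)) in H2; [|lra].
  replace ((Cmod l + 1) * (eps / (Cmod l + 1))) with eps in H2 by (field; lra). exact H2.
Qed.

Lemma is_Cder_const (c z : C) : is_Cder (fun _ => c) z 0.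
Proof.
  intros e He. apply near_true. intros w.
  replace (c - c - 0 * (w - z))%C with (RtoC 0) by ring. rewrite Cmod_0.
  apply Rmult_le_pos; [lra|apply Cmod_ge_0].
Qed.

Lemma is_Cder_id (z : C) : is_Cder (fun w => w) z 1.
Proof.
  intros e He. apply near_true. intros w.
  replace (w - z - 1 * (w - z))%C with (RtoC 0) by ring. rewrite Cmod_0.
  apply Rmult_le_pos; [lra|apply Cmod_ge_0].
Qed.

Lemma is_Cder_plus (f g : C -> C) (z a b : C) : is_Cder f z a -> is_Cder g z b ->
  is_Cder (fun w => f w + g w)%C z (a + b)%C.
Proof.
  intros Hf Hg e He.
  generalize (near_and _ _ _ (Hf (e / 2) ltac:(lra)) (Hg (e / 2) ltac:(lra))).
  apply near_imp. intros w [H1 H2].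
  replace (f w + g w - (f z + g z) - (a + b) * (w - z))%C
    with ((f w - f z - a * (w - z)) + (g w - g z - b * (w - z)))%C by ring.
  eapply Rle_trans; [apply Cmod_triangle|]. lra.
Qed.

Lemma is_Cder_mult (f g : C -> C) (z a b : C) : is_Cder f z a -> is_Cder g z b ->
  is_Cder (fun w => f w * g w)%C z (a * g z + f z * b)%C.
Proof.
  intros Hf Hg e He.
  assert (Ha := Cmod_ge_0 a). assert (Hb := Cmod_ge_0 b).
  assert (Hfz := Cmod_ge_0 (f z)). assert (Hgz := Cmod_ge_0 (g z)).
  set (q1 := e / 3 / (Cmod (g z) + 1)). set (q2 := e / 3 / (Cmod (f z) + 1)).
  set (q3 := e / 3 / ((Cmod a + 1) * (Cmod b + 1))).
  assert (Q1 : 0 < q1) by (repeat apply Rdiv_lt_0_compat; lra).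
  assert (Q2 : 0 < q2) by (repeat apply Rdiv_lt_0_compat; lra).
  assert (Q3 : 0 < q3) by (repeat apply Rdiv_lt_0_compat; try lra; apply Rmult_lt_0_compat; lra).
  assert (E1 : q1 * (Cmod (g z) + 1) = e / 3) by (unfold q1; field; lra).
  assert (E2 : q2 * (Cmod (f z) + 1) = e / 3) by (unfold q2; field; lra).
  assert (E3 : (Cmod a + 1) * (Cmod b + 1) * q3 = e / 3) by (unfold q3; field; split; lra).
  generalize (near_and _ _ _ (near_and _ _ _ (Hf q1 Q1) (Hg q2 Q2))
    (near_and _ _ _ (near_close z q3 Q3) (near_and _ _ _ (is_Cder_lip _ _ _ Hf) (is_Cder_lip _ _ _ Hg)))).
  apply near_imp. intros w [[H1 H2] [H3 [H4 H5]]].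
  assert (HN := Cmod_ge_0 (w - z)%C). set (N := Cmod (w - z)%C) in *.
  replace (f w * g w - f z * g z - (a * g z + f z * b) * (w - z))%C
    with ((f w - f z - a * (w - z)) * g z + f z * (g w - g z - b * (w - z))
          + (f w - f z) * (g w - g z))%C by ring.
  eapply Rle_trans; [apply Cmod_triangle|].
  eapply Rle_trans; [apply Rplus_le_compat_r, Cmod_triangle|].
  rewrite !Cmod_mult.
  assert (T1 : Cmod (f w - f z - a * (w - z)) * Cmod (g z) <= (q1 * N) * (Cmod (g z) + 1)).
  { apply Rmult_le_compat; try apply Cmod_ge_0; lra. }
  assert (T2 : Cmod (f z) * Cmod (g w - g z - b * (w - z)) <= (Cmod (f z) + 1) * (q2 * N)).
  { apply Rmult_le_compat; try apply Cmod_ge_0; lra. }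
  assert (T3 : Cmod (f w - f z) * Cmod (g w - g z) <= ((Cmod a + 1) * N) * ((Cmod b + 1) * q3)).
  { apply Rmult_le_compat; try apply Cmod_ge_0; try lra.
    eapply Rle_trans; [exact H5|]. apply Rmult_le_compat_l; lra. }
  replace (e * N) with (e / 3 * N + e / 3 * N + e / 3 * N) by field.
  rewrite <- E1 at 1. rewrite <- E2 at 1. rewrite <- E3 at 1. nra.
Qed.

Lemma near_nonzero (f : C -> C) (z : C) : Ccont f z -> f z <> 0%C ->
  near z (fun w => Cmod (f z) / 2 < Cmod (f w)).
Proof.
  intros Hc Hz. apply Cmod_gt_0 in Hz.
  generalize (Hc (Cmod (f z) / 2) ltac:(lra)). apply near_imp. intros w Hw.
  generalize (Cmod_triangle_inv (f z) (f w)). rewrite Cmod_minus_sym. lra.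
Qed.

Lemma is_Cder_inv (f : C -> C) (z a : C) : is_Cder f z a -> f z <> 0%C ->
  is_Cder (fun w => / f w)%C z (- a * (/ f z * / f z))%C.
Proof.
  intros Hf Hz e He. assert (Hm := Hz). apply Cmod_gt_0 in Hm.
  set (m := Cmod (f z)) in *. assert (Ha := Cmod_ge_0 a).
  set (q1 := e / 2 * (m * m / 2)). set (q2 := e / 2 * (m * m * m / 2) / ((Cmod a + 1) * (Cmod a + 1))).
  assert (Hm2 : 0 < m * m) by nra. assert (Hm3 : 0 < m * m * m) by nra.
  assert (Q1 : 0 < q1) by (unfold q1; nra).
  assert (Q2 : 0 < q2) by (unfold q2; apply Rdiv_lt_0_compat; nra).
  generalize (near_and _ _ _ (near_nonzero _ _ (is_Cder_cont _ _ _ Hf) Hz)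
   (near_and _ _ _ (Hf q1 Q1) (near_and _ _ _ (near_close z q2 Q2) (is_Cder_lip _ _ _ Hf)))).
  apply near_imp. intros w [H1 [H2 [H3 H4]]]. fold m in H1.
  assert (HN := Cmod_ge_0 (w - z)%C).
  assert (Hw : f w <> 0%C) by (apply Cmod_gt_0; lra).
  replace (/ f w - / f z - - a * (/ f z * / f z) * (w - z))%C
    with ((- (f w - f z - a * (w - z)) * f z + a * (w - z) * (f w - f z)) / (f z * f z * f w))%C
    by (field; split; assumption).
  assert (Hden : m * m * (m / 2) <= Cmod (f z * f z * f w)).
  { rewrite !Cmod_mult. fold m. apply Rmult_le_compat_l; lra. }
  rewrite Cmod_div. 2:{ intro H0. rewrite H0, Cmod_0 in Hden. nra. }
  set (N := Cmod (w - z)%C) in *.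
  assert (Hnum : Cmod (- (f w - f z - a * (w - z)) * f z + a * (w - z) * (f w - f z)) <= e * N * (m * m * (m / 2))).
  { eapply Rle_trans; [apply Cmod_triangle|]. rewrite !Cmod_mult, Cmod_opp. fold N. fold m.
    assert (T1 : Cmod (f w - f z - a * (w - z)) * m <= q1 * N * m) by (apply Rmult_le_compat_r; lra).
    assert (T2 : Cmod a * N * Cmod (f w - f z) <= (Cmod a + 1) * N * ((Cmod a + 1) * q2)).
    { apply Rmult_le_compat; try apply Cmod_ge_0.
      - apply Rmult_le_pos; lra.
      - apply Rmult_le_compat_r; lra.
      - eapply Rle_trans; [exact H4|]. apply Rmult_le_compat_l; lra. }
    assert (E2 : (Cmod a + 1) * ((Cmod a + 1) * q2) = e / 2 * (m * m * m / 2)) by (unfold q2; field; lra).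
    replace ((Cmod a + 1) * N * ((Cmod a + 1) * q2)) with (N * ((Cmod a + 1) * ((Cmod a + 1) * q2))) in T2 by ring.
    rewrite E2 in T2. unfold q1 in T1. nra. }
  apply Rmult_le_reg_r with (Cmod (f z * f z * f w)); [nra|].
  unfold Rdiv at 1. rewrite Rmult_assoc, Rinv_l by nra. rewrite Rmult_1_r.
  eapply Rle_trans; [exact Hnum|]. apply Rmult_le_compat_l; [|exact Hden].
  apply Rmult_le_pos; lra.
Qed.

Lemma is_Cder_comp (f g : C -> C) (z a b : C) : is_Cder g z b -> is_Cder f (g z) a ->
  is_Cder (fun w => f (g w)) z (a * b)%C.
Proof.
  intros Hg Hf e He.
  assert (Ha := Cmod_ge_0 a). assert (Hb := Cmod_ge_0 b).
  set (q1 := e / 2 / (Cmod b + 1)). set (q2 := e / 2 / (Cmod a + 1)).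
  assert (Q1 : 0 < q1) by (repeat apply Rdiv_lt_0_compat; lra).
  assert (Q2 : 0 < q2) by (repeat apply Rdiv_lt_0_compat; lra).
  destruct (Hf q1 Q1) as [d [Hd Hfd]].
  generalize (near_and _ _ _ (is_Cder_cont _ _ _ Hg d Hd)
    (near_and _ _ _ (Hg q2 Q2) (is_Cder_lip _ _ _ Hg))).
  apply near_imp. intros w [H1 [H2 H3]]. specialize (Hfd _ H1).
  replace (f (g w) - f (g z) - a * b * (w - z))%C
    with ((f (g w) - f (g z) - a * (g w - g z)) + a * (g w - g z - b * (w - z)))%C by ring.
  eapply Rle_trans; [apply Cmod_triangle|]. rewrite Cmod_mult.
  assert (HN := Cmod_ge_0 (w - z)%C). set (N := Cmod (w - z)%C) in *.
  assert (E1 : q1 * (Cmod b + 1) = e / 2) by (unfold q1; field; lra).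
  assert (E2 : (Cmod a + 1) * q2 = e / 2) by (unfold q2; field; lra).
  assert (T1 : q1 * Cmod (g w - g z) <= q1 * ((Cmod b + 1) * N)) by (apply Rmult_le_compat_l; lra).
  assert (T2 : Cmod a * Cmod (g w - g z - b * (w - z)) <= (Cmod a + 1) * (q2 * N)).
  { apply Rmult_le_compat; try apply Cmod_ge_0; lra. }
  rewrite <- Rmult_assoc, E1 in T1. rewrite <- Rmult_assoc, E2 in T2. lra.
Qed.

Lemma is_Cder_ext (f g : C -> C) (z l : C) : near z (fun w => f w = g w) ->
  is_Cder f z l -> is_Cder g z l.
Proof.
  intros He Hf e H. assert (Hz := near_at _ _ He). simpl in Hz.
  generalize (near_and _ _ _ He (Hf e H)). apply near_imp.
  intros w [H1 H2]. rewrite <- H1, <- Hz. exact H2.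
Qed.

Lemma is_derive_eps (h : R -> R) (x l : R) :
  (forall eps, 0 < eps -> exists d, 0 < d /\ forall r, Rabs (r - x) < d ->
     Rabs (h r - h x - l * (r - x)) <= eps * Rabs (r - x)) ->
  is_derive h x l.
Proof.
  intros H. apply is_derive_Reals. intros e He.
  destruct (H (e / 2)) as [d [Hd Hr]]; [lra|].
  exists (mkposreal d Hd). intros k Hk Hkd. simpl in Hkd.
  specialize (Hr (x + k)). replace (x + k - x) with k in Hr by ring. specialize (Hr Hkd).
  replace ((h (x + k) - h x) / k - l) with ((h (x + k) - h x - l * k) / k) by (field; exact Hk).
  unfold Rdiv. rewrite Rabs_mult, Rabs_inv. assert (0 < Rabs k) by (apply Rabs_pos_lt; exact Hk).
  apply Rmult_lt_reg_r with (Rabs k); [assumption|].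
  rewrite Rmult_assoc, Rinv_l, Rmult_1_r by lra. nra.
Qed.

Lemma is_Cder_line (f : C -> C) (z l v : C) : is_Cder f z l ->
  is_Rder (fun r => f (z + r * v)%C) 0 (l * v)%C.
Proof.
  intros Hf.
  assert (HE : forall eps, 0 < eps -> exists d, 0 < d /\ forall r, Rabs (r - 0) < d ->
     Cmod (f (z + r * v) - f (z + 0 * v) - (r - 0)%R * (l * v))%C <= eps * Rabs (r - 0)).
  { intros e He. assert (Hv := Cmod_ge_0 v).
    destruct (Hf (e / (Cmod v + 1))) as [d [Hd Hw]]; [apply Rdiv_lt_0_compat; lra|].
    exists (d / (Cmod v + 1)). split; [apply Rdiv_lt_0_compat; lra|].
    intros r Hr. rewrite Rminus_0_r in *.
    replace (z + 0 * v)%C with z by ring.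
    specialize (Hw (z + r * v)%C). replace (z + r * v - z)%C with (r * v)%C in Hw by ring.
    rewrite Cmod_mult, Cmod_R in Hw.
    assert (Hr2 : Rabs r * (Cmod v + 1) < d).
    { apply (Rmult_lt_compat_r (Cmod v + 1)) in Hr; [|lra].
      unfold Rdiv in Hr. rewrite Rmult_assoc, Rinv_l, Rmult_1_r in Hr by lra. exact Hr. }
    assert (Hr0 := Rabs_pos r).
    specialize (Hw ltac:(nra)).
    replace (r * (l * v))%C with (l * (r * v))%C by ring.
    eapply Rle_trans; [exact Hw|].
    unfold Rdiv. rewrite (Rmult_comm (Rabs r)), <- Rmult_assoc. apply Rmult_le_compat_r; [exact Hr0|].
    apply Rmult_le_reg_r with (Cmod v + 1); [lra|].
    field_simplify; [|lra]. nra. }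
  split; apply is_derive_eps; intros e He; destruct (HE e He) as [d [Hd Hr]]; exists d;
    (split; [exact Hd|]); intros r Hrd; eapply Rle_trans; [|apply Hr; exact Hrd| |apply Hr; exact Hrd].
  - eapply Rle_trans; [|apply fst_le_Cmod]. right. f_equal. simpl. ring.
  - eapply Rle_trans; [|apply snd_le_Cmod]. right. f_equal. simpl. ring.
Qed.

Lemma is_derive_shift (h : R -> R) (x l : R) : is_derive (fun r => h (x + r)) 0 l -> is_derive h x l.
Proof.
  intros H. apply is_derive_ext with (fun r => (fun r => h (x + r)) (r - x)).
  - intros t. simpl. f_equal. ring.
  - rewrite <- (Rmult_1_l l). apply (is_derive_comp (fun r => h (x + r)) (fun r => r - x)).
    + replace (x - x) with 0 by ring. exact H.
    + auto_derive; [exact I|ring].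
Qed.

Lemma is_Cder_x (f : C -> C) (x y : R) (l : C) : is_Cder f (x, y) l ->
  is_Rder (fun r => f (r, y)) x l.
Proof.
  intros H. destruct (is_Cder_line _ _ _ 1 H) as [H1 H2].
  rewrite Cmult_1_r in H1, H2.
  split; apply is_derive_shift; [eapply is_derive_ext; [|exact H1]|eapply is_derive_ext; [|exact H2]];
    intros t; simpl; do 2 f_equal; unfold Cplus, Cmult, RtoC; simpl; f_equal; ring.
Qed.

Lemma is_Cder_y (f : C -> C) (x y : R) (l : C) : is_Cder f (x, y) l ->
  is_Rder (fun r => f (x, r)) y (Ci * l)%C.
Proof.
  intros H. destruct (is_Cder_line _ _ _ Ci H) as [H1 H2].
  rewrite (Cmult_comm l Ci) in H1, H2.
  split; apply is_derive_shift; [eapply is_derive_ext; [|exact H1]|eapply is_derive_ext; [|exact H2]];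
    intros t; simpl; do 2 f_equal; unfold Cplus, Cmult, RtoC, Ci; simpl; f_equal; ring.
Qed.

(** The derivative along the real axis: the complex derivative where that exists ([Dc_unique]), a junk value elsewhere. *)
Definition Dc (f : C -> C) (z : C) : C :=
  (Derive (fun r => fst (f (r, snd z))) (fst z), Derive (fun r => snd (f (r, snd z))) (fst z)).

Lemma Dc_unique (f : C -> C) (z l : C) : is_Cder f z l -> Dc f z = l.
Proof.
  intros H. destruct z as [x y]. destruct (is_Cder_x _ _ _ _ H) as [H1 H2].
  unfold Dc; apply injective_projections; simpl; apply is_derive_unique; assumption.
Qed.

Definition Copen (D : C -> Prop) : Prop := forall z, D z -> near z D.

(** The order is part of the predicate because, without Cauchy's theorem, one derivative is not known to give the next. *)
Fixpoint hol (n : nat) (D : C -> Prop) (f : C -> C) : Prop :=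
  match n with
  | O => True
  | S m => (forall z, D z -> is_Cder f z (Dc f z)) /\ hol m D (Dc f)
  end.

Lemma hol_ext (n : nat) (D : C -> Prop) (f g : C -> C) : Copen D ->
  (forall z, D z -> f z = g z) -> hol n D f -> hol n D g.
Proof.
  intros HD. revert f g. induction n as [|n IH]; intros f g He Hf; [exact I|].
  destruct Hf as [H1 H2].
  assert (Hd : forall z, D z -> is_Cder g z (Dc f z)).
  { intros z Hz. apply is_Cder_ext with f; [|apply H1; exact Hz].
    generalize (HD z Hz). apply near_imp. exact He. }
  split.
  - intros z Hz. rewrite (Dc_unique _ _ _ (Hd z Hz)). apply Hd, Hz.
  - apply (IH (Dc f)); [|exact H2]. intros z Hz. symmetry. apply Dc_unique, Hd, Hz.
Qed.

Lemma hol_intro (n : nat) (D : C -> Prop) (f f' : C -> C) : Copen D ->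
  (forall z, D z -> is_Cder f z (f' z)) -> hol n D f' -> hol (S n) D f.
Proof.
  intros HD H1 H2. split.
  - intros z Hz. rewrite (Dc_unique _ _ _ (H1 z Hz)). apply H1, Hz.
  - apply hol_ext with f'; [exact HD| |exact H2]. intros z Hz. symmetry. apply Dc_unique, H1, Hz.
Qed.

Lemma hol_S (n : nat) (D : C -> Prop) (f : C -> C) : hol (S n) D f -> hol n D f.
Proof.
  revert f. induction n as [|n IH]; intros f H; [exact I|].
  destruct H as [H1 H2]. split; [exact H1|]. apply IH, H2.
Qed.

Lemma hol_sub (n : nat) (D E : C -> Prop) (f : C -> C) : (forall z, E z -> D z) -> hol n D f -> hol n E f.
Proof.
  intros HE. revert f. induction n as [|n IH]; intros f H; [exact I|].
  destruct H as [H1 H2]. split; [intros; apply H1, HE; assumption|]. apply IH, H2.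
Qed.

Lemma hol_const (n : nat) (D : C -> Prop) (c : C) : Copen D -> hol n D (fun _ => c).
Proof.
  intros HD. revert c. induction n as [|n IH]; intros c; [exact I|].
  apply hol_intro with (fun _ => RtoC 0); [exact HD| |apply IH].
  intros z _. apply is_Cder_const.
Qed.

Lemma hol_id (n : nat) (D : C -> Prop) : Copen D -> hol n D (fun z => z).
Proof.
  intros HD. destruct n as [|n]; [exact I|].
  apply hol_intro with (fun _ => RtoC 1); [exact HD| |apply hol_const, HD].
  intros z _. apply is_Cder_id.
Qed.

Lemma hol_plus (n : nat) (D : C -> Prop) (f g : C -> C) : Copen D ->
  hol n D f -> hol n D g -> hol n D (fun z => f z + g z)%C.
Proof.
  intros HD. revert f g. induction n as [|n IH]; intros f g Hf Hg; [exact I|].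
  destruct Hf as [F1 F2], Hg as [G1 G2].
  apply hol_intro with (fun z => Dc f z + Dc g z)%C; [exact HD| |apply IH; assumption].
  intros z Hz. apply is_Cder_plus; auto.
Qed.

Lemma hol_mult (n : nat) (D : C -> Prop) (f g : C -> C) : Copen D ->
  hol n D f -> hol n D g -> hol n D (fun z => f z * g z)%C.
Proof.
  intros HD. revert f g. induction n as [|n IH]; intros f g Hf Hg; [exact I|].
  assert (Hf' := hol_S _ _ _ Hf). assert (Hg' := hol_S _ _ _ Hg).
  destruct Hf as [F1 F2], Hg as [G1 G2].
  apply hol_intro with (fun z => Dc f z * g z + f z * Dc g z)%C; [exact HD| |].
  - intros z Hz. apply is_Cder_mult; auto.
  - apply hol_plus; [exact HD|apply IH; assumption|apply IH; assumption].
Qed.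

Lemma hol_opp (n : nat) (D : C -> Prop) (f : C -> C) : Copen D ->
  hol n D f -> hol n D (fun z => - f z)%C.
Proof.
  intros HD H. apply hol_ext with (fun z => (-(1)) * f z)%C; [exact HD|intros; ring|].
  apply hol_mult; [exact HD|apply hol_const, HD|exact H].
Qed.

Lemma hol_minus (n : nat) (D : C -> Prop) (f g : C -> C) : Copen D ->
  hol n D f -> hol n D g -> hol n D (fun z => f z - g z)%C.
Proof. intros HD Hf Hg. apply hol_plus; [exact HD|exact Hf|]. apply hol_opp; assumption. Qed.

Lemma hol_inv (n : nat) (D : C -> Prop) (f : C -> C) : Copen D ->
  (forall z, D z -> f z <> 0%C) -> hol n D f -> hol n D (fun z => / f z)%C.
Proof.
  intros HD H0. induction n as [|n IH]; intros Hf; [exact I|].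
  assert (Hf' := hol_S _ _ _ Hf). destruct Hf as [F1 F2].
  apply hol_intro with (fun z => - Dc f z * (/ f z * / f z))%C; [exact HD| |].
  - intros z Hz. apply is_Cder_inv; auto.
  - apply hol_mult; [exact HD|apply hol_opp; assumption|].
    apply hol_mult; [exact HD|apply IH; exact Hf'|apply IH; exact Hf'].
Qed.

Lemma hol_div (n : nat) (D : C -> Prop) (f g : C -> C) : Copen D ->
  (forall z, D z -> g z <> 0%C) -> hol n D f -> hol n D g -> hol n D (fun z => f z / g z)%C.
Proof. intros HD H0 Hf Hg. apply hol_mult; [exact HD|exact Hf|]. apply hol_inv; assumption. Qed.

(** * The complex exponential *)

Definition Cexp (z : C) : C := (exp (fst z) * cos (snd z), exp (fst z) * sin (snd z)).

Lemma Cexp_plus (z w : C) : Cexp (z + w)%C = (Cexp z * Cexp w)%C.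
Proof.
  unfold Cexp, Cmult, Cplus; simpl. rewrite exp_plus, cos_plus, sin_plus. f_equal; ring.
Qed.

Lemma Cmod_Cexp (z : C) : Cmod (Cexp z) = exp (fst z).
Proof.
  assert (H := exp_pos (fst z)).
  apply Rsqr_inj; [apply Cmod_ge_0|lra|]. unfold Rsqr. rewrite Cmod_sq. unfold Cexp; simpl.
  generalize (sin2_cos2 (snd z)). unfold Rsqr. intros E.
  replace (exp (fst z) * cos (snd z) * (exp (fst z) * cos (snd z)) + exp (fst z) * sin (snd z) * (exp (fst z) * sin (snd z)))
   with (exp (fst z) * exp (fst z) * (sin (snd z) * sin (snd z) + cos (snd z) * cos (snd z))) by ring.
  rewrite E; ring.
Qed.

Lemma Cexp_0 : Cexp 0 = 1%C.
Proof. unfold Cexp; simpl. rewrite exp_0, cos_0, sin_0. apply injective_projections; simpl; ring. Qed.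

Lemma Cexp_line (h : C) (x : R) : is_Rder (fun r => Cexp (r * h)%C) x (h * Cexp (x * h))%C.
Proof.
  split; unfold Cexp; simpl; (auto_derive; [exact I|]); unfold Rminus; ring.
Qed.

(** Two applications of the mean value inequality along [r * h], to [Cexp] and then to the
    remainder; the factor 3 bounds [exp 1]. *)
Lemma Cexp_quad (h : C) : Cmod h <= 1 -> Cmod (Cexp h - 1 - h)%C <= 3 * (Cmod h * Cmod h).
Proof.
  intros Hh. assert (H0 := Cmod_ge_0 h).
  assert (E3 : forall x, 0 <= x <= 1 -> exp (fst (x * h)%C) <= 3).
  { intros x Hx. apply Rle_trans with (exp 1); [|exact exp_le_3].
    assert (fst (x * h)%C <= 1).
    { simpl. generalize (fst_le_Cmod h) (Rle_abs (fst h)). nra. }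
    destruct (Req_dec (fst (x*h)%C) 1) as [E|E]; [rewrite E; lra|].
    left; apply exp_increasing; lra. }
  assert (S1 : forall x, 0 <= x <= 1 -> Cmod (Cexp (x * h) - 1)%C <= 3 * Cmod h).
  { intros x Hx.
    apply Rle_trans with (3 * Cmod h * (x - 0)); [|nra].
    rewrite <- Cexp_0. replace (RtoC 0) with (0 * h)%C at 1 by ring.
    apply (mvt_ineq (fun r => Cexp (r * h)%C) (fun r => h * Cexp (r * h))%C); [lra| |].
    - intros r _. apply Cexp_line.
    - intros r Hr. rewrite Cmod_mult, Cmod_Cexp. specialize (E3 r ltac:(lra)). nra. }
  apply Rle_trans with (3 * (Cmod h * Cmod h) * (1 - 0)); [|lra].
  replace (Cexp h - 1 - h)%C with ((Cexp (1 * h) - 1 - 1 * h) - (Cexp (0 * h) - 1 - 0 * h))%C.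
  2:{ replace (0 * h)%C with (RtoC 0) by ring. rewrite Cexp_0. replace (1 * h)%C with h by ring. ring. }
  apply (mvt_ineq (fun r => Cexp (r * h) - 1 - r * h)%C (fun r => h * Cexp (r * h) - h)%C); [lra| |].
  - intros r _. destruct (Cexp_line h r) as [A B].
    split; simpl.
    + apply (is_derive_ext (fun r : R => fst (Cexp (r * h)) + (-1 - r * fst h))).
      { intros t; simpl. ring. }
      apply @is_derive_plus; [exact A|]. auto_derive; [exact I|ring].
    + apply (is_derive_ext (fun r : R => snd (Cexp (r * h)) + (- r * snd h))).
      { intros t; simpl. ring. }
      apply @is_derive_plus; [exact B|]. auto_derive; [exact I|ring].
  - intros r Hr. replace (h * Cexp (r * h) - h)%C with (h * (Cexp (r * h) - 1))%C by ring.
    rewrite Cmod_mult. specialize (S1 r Hr). nra.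
Qed.

Lemma is_Cder_Cexp (z : C) : is_Cder Cexp z (Cexp z).
Proof.
  intros e He. assert (Hp := exp_pos (fst z)).
  generalize (near_and _ _ _ (near_close z 1 Rlt_0_1)
    (near_close z (e / (3 * exp (fst z))) ltac:(apply Rdiv_lt_0_compat; lra))).
  apply near_imp. intros w [H1 H2].
  replace (Cexp w) with (Cexp z * Cexp (w - z))%C.
  2:{ rewrite <- Cexp_plus. f_equal. ring. }
  replace (Cexp z * Cexp (w - z) - Cexp z - Cexp z * (w - z))%C with (Cexp z * (Cexp (w - z) - 1 - (w - z)))%C by ring.
  rewrite Cmod_mult, Cmod_Cexp.
  assert (Q := Cexp_quad (w - z)%C ltac:(lra)).
  assert (HN := Cmod_ge_0 (w - z)%C). set (N := Cmod (w - z)%C) in *.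
  apply Rle_trans with (exp (fst z) * (3 * (N * N))); [apply Rmult_le_compat_l; lra|].
  apply (Rmult_lt_compat_l (3 * exp (fst z))) in H2; [|lra].
  replace (3 * exp (fst z) * (e / (3 * exp (fst z)))) with e in H2 by (field; lra).
  nra.
Qed.

Lemma is_Cder_affine (a b z : C) : is_Cder (fun w => a * w + b)%C z a.
Proof.
  intros e He. apply near_true. intros w.
  replace (a * w + b - (a * z + b) - a * (w - z))%C with (RtoC 0) by ring. rewrite Cmod_0.
  apply Rmult_le_pos; [lra|apply Cmod_ge_0].
Qed.

Lemma is_Cder_Cexp_affine (a b z : C) :
  is_Cder (fun w => Cexp (a * w + b)%C) z (a * Cexp (a * z + b))%C.
Proof.
  rewrite Cmult_comm. apply (is_Cder_comp Cexp (fun w => a * w + b)%C).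
  - apply is_Cder_affine.
  - apply is_Cder_Cexp.
Qed.

Lemma hol_Cexp_affine (n : nat) (D : C -> Prop) (a b : C) : Copen D ->
  hol n D (fun w => Cexp (a * w + b)%C).
Proof.
  intros HD. induction n as [|n IH]; [exact I|].
  apply hol_intro with (fun w => a * Cexp (a * w + b))%C; [exact HD| |].
  - intros z _. apply is_Cder_Cexp_affine.
  - apply hol_mult; [exact HD|apply hol_const, HD|exact IH].
Qed.

Lemma hol_cont (n : nat) (D : C -> Prop) (f : C -> C) (z : C) : hol (S n) D f -> D z -> Ccont f z.
Proof. intros [H _] Hz. eapply is_Cder_cont, H, Hz. Qed.

(** * The Laplacian and the maximum principle *)

(** The first derivative is given near [x] by a witness function, so that rules for sums and
    compositions only combine witnesses. *)
Definition is_der2 (phi : R -> R) (x a b : R) : Prop :=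
  exists phi' : R -> R, locally x (fun r => is_derive phi r (phi' r)) /\ phi' x = a /\ is_derive phi' x b.

Lemma is_der2_plus (f g : R -> R) (x a b a' b' : R) : is_der2 f x a b -> is_der2 g x a' b' ->
  is_der2 (fun r => f r + g r) x (a + a') (b + b').
Proof.
  intros [f' [F1 [F2 F3]]] [g' [G1 [G2 G3]]].
  exists (fun r => f' r + g' r). split; [|split].
  - generalize (filter_and _ _ F1 G1). apply filter_imp. intros r [A B].
    apply @is_derive_plus; assumption.
  - lra.
  - apply @is_derive_plus; assumption.
Qed.

Lemma is_der2_ext (f g : R -> R) (x a b : R) : locally x (fun r => f r = g r) ->
  is_der2 f x a b -> is_der2 g x a b.
Proof.
  intros He [f' [F1 [F2 F3]]]. exists f'. split; [|split; assumption].
  apply locally_locally in He.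
  generalize (filter_and _ _ F1 He). apply filter_imp. intros r [A B].
  apply is_derive_ext_loc with f; assumption.
Qed.

Lemma is_der2_exp (f : R -> R) (x a b : R) : is_der2 f x a b ->
  is_der2 (fun r => exp (f r)) x (a * exp (f x)) ((b + a * a) * exp (f x)).
Proof.
  intros [f' [F1 [F2 F3]]]. exists (fun r => f' r * exp (f r)). split; [|split].
  - generalize F1. apply filter_imp. intros r A.
    apply (is_derive_comp exp f); [apply is_derive_exp|exact A].
  - rewrite F2; reflexivity.
  - assert (A := locally_singleton _ _ F1). simpl in A. rewrite F2 in A.
    replace ((b + a * a) * exp (f x)) with (b * exp (f x) + f' x * (a * exp (f x))) by (rewrite F2; ring).
    apply (is_derive_mult f' (fun r => exp (f r))); [exact F3| |intros; apply Rmult_comm].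
    apply (is_derive_comp exp f); [apply is_derive_exp|exact A].
Qed.

Lemma is_der2_ln (f : R -> R) (x a b : R) : is_der2 f x a b -> 0 < f x ->
  is_der2 (fun r => ln (f r)) x (a / f x) ((b * f x - a * a) / (f x * f x)).
Proof.
  intros [f' [F1 [F2 F3]]] Hp.
  assert (A := locally_singleton _ _ F1). simpl in A. rewrite F2 in A.
  assert (Hc : locally x (fun r => 0 < f r)).
  { assert (Hc := ex_derive_continuous f x (ex_intro _ a A)).
    generalize (proj1 (filterlim_locally f (f x)) Hc (mkposreal _ Hp)). apply filter_imp.
    intros r Hr. change (Rabs (f r - f x) < f x) in Hr. apply Rabs_def2 in Hr. lra. }
  exists (fun r => f' r / f r). split; [|split].
  - generalize (filter_and _ _ F1 Hc). apply filter_imp. intros r [B D].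
    apply (is_derive_comp ln f); [apply is_derive_ln; exact D|exact B].
  - rewrite F2; reflexivity.
  - rewrite <- F2. replace (f x * f x) with (f x ^ 2) by ring.
    apply is_derive_div; [exact F3|rewrite F2; exact A|lra].
Qed.

Lemma is_der2_reflect (f : R -> R) (k x a b : R) : is_der2 f (k - x) a b ->
  is_der2 (fun r => f (k - r)) x (- a) b.
Proof.
  intros [f' [F1 [F2 F3]]]. exists (fun r => - f' (k - r)). split; [|split].
  - destruct F1 as [d F1]. exists d. intros r Hr.
    replace (- f' (k - r)) with ((-1) * f' (k - r)) by ring.
    apply (is_derive_comp f (fun r => k - r)).
    + apply F1. change (Rabs (k - r - (k - x)) < d).
      replace (k - r - (k - x)) with (- (r - x)) by ring. rewrite Rabs_Ropp. exact Hr.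
    + auto_derive; [exact I|ring].
  - rewrite F2. reflexivity.
  - replace b with (- ((-1) * b)) by ring.
    apply (is_derive_opp (fun r => f' (k - r))).
    apply (is_derive_comp f' (fun r => k - r)); [exact F3|auto_derive; [exact I|ring]].
Qed.

Lemma is_der2_affine (p q x : R) : is_der2 (fun r => p * r + q) x p 0.
Proof.
  exists (fun _ => p). split; [|split].
  - apply filter_forall. intros r. auto_derive; [exact I|ring].
  - reflexivity.
  - auto_derive; [exact I|ring].
Qed.

Lemma is_der2_const (q x : R) : is_der2 (fun r => q) x 0 0.
Proof.
  eapply is_der2_ext; [|apply (is_der2_affine 0 q)]. apply filter_forall. intros; ring.
Qed.

(** The first derivative vanishes at the maximum; if [b] were positive, it would be positive just to
    the right of [x] and [f] would increase there. *)
Lemma is_der2_max (f : R -> R) (x a b : R) : is_der2 f x a b ->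
  locally x (fun r => f r <= f x) -> b <= 0.
Proof.
  intros [f' [F1 [F2 F3]]] Hm.
  assert (Ha : f' x = 0).
  { assert (A := locally_singleton _ _ F1). simpl in A.
    destruct Hm as [d Hm].
    apply is_derive_Reals in A.
    assert (pr : derivable_pt f x) by (exists (f' x); exact A).
    assert (E : derive_pt f x pr = f' x) by (apply derive_pt_eq; exact A).
    rewrite <- E.
    apply (deriv_maximum f (x - d) (x + d) x pr); generalize (cond_pos d); intros; try lra.
    apply Hm. apply Rabs_lt_between'. simpl in *. split; lra. }
  apply Rnot_lt_le. intros Hb.
  apply is_derive_Reals in F3. destruct (F3 (b / 2)) as [e He]; [lra|].
  destruct F1 as [d1 F1]. destruct Hm as [d2 Hm].
  set (h := Rmin e (Rmin d1 d2) / 2).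
  assert (Hh : 0 < h /\ h < e /\ h < d1 /\ h < d2).
  { assert (0 < Rmin e (Rmin d1 d2)) by (repeat apply Rmin_pos; apply cond_pos).
    generalize (Rmin_l e (Rmin d1 d2)) (Rmin_r e (Rmin d1 d2)) (Rmin_l d1 d2) (Rmin_r d1 d2).
    unfold h. lra. }
  destruct (MVT_cor2 f f' x (x + h)) as [c [Hfc Hc]]; [lra| |].
  - intros r Hr. apply is_derive_Reals, F1. change (Rabs (r - x) < d1). apply Rabs_def1; lra.
  - assert (Hle : f (x + h) <= f x).
    { apply Hm. change (Rabs (x + h - x) < d2). apply Rabs_def1; lra. }
    assert (Hc0 : f' c <= 0) by nra.
    assert (Hk := He (c - x) ltac:(lra)). rewrite Ha in Hk.
    replace (x + (c - x)) with c in Hk by ring.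
    specialize (Hk ltac:(apply Rabs_def1; lra)). apply Rabs_def2 in Hk.
    assert ((f' c - 0) / (c - x) <= 0).
    { unfold Rdiv. assert (0 < / (c - x)) by (apply Rinv_0_lt_compat; lra). nra. }
    lra.
Qed.

Definition is_lap (h : C -> R) (p : C) (v : R) : Prop :=
  exists a b a' b', is_der2 (fun r => h (r, snd p)) (fst p) a b /\
    is_der2 (fun r => h (fst p, r)) (snd p) a' b' /\ v = b + b'.

(** Also records the squared norm of the gradient, which enters the Laplacian of a logarithm
    ([is_lap_ln]). *)
Definition is_lap_grad (h : C -> R) (p : C) (v g : R) : Prop :=
  exists a b a' b', is_der2 (fun r => h (r, snd p)) (fst p) a b /\
    is_der2 (fun r => h (fst p, r)) (snd p) a' b' /\ v = b + b' /\ g = a * a + a' * a'.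

Lemma is_lap_grad_lap (h : C -> R) (p : C) (v g : R) : is_lap_grad h p v g -> is_lap h p v.
Proof. intros [a [b [a' [b' [H1 [H2 [H3 H4]]]]]]]. exists a, b, a', b'. auto. Qed.

Lemma is_lap_ex_grad (h : C -> R) (p : C) (v : R) : is_lap h p v -> exists g, 0 <= g /\ is_lap_grad h p v g.
Proof.
  intros [a [b [a' [b' [H1 [H2 H3]]]]]]. exists (a * a + a' * a'). split; [nra|].
  exists a, b, a', b'. auto.
Qed.

Lemma is_lap_plus (f g : C -> R) (p : C) (u v : R) : is_lap f p u -> is_lap g p v ->
  is_lap (fun z => f z + g z) p (u + v).
Proof.
  intros [a [b [a' [b' [H1 [H2 H3]]]]]] [c [d [c' [d' [K1 [K2 K3]]]]]].
  exists (a + c), (b + d), (a' + c'), (b' + d'). split; [|split].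
  - apply is_der2_plus; assumption.
  - apply is_der2_plus; assumption.
  - lra.
Qed.

Lemma near_slice_x (p : C) (P : C -> Prop) : near p P -> locally (fst p) (fun r => P (r, snd p)).
Proof.
  intros [d [Hd H]]. exists (mkposreal d Hd). intros r Hr. apply H.
  eapply Rle_lt_trans; [apply Cmod_le_abs|]. destruct p as [x y]; simpl.
  replace (y + - y) with 0 by ring. rewrite Rabs_R0, Rplus_0_r. exact Hr.
Qed.

Lemma near_slice_y (p : C) (P : C -> Prop) : near p P -> locally (snd p) (fun r => P (fst p, r)).
Proof.
  intros [d [Hd H]]. exists (mkposreal d Hd). intros r Hr. apply H.
  eapply Rle_lt_trans; [apply Cmod_le_abs|]. destruct p as [x y]; simpl.
  replace (x + - x) with 0 by ring. rewrite Rabs_R0, Rplus_0_l. exact Hr.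
Qed.

Lemma is_lap_ext (f g : C -> R) (p : C) (v : R) : near p (fun z => f z = g z) ->
  is_lap f p v -> is_lap g p v.
Proof.
  intros He [a [b [a' [b' [H1 [H2 H3]]]]]]. exists a, b, a', b'. split; [|split; [|exact H3]].
  - eapply is_der2_ext; [|exact H1]. apply (near_slice_x p (fun z => f z = g z) He).
  - eapply is_der2_ext; [|exact H2]. apply (near_slice_y p (fun z => f z = g z) He).
Qed.

Lemma is_lap_exp (f : C -> R) (p : C) (u : R) : is_lap f p u -> 0 <= u ->
  exists v, 0 <= v /\ is_lap (fun z => exp (f z)) p v.
Proof.
  intros [a [b [a' [b' [H1 [H2 H3]]]]]] Hu.
  exists ((b + a * a) * exp (f p) + (b' + a' * a') * exp (f p)).
  split.
  - generalize (exp_pos (f p)). nra.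
  - exists (a * exp (f p)), ((b + a * a) * exp (f p)), (a' * exp (f p)), ((b' + a' * a') * exp (f p)).
    split; [|split; [|reflexivity]].
    + apply is_der2_exp in H1. destruct p; exact H1.
    + apply is_der2_exp in H2. destruct p; exact H2.
Qed.

Lemma is_lap_ln (f : C -> R) (p : C) (u g : R) : is_lap_grad f p u g -> 0 < f p ->
  is_lap (fun z => ln (f z)) p (u / f p - g / (f p * f p)).
Proof.
  intros [a [b [a' [b' [H1 [H2 [H3 H4]]]]]]] Hp.
  apply is_der2_ln in H1; [|destruct p; exact Hp]. apply is_der2_ln in H2; [|destruct p; exact Hp].
  assert (E : f (fst p, snd p) = f p) by (destruct p; reflexivity). rewrite E in H1, H2.
  do 4 eexists. split; [exact H1|split; [exact H2|]]. rewrite H3, H4. field. lra.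
Qed.

Lemma is_lap_scal (f : C -> R) (k : R) (p : C) (u g : R) : is_lap_grad f p u g ->
  is_lap_grad (fun z => k * f z) p (k * u) (k * k * g).
Proof.
  assert (S : forall phi x a b, is_der2 phi x a b -> is_der2 (fun r => k * phi r) x (k * a) (k * b)).
  { intros phi x a b [f' [F1 [F2 F3]]]. exists (fun r => k * f' r). split; [|split].
    - generalize F1. apply filter_imp. intros r A. apply is_derive_scal, A.
    - rewrite F2; reflexivity.
    - apply is_derive_scal, F3. }
  intros [a [b [a' [b' [H1 [H2 [H3 H4]]]]]]].
  exists (k * a), (k * b), (k * a'), (k * b'). split; [apply S, H1|split; [apply S, H2|]].
  split; [rewrite H3|rewrite H4]; ring.
Qed.

Lemma is_lap_opp (f : C -> R) (p : C) (u : R) : is_lap f p u -> is_lap (fun z => - f z) p (- u).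
Proof.
  intros H. destruct (is_lap_ex_grad _ _ _ H) as [g [_ Hg]].
  apply is_lap_ext with (fun z => (-1) * f z).
  - apply near_true. intros; ring.
  - replace (- u) with ((-1) * u) by ring. eapply is_lap_grad_lap, is_lap_scal, Hg.
Qed.

Lemma is_lap_reflect (f : C -> R) (k : R) (p : C) (u : R) : is_lap f (k - fst p, snd p) u ->
  is_lap (fun z => f (k - fst z, snd z)) p u.
Proof.
  intros [a [b [a' [b' [H1 [H2 H3]]]]]]. simpl in *.
  exists (- a), b, a', b'. split; [|split; [exact H2|exact H3]].
  apply (is_der2_reflect (fun r => f (r, snd p))). exact H1.
Qed.

Lemma is_lap_max (h : C -> R) (p : C) (v : R) : is_lap h p v -> near p (fun z => h z <= h p) -> v <= 0.
Proof.
  intros [a [b [a' [b' [H1 [H2 H3]]]]]] Hm.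
  assert (A : b <= 0).
  { apply (is_der2_max _ _ _ _ H1). generalize (near_slice_x p _ Hm). destruct p; auto. }
  assert (B : b' <= 0).
  { apply (is_der2_max _ _ _ _ H2). generalize (near_slice_y p _ Hm). destruct p; auto. }
  lra.
Qed.

(** [q] is the conjugate gradient [h_x - i h_y]. Its Cauchy-Riemann equations make the two pure
    second derivatives of [h] opposite, and [|q|^2] is the squared gradient. *)
Lemma is_lap_conj_grad (h : C -> R) (q : C -> C) (p l : C) :
  near p (fun z => is_derive (fun r => h (r, snd z)) (fst z) (fst (q z)) /\
                   is_derive (fun r => h (fst z, r)) (snd z) (- snd (q z))) ->
  is_Cder q p l -> is_lap_grad h p 0 (Cmod (q p) * Cmod (q p)).
Proof.
  intros Hn Hq.
  destruct p as [x y]. destruct (is_Cder_x _ _ _ _ Hq) as [X1 X2]. destruct (is_Cder_y _ _ _ _ Hq) as [Y1 Y2].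
  exists (fst (q (x, y))), (fst l), (- snd (q (x, y))), (- fst l). split; [|split; [|split]].
  - exists (fun r => fst (q (r, y))). split; [|split; [reflexivity|exact X1]].
    generalize (near_slice_x _ _ Hn). apply filter_imp. simpl. intros r [A _]. exact A.
  - exists (fun r => - snd (q (x, r))). split; [|split; [reflexivity|]].
    + generalize (near_slice_y _ _ Hn). apply filter_imp. simpl. intros r [_ A]. exact A.
    + replace (- fst l) with (- snd (Ci * l)%C) by (simpl; ring).
      apply (is_derive_opp (fun r => snd (q (x, r)))). exact Y2.
  - ring.
  - rewrite Cmod_sq. ring.
Qed.

Lemma is_lap_Re (D : C -> Prop) (f : C -> C) (p : C) : Copen D -> D p -> hol 2 D f ->
  is_lap_grad (fun z => fst (f z)) p 0 (Cmod (Dc f p) * Cmod (Dc f p)).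
Proof.
  intros HD Hp [H1 [H2 _]].
  apply is_lap_conj_grad with (l := Dc (Dc f) p); [|apply H2, Hp].
  generalize (HD p Hp). apply near_imp. intros z Hz. specialize (H1 z Hz).
  destruct z as [x y]. split.
  - apply (is_Cder_x _ _ _ _ H1).
  - destruct (is_Cder_y _ _ _ _ H1) as [A _].
    replace (- snd (Dc f (x, y))) with (fst (Ci * Dc f (x, y))%C); [exact A|].
    unfold Cmult, Ci; cbn -[Dc]. ring.
Qed.

Lemma is_derive_ln_Cmod (phi : R -> C) (x : R) (l : C) : is_Rder phi x l -> phi x <> 0%C ->
  is_derive (fun r => ln (Cmod (phi r))) x (fst (l / phi x)%C).
Proof.
  intros [H1 H2] H0. apply Cmod_gt_0 in H0. assert (Hs := Cmod_sq (phi x)).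
  assert (Hpos : 0 < fst (phi x) * fst (phi x) + snd (phi x) * snd (phi x)) by nra.
  assert (Hloc : is_derive (fun r => fst (phi r) * fst (phi r) + snd (phi r) * snd (phi r)) x
     (2 * (fst l * fst (phi x) + snd l * snd (phi x)))).
  { replace (2 * (fst l * fst (phi x) + snd l * snd (phi x)))
      with ((fst l * fst (phi x) + fst (phi x) * fst l) + (snd l * snd (phi x) + snd (phi x) * snd l)) by ring.
    apply @is_derive_plus.
    - apply (is_derive_mult (fun r => fst (phi r)) (fun r => fst (phi r))); [exact H1|exact H1|intros; apply Rmult_comm].
    - apply (is_derive_mult (fun r => snd (phi r)) (fun r => snd (phi r))); [exact H2|exact H2|intros; apply Rmult_comm]. }
  set (N := fun r => fst (phi r) * fst (phi r) + snd (phi r) * snd (phi r)) in *.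
  replace (fst (l / phi x)%C) with ((2 * (fst l * fst (phi x) + snd l * snd (phi x))) * (/ (2 * sqrt (N x)) * / sqrt (N x))).
  - apply (is_derive_ext (fun r : R => ln (sqrt (N r)))).
    { intros r. unfold N, Cmod. do 2 f_equal. ring. }
    apply (is_derive_comp (fun v => ln (sqrt v)) N); [|exact Hloc].
    assert (0 < sqrt (N x)) by (apply sqrt_lt_R0; exact Hpos).
    auto_derive; [repeat split; assumption|field; lra].
  - assert (E : sqrt (N x) * sqrt (N x) = N x) by (apply sqrt_sqrt; left; exact Hpos).
    replace (/ (2 * sqrt (N x)) * / sqrt (N x)) with (/ (2 * N x)).
    2:{ rewrite <- E at 1. assert (0 < sqrt (N x)) by (apply sqrt_lt_R0; exact Hpos). field; lra. }
    unfold Cdiv, Cmult, Cinv, N; simpl. field. lra.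
Qed.

(** The conjugate gradient of [ln |f|] is [f'/f], which is differentiable where [f] is nonzero. *)
Lemma is_lap_ln_Cmod (D : C -> Prop) (f : C -> C) (p : C) : Copen D -> D p -> hol 2 D f -> f p <> 0%C ->
  is_lap_grad (fun z => ln (Cmod (f z))) p 0 (Cmod (Dc f p / f p)%C * Cmod (Dc f p / f p)%C).
Proof.
  intros HD Hp [H1 [H2 _]] H0.
  apply (is_lap_conj_grad _ (fun z => Dc f z / f z)%C p (Dc (Dc f) p * / f p + Dc f p * (- Dc f p * (/ f p * / f p)))%C).
  - generalize (near_and _ _ _ (HD p Hp) (near_nonzero _ _ (is_Cder_cont _ _ _ (H1 p Hp)) H0)).
    apply near_imp. intros z [Hz Hn]. specialize (H1 z Hz).
    assert (Hf0 : f z <> 0%C) by (apply Cmod_gt_0; generalize (Cmod_ge_0 (f p)); lra).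
    destruct z as [x y]. split.
    + apply (is_derive_ln_Cmod (fun r => f (r, y))); [apply is_Cder_x, H1|exact Hf0].
    + assert (A := is_derive_ln_Cmod (fun r => f (x, r)) y _ (is_Cder_y _ _ _ _ H1) Hf0).
      replace (- snd (Dc f (x, y) / f (x, y))%C) with (fst ((Ci * Dc f (x, y)) / f (x, y))%C); [exact A|].
      unfold Cdiv, Cmult, Cinv, Ci; simpl. ring.
  - apply (is_Cder_mult (Dc f) (fun z => / f z)%C); [apply H2, Hp|].
    apply (is_Cder_inv f); [apply H1, Hp|exact H0].
Qed.

(** * Extreme values and the maximum principle on rectangles *)

Definition rect (x1 x2 y1 y2 : R) (z : C) : Prop := x1 <= fst z <= x2 /\ y1 <= snd z <= y2.

Definition Rcont (h : C -> R) (z : C) : Prop :=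
  forall eps, 0 < eps -> near z (fun w => Rabs (h w - h z) < eps).

Lemma list_max (l : list C) (P : C -> Prop) (W : C -> R) (p0 : C) : P p0 ->
  (forall z, In z l -> P z) -> exists p, P p /\ W p0 <= W p /\ forall z, In z l -> W z <= W p.
Proof.
  intros H0. induction l as [|a l IH]; intros H.
  - exists p0. split; [exact H0|]. split; [lra|]. intros z [].
  - destruct IH as [p [P1 [P2 P3]]]; [intros; apply H; right; assumption|].
    destruct (Rle_dec (W a) (W p)) as [L|L].
    + exists p. split; [exact P1|]. split; [exact P2|]. intros z [E|E]; [subst; exact L|apply P3, E].
    + exists a. split; [apply H; left; reflexivity|]. split; [lra|].
      intros z [E|E]; [subst; lra|]. specialize (P3 z E). lra.
Qed.

(** By contradiction: each [p] then has a better point [Q p] and, by continuity, a neighbourhood on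
    which [W] stays below [W (Q p)]. Finitely many neighbourhoods cover, and the best of the
    corresponding points lies in one of them, so another one beats it. *)
Lemma rect_max (W : C -> R) (x1 x2 y1 y2 : R) : x1 <= x2 -> y1 <= y2 ->
  (forall z, rect x1 x2 y1 y2 z -> Rcont W z) ->
  exists p, rect x1 x2 y1 y2 p /\ forall z, rect x1 x2 y1 y2 z -> W z <= W p.
Proof.
  intros Hx Hy Hc. apply NNPP. intros HN.
  assert (Hq : forall p, exists q, rect x1 x2 y1 y2 p -> rect x1 x2 y1 y2 q /\ W p < W q).
  { intros p. apply NNPP. intros Hn. apply HN. exists p.
    assert (Hp : rect x1 x2 y1 y2 p).
    { apply NNPP. intros Hp. apply Hn. exists p. intros. contradiction. }
    split; [exact Hp|].
    intros z Hz. apply Rnot_lt_le. intros Hlt. apply Hn. exists z. intros _. split; assumption. }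
  apply ClassicalChoice.choice in Hq. destruct Hq as [Q HQ].
  assert (Hd : forall p : C, exists d : posreal, rect x1 x2 y1 y2 p ->
     forall w, Rabs (fst w - fst p) < d -> Rabs (snd w - snd p) < d -> W w < W (Q p)).
  { intros p. destruct (classic (rect x1 x2 y1 y2 p)) as [Hp|Hp].
    - destruct (HQ p Hp) as [_ Hlt]. destruct (Hc p Hp (W (Q p) - W p)) as [d [Hd Hw]]; [lra|].
      exists (mkposreal (d / 2) ltac:(lra)). simpl. intros _ w A B.
      assert (Hcm : Cmod (w - p)%C < d).
      { eapply Rle_lt_trans; [apply Cmod_le_abs|]. simpl. unfold Rminus in *. lra. }
      specialize (Hw w Hcm). apply Rabs_def2 in Hw. lra.
    - exists (mkposreal 1 Rlt_0_1). intros; contradiction. }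
  apply ClassicalChoice.choice in Hd. destruct Hd as [dl Hdl].
  apply (compactness_list 2 (x1, (y1, tt)) (x2, (y2, tt))
     (fun t => dl (fst t, fst (snd t)))).
  intros [l Hl].
  (* The finite cover may have centres outside the rectangle, where [Q] is arbitrary; they are
     discarded. *)
  set (l' := map (fun t : Compactness.Tn 2 R => Q (fst t, fst (snd t)))
     (filter (fun t => if excluded_middle_informative (rect x1 x2 y1 y2 (fst t, fst (snd t))) then true else false) l)).
  assert (HP : forall z, In z l' -> rect x1 x2 y1 y2 z).
  { intros z Hz. unfold l' in Hz. apply in_map_iff in Hz. destruct Hz as [t [E Ht]].
    apply filter_In in Ht. destruct Ht as [_ Ht].
    destruct (excluded_middle_informative (rect x1 x2 y1 y2 (fst t, fst (snd t)))) as [R|R]; [|discriminate].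
    subst z. apply (HQ _ R). }
  destruct (list_max l' (rect x1 x2 y1 y2) W (x1, y1)) as [p [P1 [_ P3]]].
  - split; simpl; lra.
  - exact HP.
  - destruct (Hl (fst p, (snd p, tt))) as [[tx [ty []]] [Hin [Hb Hcl]]].
    + destruct P1 as [A B]. simpl. auto.
    + simpl in Hb, Hcl. destruct Hb as [B1 [B2 _]]. destruct Hcl as [C1 [C2 _]].
      assert (R : rect x1 x2 y1 y2 (tx, ty)) by (split; simpl; assumption).
      assert (Hlt := Hdl (tx, ty) R p C1 C2).
      assert (Hin' : In (Q (tx, ty)) l').
      { unfold l'. apply in_map_iff. exists (tx, (ty, tt)). split; [reflexivity|].
        apply filter_In. split; [exact Hin|]. simpl.
        destruct (excluded_middle_informative (rect x1 x2 y1 y2 (tx, ty))); [reflexivity|contradiction]. }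
      specialize (P3 _ Hin'). lra.
Qed.

Definition rint (x1 x2 y1 y2 : R) (z : C) : Prop := x1 < fst z < x2 /\ y1 < snd z < y2.

Lemma rint_near (x1 x2 y1 y2 : R) (z : C) : rint x1 x2 y1 y2 z -> near z (rint x1 x2 y1 y2).
Proof.
  intros [[A1 A2] [B1 B2]].
  exists (Rmin (Rmin (fst z - x1) (x2 - fst z)) (Rmin (snd z - y1) (y2 - snd z))).
  split; [repeat apply Rmin_pos; lra|]. intros w Hw.
  assert (F := fst_le_Cmod (w - z)%C). assert (S := snd_le_Cmod (w - z)%C). simpl in F, S.
  fold (fst w - fst z) in F. fold (snd w - snd z) in S.
  generalize (Rmin_l (Rmin (fst z - x1) (x2 - fst z)) (Rmin (snd z - y1) (y2 - snd z)))
    (Rmin_r (Rmin (fst z - x1) (x2 - fst z)) (Rmin (snd z - y1) (y2 - snd z)))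
    (Rmin_l (fst z - x1) (x2 - fst z)) (Rmin_r (fst z - x1) (x2 - fst z))
    (Rmin_l (snd z - y1) (y2 - snd z)) (Rmin_r (snd z - y1) (y2 - snd z)). intros.
  assert (F1 : Rabs (fst w - fst z) < Rmin (fst z - x1) (x2 - fst z)) by lra.
  assert (S1 : Rabs (snd w - snd z) < Rmin (snd z - y1) (y2 - snd z)) by lra.
  apply Rabs_def2 in F1. apply Rabs_def2 in S1. unfold rint. lra.
Qed.

Lemma rect_interior_or_boundary (x1 x2 y1 y2 : R) (z : C) : rect x1 x2 y1 y2 z ->
  rint x1 x2 y1 y2 z \/ (fst z = x1 \/ fst z = x2 \/ snd z = y1 \/ snd z = y2).
Proof.
  intros [[A1 A2] [B1 B2]]. unfold rint.
  destruct (Req_dec (fst z) x1), (Req_dec (fst z) x2), (Req_dec (snd z) y1), (Req_dec (snd z) y2); auto.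
  left. lra.
Qed.

Lemma Rcont_x2 (z : C) : Rcont (fun w => fst w * fst w) z.
Proof.
  intros e He. set (k := Rabs (fst z) + 1). assert (Hk : 0 < k) by (unfold k; generalize (Rabs_pos (fst z)); lra).
  generalize (near_and _ _ _ (near_close z 1 Rlt_0_1) (near_close z (e / (2 * k)) ltac:(apply Rdiv_lt_0_compat; lra))).
  apply near_imp. intros w [H1 H2].
  assert (F := fst_le_Cmod (w - z)%C). simpl in F. fold (fst w - fst z) in F.
  replace (fst w * fst w - fst z * fst z) with ((fst w - fst z) * ((fst w - fst z) + 2 * fst z)) by ring.
  rewrite Rabs_mult.
  assert (G : Rabs ((fst w - fst z) + 2 * fst z) <= 2 * k).
  { eapply Rle_trans; [apply Rabs_triang|]. rewrite Rabs_mult, (Rabs_right 2) by lra. unfold k.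
    generalize (Rabs_pos (fst z)); lra. }
  apply Rle_lt_trans with (Rabs (fst w - fst z) * (2 * k)).
  - apply Rmult_le_compat_l; [apply Rabs_pos|exact G].
  - apply Rlt_le_trans with (e / (2 * k) * (2 * k)); [apply Rmult_lt_compat_r; lra|].
    right; field; lra.
Qed.

Lemma Rcont_plus (f g : C -> R) (z : C) : Rcont f z -> Rcont g z -> Rcont (fun w => f w + g w) z.
Proof.
  intros Hf Hg e He. generalize (near_and _ _ _ (Hf (e/2) ltac:(lra)) (Hg (e/2) ltac:(lra))).
  apply near_imp. intros w [H1 H2].
  replace (f w + g w - (f z + g z)) with ((f w - f z) + (g w - g z)) by ring.
  eapply Rle_lt_trans; [apply Rabs_triang|]. lra.
Qed.

Lemma Rcont_scal (k : R) (f : C -> R) (z : C) : Rcont f z -> Rcont (fun w => k * f w) z.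
Proof.
  intros Hf e He. assert (Hk := Rabs_pos k).
  generalize (Hf (e / (Rabs k + 1)) ltac:(apply Rdiv_lt_0_compat; lra)).
  apply near_imp. intros w H1.
  replace (k * f w - k * f z) with (k * (f w - f z)) by ring. rewrite Rabs_mult.
  apply Rle_lt_trans with ((Rabs k) * (e / (Rabs k + 1))).
  - apply Rmult_le_compat_l; lra.
  - apply Rmult_lt_reg_r with (Rabs k + 1); [lra|]. field_simplify; nra.
Qed.

Lemma is_lap_x2 (k : R) (p : C) : is_lap (fun w => k * (fst w * fst w)) p (2 * k).
Proof.
  exists (2 * k * fst p), (2 * k), 0, 0. split; [|split; [|ring]].
  - exists (fun r => 2 * k * r). simpl. split; [|split; [reflexivity|]].
    + apply filter_forall. intros r. auto_derive; [exact I|ring].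
    + auto_derive; [exact I|ring].
  - simpl. apply (is_der2_const (k * (fst p * fst p))).
Qed.

(** The Laplacian has to be nonnegative only where [W > m]; at the zeros of an analytic factor,
    where [ln |f|] is singular, [W] is small and nothing is asked. Adding [k x^2] makes the
    Laplacian positive, which excludes an interior maximum above [m]. *)
Lemma max_principle (W : C -> R) (x1 x2 y1 y2 m : R) : x1 <= x2 -> y1 <= y2 ->
  (forall z, rect x1 x2 y1 y2 z -> Rcont W z) ->
  (forall z, rect x1 x2 y1 y2 z -> fst z = x1 \/ fst z = x2 \/ snd z = y1 \/ snd z = y2 -> W z <= m) ->
  (forall z, rint x1 x2 y1 y2 z -> m < W z -> exists v, 0 <= v /\ is_lap W z v) ->
  forall z, rect x1 x2 y1 y2 z -> W z <= m.
Proof.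
  intros Hx Hy Hc Hb Hl z0 Hz0. apply Rnot_lt_le. intros Hlt.
  set (S := x1 * x1 + x2 * x2 + 1). assert (HS : 0 < S) by (unfold S; nra).
  (* On the rectangle [k x^2] is at most [k S], half the excess of [W z0] over [m], so [W] still
     exceeds [m] at the maximum of the perturbed function. *)
  set (k := (W z0 - m) / (2 * S)). assert (Hk : 0 < k) by (apply Rdiv_lt_0_compat; lra).
  assert (HkS : k * S = (W z0 - m) / 2) by (unfold k; field; lra).
  assert (Hsq : forall z, rect x1 x2 y1 y2 z -> 0 <= k * (fst z * fst z) <= k * S).
  { intros z [[A1 A2] _]. assert (fst z * fst z <= S).
    { unfold S. destruct (Rle_dec 0 (fst z)); nra. }
    assert (0 <= fst z * fst z) by nra. split; nra. }
  destruct (rect_max (fun z => W z + k * (fst z * fst z)) x1 x2 y1 y2 Hx Hy) as [p [Hp Hmax]].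
  - intros z Hz. apply Rcont_plus; [apply Hc, Hz|]. apply Rcont_scal, Rcont_x2.
  - assert (H0 := Hmax z0 Hz0). simpl in H0.
    assert (Q0 := Hsq z0 Hz0). assert (Qp := Hsq p Hp).
    assert (Hpm : m < W p) by lra.
    destruct (rect_interior_or_boundary _ _ _ _ _ Hp) as [Hi|Hbd].
    + destruct (Hl p Hi Hpm) as [v [Hv Hlap]].
      assert (Hlap2 := is_lap_plus _ _ _ _ _ Hlap (is_lap_x2 k p)).
      assert (v + 2 * k <= 0).
      { apply (is_lap_max _ _ _ Hlap2). generalize (rint_near _ _ _ _ _ Hi). apply near_imp.
        intros w [[A1 A2] [B1 B2]]. apply Hmax. split; lra. }
      lra.
    + specialize (Hb p Hp Hbd). lra.
Qed.

(** Serves to let an auxiliary parameter, such as the distance of a rectangle from the critical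
    line, tend to 0 in an inequality. *)
Lemma limit_ge (g : R -> R) (x d : R) : ex_derive g 0 -> 0 < d ->
  (forall e, 0 < e < d -> x <= g e) -> x <= g 0.
Proof.
  intros Hg Hd H. apply Rnot_lt_le. intros Hlt.
  assert (Hc := ex_derive_continuous g 0 Hg).
  assert (He : 0 < x - g 0) by lra.
  destruct (proj1 (filterlim_locally g (g 0)) Hc (mkposreal _ He)) as [dl Hdl].
  set (e := Rmin d dl / 2).
  assert (0 < Rmin d dl) by (apply Rmin_pos; [exact Hd|apply cond_pos]).
  generalize (Rmin_l d dl) (Rmin_r d dl). intros M1 M2.
  assert (Hb : ball (0 : R) dl e).
  { change (Rabs (e - 0) < dl). unfold e. apply Rabs_def1; lra. }
  specialize (Hdl e Hb). change (Rabs (g e - g 0) < x - g 0) in Hdl. apply Rabs_def2 in Hdl.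
  specialize (H e). unfold e in *. lra.
Qed.

Lemma Cmod_eq_0_sub (z w : C) : Cmod (z - w)%C = 0 -> z = w.
Proof. intros H. apply Cmod_eq_0 in H. replace z with ((z - w) + w)%C by ring. rewrite H. ring. Qed.

Lemma Rcont_Cmod (f : C -> C) (z : C) : Ccont f z -> Rcont (fun w => Cmod (f w)) z.
Proof.
  intros Hf e He. generalize (Hf e He). apply near_imp. intros w Hw.
  assert (A := Cmod_triangle_inv (f w) (f z)). assert (B := Cmod_triangle_inv (f z) (f w)).
  rewrite Cmod_minus_sym in B. apply Rabs_def1; lra.
Qed.

Lemma Rcont_const (k : R) (z : C) : Rcont (fun _ => k) z.
Proof. intros e He. apply near_true. intros w. rewrite Rminus_diag, Rabs_R0. exact He. Qed.

Lemma Rcont_mult (f g : C -> R) (z : C) : Rcont f z -> Rcont g z -> Rcont (fun w => f w * g w) z.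
Proof.
  intros Hf Hg e He.
  set (A := Rabs (f z) + 1). set (B := Rabs (g z) + 1).
  assert (HA : 1 <= A) by (unfold A; generalize (Rabs_pos (f z)); lra).
  assert (HB : 1 <= B) by (unfold B; generalize (Rabs_pos (g z)); lra).
  generalize (near_and _ _ _ (Hf (e / (2 * B)) ltac:(apply Rdiv_lt_0_compat; lra))
    (near_and _ _ _ (Hg (e / (2 * A)) ltac:(apply Rdiv_lt_0_compat; lra)) (Hg 1 Rlt_0_1))).
  apply near_imp. intros w [H1 [H2 H3]].
  replace (f w * g w - f z * g z) with ((f w - f z) * g w + f z * (g w - g z)) by ring.
  eapply Rle_lt_trans; [apply Rabs_triang|]. rewrite !Rabs_mult.
  assert (HgB : Rabs (g w) <= B).
  { replace (g w) with ((g w - g z) + g z) by ring. eapply Rle_trans; [apply Rabs_triang|]. unfold B; lra. }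
  assert (T1 : Rabs (f w - f z) * Rabs (g w) <= Rabs (f w - f z) * B)
    by (apply Rmult_le_compat_l; [apply Rabs_pos|exact HgB]).
  assert (T2 : Rabs (f z) * Rabs (g w - g z) <= A * Rabs (g w - g z))
    by (apply Rmult_le_compat_r; [apply Rabs_pos|unfold A; lra]).
  apply (Rmult_lt_compat_r B) in H1; [|lra]. apply (Rmult_lt_compat_l A) in H2; [|lra].
  replace (e / (2 * B) * B) with (e / 2) in H1 by (field; lra).
  replace (A * (e / (2 * A))) with (e / 2) in H2 by (field; lra). lra.
Qed.

Lemma Rcont_comp (h : R -> R) (f : C -> R) (z : C) : Rcont f z -> ex_derive h (f z) ->
  Rcont (fun w => h (f w)) z.
Proof.
  intros Hf Hh e He.
  assert (Hc := ex_derive_continuous h (f z) Hh).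
  destruct (proj1 (filterlim_locally h (h (f z))) Hc (mkposreal _ He)) as [d Hd].
  generalize (Hf d (cond_pos d)). apply near_imp. intros w Hw. apply (Hd (f w)). exact Hw.
Qed.

Lemma Rcont_ext_near (f g : C -> R) (z : C) : near z (fun w => f w = g w) -> Rcont f z -> Rcont g z.
Proof.
  intros He Hf e H. assert (Hz := near_at _ _ He). simpl in Hz.
  generalize (near_and _ _ _ He (Hf e H)). apply near_imp. intros w [H1 H2]. rewrite <- H1, <- Hz. exact H2.
Qed.

Lemma Ccont_plus (f g : C -> C) (z : C) : Ccont f z -> Ccont g z -> Ccont (fun w => f w + g w)%C z.
Proof.
  intros Hf Hg e He. generalize (near_and _ _ _ (Hf (e/2) ltac:(lra)) (Hg (e/2) ltac:(lra))).
  apply near_imp. intros w [H1 H2].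
  replace (f w + g w - (f z + g z))%C with ((f w - f z) + (g w - g z))%C by ring.
  eapply Rle_lt_trans; [apply Cmod_triangle|]. lra.
Qed.

Lemma Ccont_const (c z : C) : Ccont (fun _ => c) z.
Proof. eapply is_Cder_cont, is_Cder_const. Qed.

Lemma Rcont_fst (z : C) : Rcont (fun w => fst w) z.
Proof.
  intros e He. generalize (near_close z e He). apply near_imp. intros w Hw.
  eapply Rle_lt_trans; [apply (fst_le_Cmod (w - z)%C)|exact Hw].
Qed.

Lemma Rcont_snd (z : C) : Rcont (fun w => snd w) z.
Proof.
  intros e He. generalize (near_close z e He). apply near_imp. intros w Hw.
  eapply Rle_lt_trans; [apply (snd_le_Cmod (w - z)%C)|exact Hw].
Qed.

Lemma Rcont_Re (f : C -> C) (z : C) : Ccont f z -> Rcont (fun w => fst (f w)) z.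
Proof.
  intros Hf e He. generalize (Hf e He). apply near_imp. intros w Hw.
  eapply Rle_lt_trans; [apply (fst_le_Cmod (f w - f z)%C)|exact Hw].
Qed.

Lemma near_neq_0 (f : C -> C) (z : C) : Ccont f z -> f z <> 0%C -> near z (fun w => f w <> 0%C).
Proof.
  intros Hc H0. generalize (near_nonzero f z Hc H0). apply near_imp. intros w Hw.
  apply Cmod_gt_0. generalize (Cmod_ge_0 (f z)). lra.
Qed.

(** [|g| exp h] is the exponential of [ln |g| + h], and [ln |g|] is harmonic off the zeros. This
    form serves both Schwarz's lemma and the reflection. *)
Lemma is_lap_Cmod_exp (D : C -> Prop) (g : C -> C) (h : C -> R) (p : C) (u : R) :
  Copen D -> D p -> hol 2 D g -> g p <> 0%C -> is_lap h p u -> 0 <= u ->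
  exists v, 0 <= v /\ is_lap (fun z => Cmod (g z) * exp (h z)) p v.
Proof.
  intros HD Hp Hg H0 Hh Hu.
  assert (HL := is_lap_plus _ _ _ _ _ (is_lap_grad_lap _ _ _ _ (is_lap_ln_Cmod D g p HD Hp Hg H0)) Hh).
  destruct (is_lap_exp _ _ _ HL ltac:(lra)) as [v [Hv HL2]].
  exists v. split; [exact Hv|]. eapply is_lap_ext; [|exact HL2].
  generalize (near_neq_0 g p (hol_cont 1 D g p Hg Hp) H0). apply near_imp. intros w Hw.
  apply Cmod_gt_0 in Hw. rewrite exp_plus, exp_ln by exact Hw. reflexivity.
Qed.

(** * Schwarz's lemma and Cauchy's estimate on squares *)

Definition square (c : C) (r : R) : C -> Prop := rect (fst c - r) (fst c + r) (snd c - r) (snd c + r).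

Lemma square_center (c : C) (r : R) : 0 <= r -> square c r c.
Proof. unfold square, rect. intros; lra. Qed.

Lemma Cmod_in_square (c z : C) (r : R) : Cmod (z - c)%C <= r -> square c r z.
Proof.
  intros H. assert (F := fst_le_Cmod (z - c)%C). assert (S := snd_le_Cmod (z - c)%C). simpl in F, S.
  fold (fst z - fst c) in F. fold (snd z - snd c) in S.
  assert (F1 : Rabs (fst z - fst c) <= r) by lra. assert (S1 : Rabs (snd z - snd c) <= r) by lra.
  apply Rabs_le_between in F1. apply Rabs_le_between in S1. unfold square, rect. lra.
Qed.

(** Schwarz's lemma in the form of a Lipschitz bound, by the maximum principle for
    [|f - f(c)| / |z - c|^a] with [a < 1], which vanishes at the centre. *)
Lemma schwarz_square (D : C -> Prop) (f : C -> C) (c : C) (r M : R) :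
  Copen D -> 0 < r -> (forall z, square c r z -> D z) -> hol 2 D f ->
  (forall z, square c r z -> Cmod (f z) <= M) ->
  forall z, square c r z -> Cmod (f z - f c)%C <= 2 * M / r * Cmod (z - c)%C.
Proof.
  intros HD Hr Hsq Hf HM z Hz.
  assert (Hc : square c r c) by (apply square_center; lra).
  assert (HM0 : 0 <= M) by (eapply Rle_trans; [apply Cmod_ge_0|apply (HM c Hc)]).
  destruct (Req_dec (Cmod (z - c)%C) 0) as [E|E].
  { apply Cmod_eq_0_sub in E. subst z. replace (f c - f c)%C with (RtoC 0) by ring.
    rewrite Cmod_0. apply Rmult_le_pos; [|apply Cmod_ge_0].
    apply Rmult_le_pos; [lra|left; apply Rinv_0_lt_compat, Hr]. }
  assert (Ez : 0 < Cmod (z - c)%C) by (generalize (Cmod_ge_0 (z - c)%C); lra).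
  assert (HW : forall a, 0 < a < 1 -> forall w, square c r w ->
     Cmod (f w - f c)%C * exp (- a * ln (Cmod (w - c)%C)) <= 2 * M * exp (- a * ln r)).
  { intros a Ha.
    assert (Hlap : forall p, square c r p -> p <> c ->
      Rcont (fun w => Cmod (f w - f c)%C * exp (- a * ln (Cmod (w - c)%C))) p).
    { intros p Hp Hpc.
      assert (Hpc' : (p - c)%C <> 0%C).
      { intro K. apply Hpc. replace p with ((p - c) + c)%C by ring. rewrite K. ring. }
      apply Rcont_mult.
      - apply Rcont_Cmod. apply Ccont_plus; [apply (hol_cont 1 D); [exact Hf|apply Hsq, Hp]|apply Ccont_const].
      - apply (Rcont_comp (fun v => exp (- a * ln v)) (fun w => Cmod (w - c)%C)).
        + apply Rcont_Cmod. apply Ccont_plus; [eapply is_Cder_cont, is_Cder_id|apply Ccont_const].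
        + apply Cmod_gt_0 in Hpc'. auto_derive. exact Hpc'. }
    apply max_principle; try lra.
    (* At the centre the value is 0 whatever [ln 0] is, and nearby it is at most
       [K |w - c|^(1 - a)]. *)
    - intros p Hp. destruct (classic (p = c)) as [Epc|Epc]; [|apply Hlap; assumption].
      subst p. intros e He.
      destruct Hf as [Hf1 _].
      set (K := Cmod (Dc f c) + 1). assert (HK : 0 < K) by (unfold K; generalize (Cmod_ge_0 (Dc f c)); lra).
      generalize (near_and _ _ _ (is_Cder_lip _ _ _ (Hf1 c (Hsq c Hc)))
        (near_close c (exp (ln (e / K) / (1 - a))) (exp_pos _))).
      apply near_imp. intros w [H1 H2]. fold K in H1.
      replace (f c - f c)%C with (RtoC 0) by ring. rewrite Cmod_0, Rmult_0_l, Rminus_0_r.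
      rewrite Rabs_right. 2:{ apply Rle_ge, Rmult_le_pos; [apply Cmod_ge_0|left; apply exp_pos]. }
      destruct (Req_dec (Cmod (w - c)%C) 0) as [E0|E0].
      + rewrite E0 in H1. rewrite Rmult_0_r in H1.
        assert (E1 : Cmod (f w - f c)%C = 0) by (generalize (Cmod_ge_0 (f w - f c)%C); lra).
        rewrite E1, Rmult_0_l. exact He.
      + assert (Hp' : 0 < Cmod (w - c)%C) by (generalize (Cmod_ge_0 (w - c)%C); lra).
        set (N := Cmod (w - c)%C) in *.
        apply Rle_lt_trans with (K * N * exp (- a * ln N)).
        { apply Rmult_le_compat_r; [left; apply exp_pos|exact H1]. }
        apply ln_increasing in H2; [|exact Hp']. rewrite ln_exp in H2.
        rewrite <- (exp_ln N) at 1 by exact Hp'.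
        rewrite Rmult_assoc, <- exp_plus.
        replace (ln N + - a * ln N) with ((1 - a) * ln N) by ring.
        apply (Rmult_lt_compat_l (1 - a)) in H2; [|lra].
        replace ((1 - a) * (ln (e / K) / (1 - a))) with (ln (e / K)) in H2 by (field; lra).
        apply exp_increasing in H2. rewrite exp_ln in H2 by (apply Rdiv_lt_0_compat; lra).
        apply (Rmult_lt_compat_l K) in H2; [|exact HK].
        replace (K * (e / K)) with e in H2 by (field; lra). exact H2.
    - intros p Hp Hb.
      assert (HN : r <= Cmod (p - c)%C).
      { assert (F := fst_le_Cmod (p - c)%C). assert (S := snd_le_Cmod (p - c)%C). simpl in F, S.
        fold (fst p - fst c) in F. fold (snd p - snd c) in S.
        assert (r <= Rabs (fst p - fst c) \/ r <= Rabs (snd p - snd c)).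
        { destruct Hb as [B|[B|[B|B]]]; rewrite B; [left|left|right|right].
          - rewrite Rabs_left; lra.
          - rewrite Rabs_right; lra.
          - rewrite Rabs_left; lra.
          - rewrite Rabs_right; lra. }
        lra. }
      apply Rmult_le_compat; [apply Cmod_ge_0|left; apply exp_pos| |].
      + eapply Rle_trans; [apply Cmod_triangle|]. rewrite Cmod_opp.
        generalize (HM p Hp) (HM c Hc). lra.
      + assert (L : ln r <= ln (Cmod (p - c)%C)).
        { destruct (Req_dec r (Cmod (p - c)%C)) as [G|G]; [rewrite G; lra|]. left; apply ln_increasing; lra. }
        assert (L2 : - a * ln (Cmod (p - c)%C) <= - a * ln r) by nra.
        destruct L2 as [L2|L2]; [left; apply exp_increasing, L2|rewrite L2; lra].
    - intros p Hp Hlt.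
      assert (Hps : square c r p) by (destruct Hp; split; lra).
      assert (Hne : Cmod (f p - f c)%C <> 0).
      { intro K. rewrite K, Rmult_0_l in Hlt. generalize (exp_pos (- a * ln r)). nra. }
      assert (Hpc : (p - c)%C <> 0%C).
      { intro K. apply Hne. replace p with c; [replace (f c - f c)%C with (RtoC 0) by ring; apply Cmod_0|].
        replace p with ((p - c) + c)%C by ring. rewrite K. ring. }
      apply (is_lap_Cmod_exp D (fun w => f w - f c)%C (fun w => - a * ln (Cmod (w - c)%C)) p 0).
      + exact HD.
      + apply Hsq, Hps.
      + apply hol_minus; [exact HD|exact Hf|apply hol_const, HD].
      + intro K. apply Hne. rewrite K. apply Cmod_0.
      + assert (G : is_lap_grad (fun w => ln (Cmod (w - c)%C)) p 0 (Cmod (Dc (fun w => w - c)%C p / (p - c))%C * Cmod (Dc (fun w => w - c)%C p / (p - c))%C)).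
        { apply (is_lap_ln_Cmod D (fun w => w - c)%C); [exact HD|apply Hsq, Hps| |exact Hpc].
          apply hol_minus; [exact HD|apply hol_id, HD|apply hol_const, HD]. }
        apply (is_lap_scal _ (- a)) in G. rewrite Rmult_0_r in G. eapply is_lap_grad_lap, G.
      + lra. }
  set (b := ln (Cmod (z - c)%C) - ln r).
  (* With [a = 1 - e], the limit [e -> 0] produces the exponent 1. *)
  assert (HL : forall e, 0 < e < 1 -> Cmod (f z - f c)%C <= 2 * M * exp ((1 - e) * b)).
  { intros e He. specialize (HW (1 - e) ltac:(lra) z Hz).
    apply (Rmult_le_compat_r (exp ((1 - e) * ln (Cmod (z - c)%C)))) in HW; [|left; apply exp_pos].
    rewrite !Rmult_assoc, <- !exp_plus in HW.
    replace (- (1 - e) * ln (Cmod (z - c)) + (1 - e) * ln (Cmod (z - c))) with 0 in HW by ring.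
    rewrite exp_0, Rmult_1_r in HW. unfold b. rewrite Rmult_assoc.
    replace ((1 - e) * (ln (Cmod (z - c)) - ln r)) with (- (1 - e) * ln r + (1 - e) * ln (Cmod (z - c))) by ring.
    exact HW. }
  apply (limit_ge (fun e => 2 * M * exp ((1 - e) * b)) _ 1) in HL; [|auto_derive; exact I|lra].
  rewrite Rminus_0_r, Rmult_1_l in HL. unfold b in HL.
  replace (ln (Cmod (z - c)%C) - ln r) with (ln (Cmod (z - c)%C) + - ln r) in HL by ring.
  rewrite exp_plus, exp_Ropp, !exp_ln in HL by assumption.
  replace (2 * M / r * Cmod (z - c)) with (2 * M * (Cmod (z - c) * / r)) by (field; lra). exact HL.
Qed.

(** The Lipschitz bound of [schwarz_square] passes to the derivative at [c]. The factor 2 stems from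
    [|f z - f c| <= 2 M] and is harmless. *)
Lemma cauchy_estimate (D : C -> Prop) (f : C -> C) (c : C) (r M : R) :
  Copen D -> 0 < r -> (forall z, square c r z -> D z) -> hol 2 D f ->
  (forall z, square c r z -> Cmod (f z) <= M) -> Cmod (Dc f c) <= 2 * M / r.
Proof.
  intros HD Hr Hsq Hf HM.
  assert (HL := schwarz_square D f c r M HD Hr Hsq Hf HM).
  apply Rnot_lt_le. intros Hlt. set (e := (Cmod (Dc f c) - 2 * M / r) / 2).
  destruct Hf as [Hf1 _].
  destruct (near_and _ _ _ (near_close c r Hr) (Hf1 c (Hsq c (square_center c r ltac:(lra))) e ltac:(unfold e; lra))) as [d [Hd H]].
  set (w := (c + RtoC (d / 2))%C).
  assert (Ew : Cmod (w - c)%C = d / 2).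
  { unfold w. replace (c + RtoC (d / 2) - c)%C with (RtoC (d / 2)) by ring. rewrite Cmod_R, Rabs_right; lra. }
  destruct (H w ltac:(lra)) as [H1 H2].
  specialize (HL w (Cmod_in_square _ _ _ (Rlt_le _ _ H1))).
  assert (T := Cmod_triangle_inv (Dc f c * (w - c))%C (f w - f c)%C).
  rewrite (Cmod_minus_sym (Dc f c * (w - c)) (f w - f c)), Cmod_mult in T.
  rewrite Ew in T, HL, H2.
  assert ((Cmod (Dc f c) - 2 * M / r - e) * (d / 2) <= 0) by lra.
  unfold e in *. nra.
Qed.

(** * Series of holomorphic functions *)

Definition CSeries (a : nat -> C) : C := (Series (fun n => fst (a n)), Series (fun n => snd (a n))).

Definition summable (a : nat -> C) : Prop := ex_series (fun n => Cmod (a n)).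

Lemma summable_le (a : nat -> C) (B : nat -> R) : (forall n, Cmod (a n) <= B n) -> ex_series B -> summable a.
Proof.
  intros H HB. apply (@ex_series_le R_AbsRing R_CompleteNormedModule _ B); [|exact HB].
  intros n. change (Rabs (Cmod (a n)) <= B n). rewrite Rabs_right; [apply H|apply Rle_ge, Cmod_ge_0].
Qed.

Lemma summable_fst (a : nat -> C) : summable a -> ex_series (fun n => fst (a n)).
Proof.
  apply (@ex_series_le R_AbsRing R_CompleteNormedModule). intros n. apply (fst_le_Cmod (a n)).
Qed.

Lemma summable_snd (a : nat -> C) : summable a -> ex_series (fun n => snd (a n)).
Proof.
  apply (@ex_series_le R_AbsRing R_CompleteNormedModule). intros n. apply (snd_le_Cmod (a n)).
Qed.

Lemma summable_scal (c : C) (a : nat -> C) : summable a -> summable (fun n => c * a n)%C.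
Proof.
  intros Ha. apply summable_le with (fun n => Cmod c * Cmod (a n)).
  - intros n. rewrite Cmod_mult. lra.
  - apply (@ex_series_scal R_AbsRing R_NormedModule (Cmod c)); assumption.
Qed.

Lemma CSeries_ext (a b : nat -> C) : (forall n, a n = b n) -> CSeries a = CSeries b.
Proof. intros H. unfold CSeries. f_equal; apply Series_ext; intros n; rewrite H; reflexivity. Qed.

Lemma CSeries_plus (a b : nat -> C) : summable a -> summable b ->
  CSeries (fun n => a n + b n)%C = (CSeries a + CSeries b)%C.
Proof.
  intros Ha Hb. unfold CSeries, Cplus; simpl. f_equal; apply Series_plus;
    (apply summable_fst || apply summable_snd); assumption.
Qed.

Lemma CSeries_scal (c : C) (a : nat -> C) : summable a -> CSeries (fun n => c * a n)%C = (c * CSeries a)%C.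
Proof.
  intros Ha. assert (F := summable_fst _ Ha). assert (S := summable_snd _ Ha).
  unfold CSeries, Cmult; simpl. f_equal.
  - rewrite Series_minus; [|apply (@ex_series_scal R_AbsRing R_NormedModule (fst c)), F|apply (@ex_series_scal R_AbsRing R_NormedModule (snd c)), S].
    rewrite !Series_scal_l. reflexivity.
  - rewrite Series_plus; [|apply (@ex_series_scal R_AbsRing R_NormedModule (fst c)), S|apply (@ex_series_scal R_AbsRing R_NormedModule (snd c)), F].
    rewrite !Series_scal_l. reflexivity.
Qed.

Lemma CSeries_minus (a b : nat -> C) : summable a -> summable b ->
  CSeries (fun n => a n - b n)%C = (CSeries a - CSeries b)%C.
Proof.
  intros Ha Hb. rewrite (CSeries_ext _ (fun n => a n + (- (1)) * b n)%C) by (intros; ring).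
  rewrite CSeries_plus, CSeries_scal; [ring|exact Hb|exact Ha|apply summable_scal, Hb].
Qed.

Lemma CSeries_bound (a : nat -> C) (B : nat -> R) : (forall n, Cmod (a n) <= B n) -> ex_series B ->
  Cmod (CSeries a) <= Series B.
Proof.
  intros H HB. assert (Ha := summable_le _ _ H HB).
  assert (F := summable_fst _ Ha). assert (S := summable_snd _ Ha).
  set (s := CSeries a).
  assert (HB0 : 0 <= Series B).
  { replace 0 with (Series (fun n => 0 * B n)) by (rewrite Series_scal_l; ring).
    apply Series_le; [|exact HB]. intros n. generalize (H n) (Cmod_ge_0 (a n)). lra. }
  destruct (Req_dec (Cmod s) 0) as [E|E]; [rewrite E; exact HB0|].
  assert (Hs := Cmod_ge_0 s).
  apply Rmult_le_reg_l with (Cmod s); [lra|]. rewrite Cmod_sq.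
  unfold s at 2 4. unfold CSeries; simpl.
  rewrite <- !Series_scal_l, <- Series_plus.
  2: apply (@ex_series_scal R_AbsRing R_NormedModule (fst s)), F.
  2: apply (@ex_series_scal R_AbsRing R_NormedModule (snd s)), S.
  assert (HK : forall n, Rabs (fst s * fst (a n) + snd s * snd (a n)) <= Cmod s * B n).
  { intros n. apply Rle_trans with (Cmod s * Cmod (a n)); [|apply Rmult_le_compat_l; [exact Hs|apply H]].
    apply Rsqr_incr_0_var; [|apply Rmult_le_pos; apply Cmod_ge_0].
    rewrite <- Rsqr_abs. rewrite Rsqr_mult. unfold Rsqr at 2 3. rewrite !Cmod_sq.
    generalize (Rle_0_sqr (fst s * snd (a n) - snd s * fst (a n))). unfold Rsqr; nra. }
  assert (HB2 : ex_series (fun n => Cmod s * B n)) by (apply (@ex_series_scal R_AbsRing R_NormedModule (Cmod s)), HB).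
  eapply Rle_trans; [apply Rle_abs|]. eapply Rle_trans; [apply Series_Rabs|].
  - apply (@ex_series_le R_AbsRing R_CompleteNormedModule _ (fun n => Cmod s * B n)); [|exact HB2].
    intros n. change (Rabs (Rabs (fst s * fst (a n) + snd s * snd (a n))) <= Cmod s * B n).
    rewrite Rabs_Rabsolu. apply HK.
  - apply Series_le; [|exact HB2].
    intros n. split; [apply Rabs_pos|apply HK].
Qed.

(** The Weierstrass majorant criterion, local in [z]; squares serve as neighbourhoods to match
    [cauchy_estimate]. *)
Definition dominated (D : C -> Prop) (a : nat -> C -> C) : Prop :=
  forall z, D z -> exists r B, 0 < r /\ ex_series B /\ (forall w, square z r w -> D w) /\
    forall n w, square z r w -> Cmod (a n w) <= B n.

Lemma square_sub (z w v : C) (r s : R) : square z r w -> square w s v -> square z (r + s) v.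
Proof. unfold square, rect. intros; lra. Qed.

Lemma square_mono (z w : C) (r s : R) : r <= s -> square z r w -> square z s w.
Proof. unfold square, rect. intros; lra. Qed.

Lemma dominated_open (D : C -> Prop) (a : nat -> C -> C) : dominated D a -> Copen D.
Proof.
  intros H z Hz. destruct (H z Hz) as [r [B [Hr [_ [Hs _]]]]]. exists r. split; [exact Hr|].
  intros w Hw. apply Hs, Cmod_in_square. lra.
Qed.

Lemma dominated_summable (D : C -> Prop) (a : nat -> C -> C) (z : C) : dominated D a -> D z ->
  summable (fun n => a n z).
Proof.
  intros H Hz. destruct (H z Hz) as [r [B [Hr [HB [_ Hs]]]]].
  apply summable_le with B; [|exact HB]. intros n. apply Hs, square_center. lra.
Qed.

(** Cauchy's estimate on squares of half the size multiplies the majorant by [4 / r], so domination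
    passes from a series to its derivatives. *)
Lemma dominated_Dc (D : C -> Prop) (a : nat -> C -> C) : dominated D a -> (forall n, hol 2 D (a n)) ->
  dominated D (fun n => Dc (a n)).
Proof.
  intros H Hh z Hz. destruct (H z Hz) as [r [B [Hr [HB [HD Hs]]]]].
  exists (r / 2), (fun n => 2 * / (r / 2) * B n). split; [lra|]. split; [|split].
  - apply (@ex_series_scal R_AbsRing R_NormedModule (2 * / (r / 2))), HB.
  - intros w Hw. apply HD. eapply square_mono; [|exact Hw]. lra.
  - intros n w Hw.
    assert (Hsub : forall v, square w (r / 2) v -> square z r v).
    { intros v Hv. generalize (square_sub _ _ _ _ _ Hw Hv). apply square_mono. lra. }
    eapply Rle_trans; [apply (cauchy_estimate D (a n) w (r / 2) (B n))|].
    + apply (dominated_open _ _ H).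
    + lra.
    + intros v Hv. apply HD, Hsub, Hv.
    + apply Hh.
    + intros v Hv. apply Hs, Hsub, Hv.
    + right. field. lra.
Qed.

Lemma is_Cder_line_at (f : C -> C) (z v l : C) (x : R) : is_Cder f (z + x * v)%C l ->
  is_Rder (fun r : R => f (z + r * v)%C) x (l * v)%C.
Proof.
  intros H. destruct (is_Cder_line _ _ _ v H) as [H1 H2].
  split; apply is_derive_shift; (eapply is_derive_ext; [|first [exact H1|exact H2]]);
    intros t; simpl; do 2 f_equal; unfold Cplus, Cmult, RtoC; simpl; f_equal; ring.
Qed.

Lemma is_Rder_plus (f g : R -> C) (x : R) (a b : C) : is_Rder f x a -> is_Rder g x b ->
  is_Rder (fun r => f r + g r)%C x (a + b)%C.
Proof.
  intros [F1 F2] [G1 G2]. split.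
  - apply (is_derive_plus (fun r => fst (f r)) (fun r => fst (g r))); assumption.
  - apply (is_derive_plus (fun r => snd (f r)) (fun r => snd (g r))); assumption.
Qed.

Lemma is_Rder_lin (c d : C) (x : R) : is_Rder (fun r : R => r * c + d)%C x c.
Proof. split; simpl; (auto_derive; [exact I|ring]). Qed.

Lemma taylor2_bound (D : C -> Prop) (f : C -> C) (z w : C) (r K : R) :
  hol 2 D f -> (forall v, square z r v -> D v) -> (forall v, square z r v -> Cmod (Dc (Dc f) v) <= K) ->
  Cmod (w - z)%C <= r -> Cmod (f w - f z - Dc f z * (w - z))%C <= K * (Cmod (w - z)%C * Cmod (w - z)%C).
Proof.
  intros [H1 [H2 _]] HD HK Hw. set (h := (w - z)%C) in *.
  assert (Hs : forall x, 0 <= x <= 1 -> square z r (z + x * h)%C).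
  { intros x Hx. apply Cmod_in_square. replace (z + x * h - z)%C with (x * h)%C by ring.
    rewrite Cmod_mult, Cmod_R, Rabs_right by lra. generalize (Cmod_ge_0 h). nra. }
  assert (Hh := Cmod_ge_0 h).
  assert (HK0 : 0 <= K) by (eapply Rle_trans; [apply Cmod_ge_0|apply (HK _ (Hs 0 ltac:(lra)))]).
  assert (S1 : forall x, 0 <= x <= 1 -> Cmod (Dc f (z + x * h) - Dc f z)%C <= K * Cmod h).
  { intros x Hx. apply Rle_trans with (K * Cmod h * (x - 0)); [|assert (0 <= K * Cmod h) by nra; nra].
    assert (E0 : Dc f z = Dc f (z + 0 * h)%C) by (f_equal; ring). rewrite E0.
    apply (mvt_ineq (fun r => Dc f (z + r * h)%C) (fun r => Dc (Dc f) (z + r * h) * h)%C); [lra| |].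
    - intros t Ht. apply (is_Cder_line_at (Dc f)). apply H2, HD, Hs. lra.
    - intros t Ht. rewrite Cmod_mult. apply Rmult_le_compat_r; [exact Hh|]. apply HK, Hs. lra. }
  replace (f w - f z - Dc f z * h)%C
    with ((f (z + 1 * h) + (1 * (- Dc f z * h) + 0)) - (f (z + 0 * h) + (0 * (- Dc f z * h) + 0)))%C.
  2:{ replace (z + 0 * h)%C with z by ring. replace (z + 1 * h)%C with w by (unfold h; ring). ring. }
  replace (K * (Cmod h * Cmod h)) with (K * Cmod h * Cmod h * (1 - 0)) by ring.
  apply (mvt_ineq (fun r : R => f (z + r * h) + (r * (- Dc f z * h) + 0))%C (fun r => Dc f (z + r * h) * h + - Dc f z * h)%C); [lra| |].
  - intros t Ht. apply is_Rder_plus; [|apply is_Rder_lin].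
    apply (is_Cder_line_at f). apply H1, HD, Hs. lra.
  - intros t Ht. replace (Dc f (z + t * h) * h + - Dc f z * h)%C with ((Dc f (z + t * h) - Dc f z) * h)%C by ring.
    rewrite Cmod_mult. apply Rmult_le_compat_r; [exact Hh|]. apply S1, Ht.
Qed.

(** The second-order Taylor remainders of the terms are summed, with the majorant of the second
    derivatives as constants. Domination is carried over to the derivative twice, each time through
    [hol 2], hence [hol 3]. *)
Lemma is_Cder_CSeries (D : C -> Prop) (a : nat -> C -> C) (z : C) : dominated D a ->
  (forall n, hol 3 D (a n)) -> D z ->
  is_Cder (fun w => CSeries (fun n => a n w)) z (CSeries (fun n => Dc (a n) z)).
Proof.
  intros H Hh Hz.
  assert (Hd1 : dominated D (fun n => Dc (a n))) by (apply dominated_Dc; [exact H|intros n; apply hol_S, Hh]).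
  assert (Hd2 : dominated D (fun n => Dc (Dc (a n)))).
  { apply (dominated_Dc D (fun n => Dc (a n))); [exact Hd1|]. intros n. apply (Hh n). }
  destruct (Hd2 z Hz) as [r [B [Hr [HB [HD Hs]]]]].
  intros e He.
  set (K := Series B). 
  assert (HB0 : forall n, 0 <= B n) by (intros n; eapply Rle_trans; [apply Cmod_ge_0|apply (Hs n z), square_center; lra]).
  assert (HK : 0 <= K).
  { unfold K. replace 0 with (Series (fun n => 0 * B n)) by (rewrite Series_scal_l; ring).
    apply Series_le; [|exact HB]. intros n. generalize (HB0 n). lra. }
  exists (Rmin r (e / (K + 1))). split; [apply Rmin_pos; [exact Hr|apply Rdiv_lt_0_compat; lra]|].
  intros w Hw.
  assert (W1 := Rlt_le_trans _ _ _ Hw (Rmin_l _ _)). assert (W2 := Rlt_le_trans _ _ _ Hw (Rmin_r _ _)).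
  assert (HDw : D w) by (apply HD, Cmod_in_square; lra).
  assert (Sw := dominated_summable _ _ w H HDw). assert (Sz := dominated_summable _ _ z H Hz).
  assert (Sd := dominated_summable _ _ z Hd1 Hz).
  set (N := Cmod (w - z)%C) in *.
  replace (CSeries (fun n => a n w) - CSeries (fun n => a n z) - CSeries (fun n => Dc (a n) z) * (w - z))%C
    with (CSeries (fun n => (a n w - a n z) - (w - z) * Dc (a n) z)%C).
  2:{ rewrite CSeries_minus, CSeries_minus, CSeries_scal; try assumption; [ring| |apply summable_scal, Sd].
      apply summable_le with (fun n => Cmod (a n w) + Cmod (a n z)).
      - intros n. eapply Rle_trans; [apply Cmod_triangle|]. rewrite Cmod_opp. lra.
      - apply (@ex_series_plus R_AbsRing R_NormedModule); assumption. }
  assert (HN : 0 <= N) by apply Cmod_ge_0.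
  apply Rle_trans with (Series (fun n => (N * N) * B n)).
  - apply CSeries_bound.
    + intros n. rewrite (Cmult_comm (w - z)). rewrite (Rmult_comm (N * N)).
      apply (taylor2_bound D (a n) z w r).
      * apply hol_S, Hh.
      * exact HD.
      * intros v Hv. apply (Hs n v Hv).
      * fold N; lra.
    + apply (@ex_series_scal R_AbsRing R_NormedModule (N * N)), HB.
  - rewrite Series_scal_l. fold K.
    apply (Rmult_lt_compat_r (K + 1)) in W2; [|lra].
    replace (e / (K + 1) * (K + 1)) with e in W2 by (field; lra). nra.
Qed.

Lemma hol_CSeries (k : nat) (D : C -> Prop) (a : nat -> C -> C) : dominated D a ->
  (forall m n, hol m D (a n)) -> hol k D (fun z => CSeries (fun n => a n z)).
Proof.
  revert a. induction k as [|k IH]; intros a H Hh; [exact I|].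
  apply hol_intro with (fun z => CSeries (fun n => Dc (a n) z)).
  - apply (dominated_open _ _ H).
  - intros z Hz. apply (is_Cder_CSeries D); [exact H|intros n; apply Hh|exact Hz].
  - apply (IH (fun n => Dc (a n))).
    + apply dominated_Dc; [exact H|intros n; apply Hh].
    + intros m n. apply (Hh (S m) n).
Qed.

(** * The zeta function to the right of [Re s = -1] *)

(** Sign convention of Dirichlet series: [cpow x s] is [x^(-s)], and [rpow x p] is [x^(-p)]. *)
Definition cpow (x : R) (s : C) : C := Cexp (RtoC (- ln x) * s)%C.
Definition rpow (x p : R) : R := exp (- p * ln x).

Lemma Cmod_cpow (x : R) (s : C) : Cmod (cpow x s) = rpow x (fst s).
Proof. unfold cpow, rpow. rewrite Cmod_Cexp. f_equal. simpl. ring. Qed.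

Lemma cpow_plus (x : R) (s w : C) : cpow x (s + w)%C = (cpow x s * cpow x w)%C.
Proof. unfold cpow. rewrite <- Cexp_plus. f_equal. ring. Qed.

Lemma rpow_pos (x p : R) : 0 < rpow x p.
Proof. apply exp_pos. Qed.

Lemma rpow_1_l (p : R) : rpow 1 p = 1.
Proof. unfold rpow. rewrite ln_1, Rmult_0_r. apply exp_0. Qed.

Lemma rpow_plus (x p q : R) : rpow x (p + q) = rpow x p * rpow x q.
Proof. unfold rpow. rewrite <- exp_plus. f_equal. ring. Qed.

Lemma rpow_1 (x : R) : 0 < x -> rpow x 1 = / x.
Proof. intros H. unfold rpow. replace (-(1) * ln x) with (- ln x) by ring. rewrite exp_Ropp, exp_ln; auto. Qed.

Lemma ln_le (x y : R) : 0 < x -> x <= y -> ln x <= ln y.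
Proof. intros H [L|L]; [left; apply ln_increasing; assumption|subst; lra]. Qed.

Lemma exp_le (x y : R) : x <= y -> exp x <= exp y.
Proof. intros [L|L]; [left; apply exp_increasing, L|subst; lra]. Qed.

Lemma ln_ge_0 (x : R) : 1 <= x -> 0 <= ln x.
Proof. intros H. rewrite <- ln_1. apply ln_le; lra. Qed.

Lemma rpow_antitone (x y p : R) : 0 < x -> x <= y -> 0 <= p -> rpow y p <= rpow x p.
Proof. intros. unfold rpow. apply exp_le. generalize (ln_le x y). nra. Qed.

Lemma rpow_mono_exp (x p q : R) : 1 <= x -> p <= q -> rpow x q <= rpow x p.
Proof. intros. unfold rpow. apply exp_le. generalize (ln_ge_0 x). nra. Qed.

Lemma is_derive_rpow (p x : R) : 0 < x -> is_derive (fun x => rpow x p) x (- p * rpow x (p + 1)).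
Proof.
  intros Hx. rewrite rpow_plus, rpow_1 by exact Hx. unfold rpow.
  auto_derive; [exact Hx|]. field. lra.
Qed.

Lemma INR_S_pos (k : nat) : 1 <= INR (S k).
Proof. rewrite S_INR. generalize (pos_INR k). lra. Qed.

Lemma is_lim_seq_rpow (p : R) : 0 < p -> is_lim_seq (fun k => rpow (INR (S k)) p) 0.
Proof.
  intros Hp. apply is_lim_seq_spec. intros [e He]. cbn -[INR].
  destruct (nfloor_ex (exp (- ln e / p))) as [N [H1 H2]]; [left; apply exp_pos|].
  exists N. intros n Hn. rewrite Rminus_0_r, Rabs_right; [|apply Rle_ge, Rlt_le, rpow_pos].
  apply le_INR in Hn. rewrite S_INR.
  assert (L : - ln e / p < ln (INR n + 1)).
  { rewrite <- (ln_exp (- ln e / p)). apply ln_increasing; [apply exp_pos|lra]. }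
  apply (Rmult_lt_compat_l p) in L; [|exact Hp].
  replace (p * (- ln e / p)) with (- ln e) in L by (field; lra).
  unfold rpow. rewrite <- (exp_ln e) by exact He. apply exp_increasing. lra.
Qed.

Lemma is_series_telescope (phi : nat -> R) : is_lim_seq phi 0 ->
  is_series (fun k => phi k - phi (S k)) (phi O).
Proof.
  intros H. change (is_lim_seq (sum_n (fun k => phi k - phi (S k))) (phi O)).
  apply (is_lim_seq_ext (fun n => phi O - phi (S n))).
  - intros n. induction n as [|n IH]; [rewrite sum_O; reflexivity|].
    rewrite sum_Sn, <- IH. change (phi O - phi (S (S n)) = phi O - phi (S n) + (phi (S n) - phi (S (S n)))). ring.
  - replace (Finite (phi O)) with (Finite (phi O - 0)) by (f_equal; ring).
    apply is_lim_seq_minus'; [apply is_lim_seq_const|]. apply -> is_lim_seq_incr_1. exact H.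
Qed.

(** The middle term is the integral of [v^(-1-r)] over [[x, x + 1]], represented by its value at a
    mean point. Its sum telescopes, which gives the integral test in both directions. *)
Lemma rpow_step (r x : R) : 0 < r -> 0 < x ->
  rpow (x + 1) (1 + r) <= / r * (rpow x r - rpow (x + 1) r) <= rpow x (1 + r).
Proof.
  intros Hr Hx.
  destruct (MVT_cor2 (fun v => rpow v r) (fun v => - r * rpow v (r + 1)) x (x + 1)) as [c [Hc1 Hc2]]; [lra| |].
  - intros c Hc. apply is_derive_Reals, is_derive_rpow. lra.
  - replace (x + 1 - x) with 1 in Hc1 by ring.
    replace (/ r * (rpow x r - rpow (x + 1) r)) with (rpow c (1 + r)).
    + split; apply rpow_antitone; lra.
    + replace (rpow x r - rpow (x + 1) r) with (r * rpow c (1 + r)); [field; lra|].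
      rewrite (Rplus_comm 1 r). lra.
Qed.

Lemma ex_series_rpow (r : R) : 0 < r -> ex_series (fun k => rpow (INR (S k)) (1 + r)).
Proof.
  intros Hr. apply (ex_series_incr_1 (fun k => rpow (INR (S k)) (1 + r))).
  apply (@ex_series_le R_AbsRing R_CompleteNormedModule _ (fun k => / r * (rpow (INR (S k)) r - rpow (INR (S (S k))) r))).
  - intros n. change (Rabs (rpow (INR (S (S n))) (1 + r)) <= / r * (rpow (INR (S n)) r - rpow (INR (S (S n))) r)).
    rewrite Rabs_right by (apply Rle_ge, Rlt_le, rpow_pos).
    rewrite (S_INR (S n)). apply rpow_step; [exact Hr|]. generalize (INR_S_pos n); lra.
  - apply (@ex_series_scal R_AbsRing R_NormedModule (/ r)).
    eexists. apply (is_series_telescope (fun k => rpow (INR (S k)) r)). apply is_lim_seq_rpow, Hr.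
Qed.

Definition rzeta (p : R) : R := Series (fun k => rpow (INR (S k)) p).

Lemma telescope_rpow (r : R) : 0 < r ->
  Series (fun k => / r * (rpow (INR (S k)) r - rpow (INR (S (S k))) r)) = / r.
Proof.
  intros Hr. rewrite Series_scal_l.
  rewrite (is_series_unique _ _ (is_series_telescope (fun k => rpow (INR (S k)) r) (is_lim_seq_rpow r Hr))).
  simpl. rewrite rpow_1_l. ring.
Qed.

Lemma rzeta_le (r : R) : 0 < r -> rzeta (1 + r) <= 1 + / r.
Proof.
  intros Hr. unfold rzeta. rewrite Series_incr_1 by (apply ex_series_rpow, Hr).
  rewrite <- (telescope_rpow r Hr). apply Rplus_le_compat.
  - simpl. rewrite rpow_1_l. lra.
  - apply Series_le.
    + intros n. split; [left; apply rpow_pos|].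
      rewrite (S_INR (S n)). apply rpow_step; [exact Hr|]. generalize (INR_S_pos n); lra.
    + apply (@ex_series_scal R_AbsRing R_NormedModule (/ r)).
      eexists. apply (is_series_telescope (fun k => rpow (INR (S k)) r)). apply is_lim_seq_rpow, Hr.
Qed.

Lemma rzeta_ge (r : R) : 0 < r -> / r <= rzeta (1 + r).
Proof.
  intros Hr. unfold rzeta. rewrite <- (telescope_rpow r Hr).
  apply Series_le; [|apply ex_series_rpow, Hr].
  intros n. assert (H := INR_S_pos n). rewrite (S_INR (S n)). split; [|apply rpow_step; lra].
  apply Rmult_le_pos; [left; apply Rinv_0_lt_compat, Hr|].
  generalize (rpow_antitone (INR (S n)) (INR (S n) + 1) r). lra.
Qed.

Lemma is_Rder_mult (f g : R -> C) (x : R) (a b : C) : is_Rder f x a -> is_Rder g x b ->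
  is_Rder (fun r => f r * g r)%C x (a * g x + f x * b)%C.
Proof.
  intros [F1 F2] [G1 G2]. split.
  - apply (is_derive_ext (fun r : R => fst (f r) * fst (g r) - snd (f r) * snd (g r))); [reflexivity|].
    replace (fst (a * g x + f x * b)%C) with ((fst a * fst (g x) + fst (f x) * fst b) - (snd a * snd (g x) + snd (f x) * snd b)) by (simpl; ring).
    apply (is_derive_minus (fun r : R => fst (f r) * fst (g r)) (fun r : R => snd (f r) * snd (g r))).
    + apply (is_derive_mult (fun r : R => fst (f r)) (fun r : R => fst (g r))); [exact F1|exact G1|intros; apply Rmult_comm].
    + apply (is_derive_mult (fun r : R => snd (f r)) (fun r : R => snd (g r))); [exact F2|exact G2|intros; apply Rmult_comm].
  - apply (is_derive_ext (fun r : R => fst (f r) * snd (g r) + snd (f r) * fst (g r))); [reflexivity|].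
    replace (snd (a * g x + f x * b)%C) with ((fst a * snd (g x) + fst (f x) * snd b) + (snd a * fst (g x) + snd (f x) * fst b)) by (simpl; ring).
    apply (is_derive_plus (fun r : R => fst (f r) * snd (g r)) (fun r : R => snd (f r) * fst (g r))).
    + apply (is_derive_mult (fun r : R => fst (f r)) (fun r : R => snd (g r))); [exact F1|exact G2|intros; apply Rmult_comm].
    + apply (is_derive_mult (fun r : R => snd (f r)) (fun r : R => fst (g r))); [exact F2|exact G1|intros; apply Rmult_comm].
Qed.

Lemma is_Rder_const (c : C) (x : R) : is_Rder (fun _ => c) x 0.
Proof. split; simpl; (auto_derive; [exact I|ring]). Qed.

Lemma is_Rder_RtoC (x : R) : is_Rder (fun r => RtoC r) x 1.
Proof. split; simpl; (auto_derive; [exact I|ring]). Qed.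

Lemma is_Rder_eq (f : R -> C) (x : R) (a b : C) : a = b -> is_Rder f x a -> is_Rder f x b.
Proof. intros E; subst; auto. Qed.

Lemma cpow_real_1 (x : R) : 0 < x -> cpow x 1 = RtoC (/ x).
Proof.
  intros H. unfold cpow, Cexp. simpl.
  replace (- ln x * 0 + 0 * 1) with 0 by ring. rewrite cos_0, sin_0.
  replace (- ln x * 1 - 0 * 0) with (- ln x) by ring. rewrite exp_Ropp, exp_ln by exact H.
  unfold RtoC. f_equal; ring.
Qed.

Lemma is_Rder_cpow (w : C) (n x : R) : 0 < n + x ->
  is_Rder (fun r => cpow (n + r) w) x (- w * cpow (n + x) (w + 1))%C.
Proof.
  intros H. rewrite cpow_plus, cpow_real_1 by exact H.
  split; unfold cpow, Cexp; simpl; (auto_derive; [repeat split; exact H|]); unfold Rminus;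
  field; lra.
Qed.

(** The trapezoidal value minus the integral of [x^-s] from [n] to [n + 1], hence [O(n^(-Re s - 2))]. *)
Definition trap (n : R) (s : C) : C :=
  ((cpow n s + cpow (n + 1) s) * / 2 - (cpow (n + 1) (s - 1) - cpow n (s - 1)) * / (1 - s))%C.

(** [e] is an antiderivative minus the trapezoidal area on [[n, n + r]]. Its derivative [d] vanishes
    at 0 and has derivative [- r g''/2], so two mean value inequalities suffice; [-2 <= Re s] puts
    the largest value of [|g''|] at the left end. *)
Lemma trap_bound (n : R) (s : C) : 0 < n -> s <> 1%C -> -2 <= fst s ->
  Cmod (trap n s) <= Cmod s * Cmod (s + 1)%C * rpow n (fst s + 2).
Proof.
  intros Hn Hs Hfs.
  assert (Hs1 : (1 - s)%C <> 0%C).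
  { intro K. apply Hs. replace s with (1 - (1 - s))%C by ring. rewrite K. ring. }
  set (K := Cmod s * Cmod (s + 1)%C * rpow n (fst s + 2)).
  assert (HK0 : 0 <= K).
  { unfold K. apply Rmult_le_pos; [|left; apply rpow_pos]. apply Rmult_le_pos; apply Cmod_ge_0. }
  set (g := fun r : R => cpow (n + r) s). set (g1 := fun r : R => (- s * cpow (n + r) (s + 1))%C).
  set (g2 := fun r : R => (- s * (- (s + 1) * cpow (n + r) (s + 1 + 1)))%C).
  assert (G1 : forall x, 0 <= x -> is_Rder g x (g1 x)).
  { intros x Hx. apply is_Rder_cpow. lra. }
  assert (G2 : forall x, 0 <= x -> is_Rder g1 x (g2 x)).
  { intros x Hx. apply is_Rder_eq with (0 * cpow (n + x) (s + 1) + - s * (- (s + 1) * cpow (n + x) (s + 1 + 1)))%C; [unfold g2; ring|].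
    apply (is_Rder_mult (fun _ => (- s)%C) (fun r => cpow (n + r) (s + 1))); [apply is_Rder_const|].
    apply is_Rder_cpow. lra. }
  assert (B2 : forall x, 0 <= x -> Cmod (g2 x) <= K).
  { intros x Hx. unfold g2. rewrite !Cmod_mult, !Cmod_opp, Cmod_cpow.
    unfold K. rewrite <- Rmult_assoc. apply Rmult_le_compat_l; [apply Rmult_le_pos; apply Cmod_ge_0|].
    replace (fst (s + 1 + 1)%C) with (fst s + 2) by (simpl; ring).
    apply rpow_antitone; lra. }
  set (d := fun r : R => (/ 2 * (g r - g 0%R) + - / 2 * (r * g1 r))%C).
  assert (Dd : forall x, 0 <= x -> is_Rder d x (- / 2 * (x * g2 x))%C).
  { intros x Hx.
    apply is_Rder_eq with ((0 * (g x - g 0%R) + / 2 * (g1 x + 0)) + (0 * (x * g1 x) + - / 2 * (1 * g1 x + x * g2 x)))%C; [ring|].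
    apply (is_Rder_plus (fun r => / 2 * (g r - g 0%R))%C (fun r => - / 2 * (r * g1 r))%C).
    - apply (is_Rder_mult (fun _ => (/ 2)%C) (fun r => (g r - g 0%R)%C)); [apply is_Rder_const|].
      apply (is_Rder_plus g (fun _ => (- g 0%R)%C)); [apply G1, Hx|apply is_Rder_const].
    - apply (is_Rder_mult (fun _ => (- / 2)%C) (fun r => (r * g1 r)%C)); [apply is_Rder_const|].
      apply (is_Rder_mult (fun r => RtoC r) g1); [apply is_Rder_RtoC|apply G2, Hx]. }
  assert (C2 : Cmod (/ 2)%C = / 2) by (rewrite <- RtoC_inv, Cmod_R, Rabs_right by lra; reflexivity).
  assert (Bd : forall x, 0 <= x <= 1 -> Cmod (d x) <= K).
  { intros x Hx. apply Rle_trans with (K * (x - 0)); [|nra].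
    replace (d x) with (d x - d 0%R)%C by (unfold d; ring).
    apply (mvt_ineq d (fun r => - / 2 * (r * g2 r))%C); [lra|intros; apply Dd; lra|].
    intros r Hr. rewrite !Cmod_mult, Cmod_opp, C2, Cmod_R, Rabs_right by lra.
    specialize (B2 r ltac:(lra)). generalize (Cmod_ge_0 (g2 r)). nra. }
  set (e := fun r : R => (cpow (n + r) (s - 1) * / (1 - s) - r * ((g 0%R + g r) * / 2))%C).
  assert (De : forall x, 0 <= x -> is_Rder e x (d x)).
  { intros x Hx.
    apply is_Rder_eq with ((- (s - 1) * cpow (n + x) (s - 1 + 1)) * / (1 - s) + cpow (n + x) (s - 1) * 0
       + (- (1) * (x * ((g 0%R + g x) * / 2)) * 0 + - (1) * (1 * ((g 0%R + g x) * / 2) + x * ((0 + g1 x) * / 2 + (g 0%R + g x) * 0))))%C.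
    - replace (s - 1 + 1)%C with s by ring. unfold d, g. field. exact Hs1.
    - apply (is_Rder_plus (fun r => cpow (n + r) (s - 1) * / (1 - s))%C (fun r => - (r * ((g 0%R + g r) * / 2)))%C).
      + apply (is_Rder_mult (fun r => cpow (n + r) (s - 1)) (fun _ => / (1 - s))%C); [apply is_Rder_cpow; lra|apply is_Rder_const].
      + apply is_Rder_eq with (- (1 * ((g 0%R + g x) * / 2) + x * ((0 + g1 x) * / 2 + (g 0%R + g x) * 0)))%C; [ring|].
        assert (Hm : is_Rder (fun r => (r * ((g 0%R + g r) * / 2)))%C x (1 * ((g 0%R + g x) * / 2) + x * ((0 + g1 x) * / 2 + (g 0%R + g x) * 0))%C).
        { apply (is_Rder_mult (fun r => RtoC r) (fun r => ((g 0%R + g r) * / 2)%C)); [apply is_Rder_RtoC|].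
          apply (is_Rder_mult (fun r => (g 0%R + g r)%C) (fun _ => (/ 2)%C)); [|apply is_Rder_const].
          apply (is_Rder_plus (fun _ => g 0%R) g); [apply is_Rder_const|apply G1, Hx]. }
        destruct Hm as [M1 M2]. split.
        * apply (is_derive_opp (fun r : R => fst (r * ((g 0%R + g r) * / 2))%C)), M1.
        * apply (is_derive_opp (fun r : R => snd (r * ((g 0%R + g r) * / 2))%C)), M2. }
  replace (trap n s) with (- (e 1%R - e 0%R))%C.
  - rewrite Cmod_opp. apply Rle_trans with (K * (1 - 0)); [|lra].
    apply (mvt_ineq e d); [lra|intros; apply De; lra|exact Bd].
  - unfold e, trap, g. rewrite Rplus_0_r. field. exact Hs1.
Qed.

(** Euler-Maclaurin summation: this continues [zeta] to [Re s > -1], which the reflection needs. *)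
Definition Zt (s : C) : C := (CSeries (fun k => trap (INR (S k)) s) + / 2 + / (s - 1))%C.

Lemma npow_neg_cpow (n : nat) (s : C) : npow_neg n s = cpow (INR n) s.
Proof.
  unfold npow_neg, cpow, Cexp. simpl.
  replace (- ln (INR n) * fst s - 0 * snd s) with (- fst s * ln (INR n)) by ring.
  replace (- ln (INR n) * snd s + 0 * fst s) with (- (snd s * ln (INR n))) by ring.
  rewrite cos_neg, sin_neg. f_equal. ring.
Qed.

Lemma npow_one_minus_cpow (n : nat) (s : C) : npow_one_minus n s = cpow (INR n) (s - 1).
Proof.
  unfold npow_one_minus, cpow, Cexp. simpl.
  replace (- ln (INR n) * (fst s + - (1)) - 0 * (snd s + - 0)) with ((1 - fst s) * ln (INR n)) by ring.
  replace (- ln (INR n) * (snd s + - 0) + 0 * (fst s + - (1))) with (- (snd s * ln (INR n))) by ring.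
  rewrite cos_neg, sin_neg. f_equal. ring.
Qed.

(** Each term of the sum is shared by two neighbouring trapezoids, so only half of the last term is
    left over. One trapezoid joins two terms, hence the index [m + 2]. *)
Lemma zeta_approx_trap (s : C) (m : nat) : s <> 1%C ->
  zeta_approx s (S (S m)) = (sum_n (fun k => trap (INR (S k)) s) m + / 2 + / (s - 1) + cpow (INR (S (S m))) s * / 2)%C.
Proof.
  intros Hs.
  assert (Hs1 : (1 - s)%C <> 0%C).
  { intro K. apply Hs. replace s with (1 - (1 - s))%C by ring. rewrite K. ring. }
  assert (Hs2 : (s - 1)%C <> 0%C).
  { intro K. apply Hs. replace s with ((s - 1) + 1)%C by ring. rewrite K. ring. }
  assert (H2 : RtoC 2 <> 0%C) by (intro E; apply (f_equal fst) in E; simpl in E; lra).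
  unfold zeta_approx. rewrite npow_one_minus_cpow. simpl pred.
  assert (Hc1 : forall w, cpow 1 w = 1%C).
  { intros w. unfold cpow. rewrite ln_1. replace (RtoC (- 0) * w)%C with (RtoC 0).
    - apply Cexp_0.
    - rewrite Ropp_0. ring. }
  induction m as [|m IH].
  - rewrite sum_Sn, !sum_O, !npow_neg_cpow. unfold trap.
    change (INR 1) with 1. replace (INR 2) with (1 + 1) by (simpl; ring).
    rewrite !Hc1. change plus with Cplus. field. repeat split; assumption.
  - rewrite sum_Sn. rewrite (sum_Sn (fun k => trap (INR (S k)) s)).
    change plus with Cplus.
    replace (sum_n (fun k : nat => npow_neg (S k) s) (S m))
      with (sum_n (fun k : nat => trap (INR (S k)) s) m + / 2 + / (s - 1) + cpow (INR (S (S m))) s * / 2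
            + cpow (INR (S (S m))) (s - 1) / (1 - s))%C by (rewrite <- IH; field; assumption).
    rewrite npow_neg_cpow. unfold trap at 3. rewrite (S_INR (S (S m))). field. repeat split; assumption.
Qed.

Lemma fst_sum_n (a : nat -> C) (n : nat) : fst (sum_n a n) = sum_n (fun k => fst (a k)) n.
Proof. induction n as [|n IH]; [rewrite !sum_O; reflexivity|]. rewrite !sum_Sn, <- IH. reflexivity. Qed.

Lemma snd_sum_n (a : nat -> C) (n : nat) : snd (sum_n a n) = sum_n (fun k => snd (a k)) n.
Proof. induction n as [|n IH]; [rewrite !sum_O; reflexivity|]. rewrite !sum_Sn, <- IH. reflexivity. Qed.

Definition is_Clim (u : nat -> C) (l : C) : Prop :=
  is_lim_seq (fun n => fst (u n)) (fst l) /\ is_lim_seq (fun n => snd (u n)) (snd l).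

Lemma is_Clim_unique (u : nat -> C) (l l' : C) : is_Clim u l -> is_Clim u l' -> l = l'.
Proof.
  intros [A B] [A' B']. apply is_lim_seq_unique in A, B, A', B'.
  rewrite A in A'. rewrite B in B'. apply injective_projections; congruence.
Qed.

Lemma is_Clim_ext (u v : nat -> C) (l : C) : (forall n, u n = v n) -> is_Clim u l -> is_Clim v l.
Proof.
  intros H [A B]. split; [eapply is_lim_seq_ext; [|exact A]|eapply is_lim_seq_ext; [|exact B]];
  intros n; simpl; rewrite H; reflexivity.
Qed.

Lemma is_Clim_plus (u v : nat -> C) (l m : C) : is_Clim u l -> is_Clim v m ->
  is_Clim (fun n => u n + v n)%C (l + m)%C.
Proof. intros [A B] [A' B']. split; apply is_lim_seq_plus'; assumption. Qed.

Lemma is_Clim_const (c : C) : is_Clim (fun _ => c) c.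
Proof. split; apply is_lim_seq_const. Qed.

Lemma is_Clim_0 (u : nat -> C) : is_lim_seq (fun n => Cmod (u n)) 0 -> is_Clim u 0.
Proof.
  intros H. split; apply is_lim_seq_abs_0; apply (is_lim_seq_le_le (fun _ => 0) _ (fun n => Cmod (u n)));
   try exact H; try apply is_lim_seq_const; intros n; split; try apply Rabs_pos; [apply fst_le_Cmod|apply snd_le_Cmod].
Qed.

Lemma is_Clim_sum (a : nat -> C) : summable a -> is_Clim (sum_n a) (CSeries a).
Proof.
  intros H. split; simpl.
  - apply (is_lim_seq_ext (sum_n (fun k => fst (a k)))); [intros; symmetry; apply fst_sum_n|].
    apply Series_correct, summable_fst, H.
  - apply (is_lim_seq_ext (sum_n (fun k => snd (a k)))); [intros; symmetry; apply snd_sum_n|].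
    apply Series_correct, summable_snd, H.
Qed.

Lemma summable_trap (s : C) : s <> 1%C -> -1 < fst s -> summable (fun k => trap (INR (S k)) s).
Proof.
  intros Hs Hf. apply summable_le with (fun k => Cmod s * Cmod (s + 1)%C * rpow (INR (S k)) (1 + (fst s + 1))).
  - intros n. replace (1 + (fst s + 1)) with (fst s + 2) by ring.
    apply trap_bound; [|exact Hs|lra]. generalize (INR_S_pos n). lra.
  - apply (@ex_series_scal R_AbsRing R_NormedModule). apply ex_series_rpow. lra.
Qed.

Lemma zeta_approx_lim (s : C) : s <> 1%C -> 0 < fst s -> is_Clim (fun m => zeta_approx s (S (S m))) (Zt s).
Proof.
  intros Hs Hf.
  apply is_Clim_ext with (fun m => sum_n (fun k => trap (INR (S k)) s) m + (/ 2 + / (s - 1)) + cpow (INR (S (S m))) s * / 2)%C.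
  { intros m. rewrite zeta_approx_trap by exact Hs. ring. }
  replace (Zt s) with (CSeries (fun k => trap (INR (S k)) s) + (/ 2 + / (s - 1)) + 0)%C by (unfold Zt; ring).
  apply is_Clim_plus; [apply is_Clim_plus; [|apply is_Clim_const]|].
  - apply is_Clim_sum, summable_trap; [exact Hs|lra].
  - apply is_Clim_0. apply (is_lim_seq_ext (fun m => rpow (INR (S (S m))) (fst s) * Cmod (/ 2)%C)).
    + intros m. rewrite Cmod_mult, Cmod_cpow. reflexivity.
    + replace 0 with (0 * Cmod (/ 2)%C) by ring. apply is_lim_seq_mult'; [|apply is_lim_seq_const].
      apply -> (is_lim_seq_incr_1 (fun m => rpow (INR (S m)) (fst s))). apply is_lim_seq_rpow, Hf.
Qed.

Lemma zeta_Zt (s : C) : s <> 1%C -> 0 < fst s -> zeta s = Zt s.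
Proof.
  intros Hs Hf. destruct (zeta_approx_lim s Hs Hf) as [A B].
  unfold zeta. apply injective_projections; simpl.
  - rewrite (is_lim_seq_unique _ (fst (Zt s))); [reflexivity|].
    apply (is_lim_seq_incr_n _ 2). eapply is_lim_seq_ext; [|exact A]. intros n. simpl. rewrite Nat.add_comm. reflexivity.
  - rewrite (is_lim_seq_unique _ (snd (Zt s))); [reflexivity|].
    apply (is_lim_seq_incr_n _ 2). eapply is_lim_seq_ext; [|exact B]. intros n. simpl. rewrite Nat.add_comm. reflexivity.
Qed.

(** The condition on the imaginary part keeps the pole at 1 away from every statement on [DZ]. *)
Definition DZ (z : C) : Prop := -1 < fst z /\ 0 < snd z.
Definition DS (z : C) : Prop := 1 < fst z.

Lemma half_plane_near_fst (a : R) (z : C) : a < fst z -> near z (fun w => a < fst w).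
Proof.
  intros H. generalize (near_close z (fst z - a) ltac:(lra)). apply near_imp. intros w Hw.
  assert (F := fst_le_Cmod (w - z)%C). simpl in F. fold (fst w - fst z) in F.
  assert (F1 : Rabs (fst w - fst z) < fst z - a) by lra. apply Rabs_def2 in F1. lra.
Qed.

Lemma half_plane_near_snd (a : R) (z : C) : a < snd z -> near z (fun w => a < snd w).
Proof.
  intros H. generalize (near_close z (snd z - a) ltac:(lra)). apply near_imp. intros w Hw.
  assert (F := snd_le_Cmod (w - z)%C). simpl in F. fold (snd w - snd z) in F.
  assert (F1 : Rabs (snd w - snd z) < snd z - a) by lra. apply Rabs_def2 in F1. lra.
Qed.

Lemma DZ_open : Copen DZ.
Proof. intros z [H1 H2]. apply near_and; [apply half_plane_near_fst|apply half_plane_near_snd]; assumption. Qed.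

Lemma DS_open : Copen DS.
Proof. intros z H. apply half_plane_near_fst, H. Qed.

Lemma DZ_ne_1 (z : C) : DZ z -> (1 - z)%C <> 0%C /\ (z - 1)%C <> 0%C /\ z <> 1%C.
Proof.
  intros [_ H]. repeat split; intro E; apply (f_equal snd) in E; simpl in E; lra.
Qed.

Lemma hol_cpow (m : nat) (D : C -> Prop) (x : R) : Copen D -> hol m D (cpow x).
Proof.
  intros HD. apply hol_ext with (fun z => Cexp (RtoC (- ln x) * z + 0)%C); [exact HD| |].
  - intros z _. unfold cpow. f_equal. ring.
  - apply hol_Cexp_affine, HD.
Qed.

Lemma hol_cpow_shift (m : nat) (D : C -> Prop) (x : R) : Copen D -> hol m D (fun s => cpow x (s - 1)%C).
Proof.
  intros HD. apply hol_ext with (fun z => Cexp (RtoC (- ln x) * z + - RtoC (- ln x))%C); [exact HD| |].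
  - intros z _. unfold cpow. f_equal. ring.
  - apply hol_Cexp_affine, HD.
Qed.

Lemma hol_trap (m : nat) (n : R) : hol m DZ (trap n).
Proof.
  unfold trap. assert (HD := DZ_open).
  apply hol_minus; [exact HD| |].
  - apply hol_mult; [exact HD| |apply hol_const, HD]. apply hol_plus; [exact HD| |]; apply hol_cpow, HD.
  - apply hol_mult; [exact HD| |].
    + apply hol_minus; [exact HD| |]; apply hol_cpow_shift, HD.
    + apply hol_inv; [exact HD|intros z Hz; apply DZ_ne_1, Hz|].
      apply hol_minus; [exact HD|apply hol_const, HD|apply hol_id, HD].
Qed.

Lemma dominated_trap : dominated DZ (fun k => trap (INR (S k))).
Proof.
  intros z [H1 H2].
  set (r := Rmin ((fst z + 1) / 2) (snd z / 2)).
  assert (Hr : 0 < r) by (apply Rmin_pos; lra).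
  assert (R1 : r <= (fst z + 1) / 2) by apply Rmin_l. assert (R2 : r <= snd z / 2) by apply Rmin_r.
  set (A := Cmod z + 2 * r + 1).
  exists r, (fun k => A * A * rpow (INR (S k)) (1 + (fst z + 1) / 2)).
  split; [exact Hr|]. split; [|split].
  - apply (@ex_series_scal R_AbsRing R_NormedModule (A * A)). apply ex_series_rpow. lra.
  - intros w [W1 W2]. unfold DZ. lra.
  - intros n w [W1 W2].
    assert (Hw : Cmod w <= Cmod z + 2 * r).
    { replace w with (z + (w - z))%C by ring. eapply Rle_trans; [apply Cmod_triangle|].
      apply Rplus_le_compat_l. eapply Rle_trans; [apply Cmod_le_abs|]. simpl.
      assert (Rabs (fst w + - fst z) <= r) by (apply Rabs_le; lra).
      assert (Rabs (snd w + - snd z) <= r) by (apply Rabs_le; lra). lra. }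
    assert (Hw1 : Cmod (w + 1)%C <= A).
    { eapply Rle_trans; [apply Cmod_triangle|]. rewrite Cmod_1. unfold A. lra. }
    eapply Rle_trans; [apply trap_bound|].
    + generalize (INR_S_pos n). lra.
    + intro E. subst w. simpl in W2. lra.
    + lra.
    + apply Rmult_le_compat.
      * apply Rmult_le_pos; apply Cmod_ge_0.
      * left; apply rpow_pos.
      * apply Rmult_le_compat; try apply Cmod_ge_0; [unfold A; lra|exact Hw1].
      * apply rpow_mono_exp; [apply INR_S_pos|lra].
Qed.

Lemma hol_Zt (m : nat) : hol m DZ Zt.
Proof.
  unfold Zt. assert (HD := DZ_open).
  apply hol_plus; [exact HD|apply hol_plus; [exact HD| |apply hol_const, HD]|].
  - apply (hol_CSeries m DZ (fun k => trap (INR (S k)))); [apply dominated_trap|]. intros; apply hol_trap.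
  - apply hol_inv; [exact HD|intros z Hz; apply DZ_ne_1, Hz|].
    apply hol_minus; [exact HD|apply hol_id, HD|apply hol_const, HD].
Qed.

Lemma rzeta_antitone (p q : R) : 1 < p -> p <= q -> rzeta q <= rzeta p.
Proof.
  intros Hp Hq. apply Series_le.
  - intros n. split; [left; apply rpow_pos|]. apply rpow_mono_exp; [apply INR_S_pos|exact Hq].
  - replace p with (1 + (p - 1)) by ring. apply ex_series_rpow. lra.
Qed.

(** The trapezoidal errors sum to at most [|s| |s + 1| zeta(3/2)], and [zeta(3/2) <= 3]. On
    [Re s = -1/2] this quadratic growth is what the reflection starts from. *)
Lemma Zt_growth (s : C) : - / 2 <= fst s <= 4 -> 10 <= snd s -> Cmod (Zt s) <= 7 * (snd s * snd s).
Proof.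
  intros [H1 H2] Hy.
  assert (Hs : DZ s) by (unfold DZ; lra).
  assert (Hs1 : s <> 1%C) by apply DZ_ne_1, Hs.
  assert (B : Cmod (CSeries (fun k => trap (INR (S k)) s)) <= Cmod s * Cmod (s + 1)%C * rzeta (fst s + 2)).
  { unfold rzeta. rewrite <- Series_scal_l. apply CSeries_bound.
    - intros n. apply trap_bound; [generalize (INR_S_pos n); lra|exact Hs1|lra].
    - apply (@ex_series_scal R_AbsRing R_NormedModule). replace (fst s + 2) with (1 + (fst s + 1)) by ring.
      apply ex_series_rpow. lra. }
  assert (B2 : rzeta (fst s + 2) <= 3).
  { eapply Rle_trans; [apply (rzeta_antitone (1 + / 2)); lra|]. eapply Rle_trans; [apply rzeta_le; lra|]. lra. }
  assert (B3 : Cmod s <= 4 + snd s).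
  { eapply Rle_trans; [apply Cmod_le_abs|]. rewrite (Rabs_right (snd s)) by lra.
    apply Rplus_le_compat_r. apply Rabs_le. lra. }
  assert (B4 : Cmod (s + 1)%C <= 5 + snd s).
  { eapply Rle_trans; [apply Cmod_triangle|]. rewrite Cmod_1. lra. }
  assert (B5 : Cmod (/ (s - 1))%C <= / 10).
  { assert (10 <= Cmod (s - 1)%C).
    { eapply Rle_trans; [|apply snd_le_Cmod]. simpl. rewrite Rabs_right; lra. }
    rewrite Cmod_inv by apply DZ_ne_1, Hs. apply Rinv_le_contravar; lra. }
  assert (B6 : Cmod (/ 2)%C = / 2) by (rewrite <- RtoC_inv, Cmod_R, Rabs_right by lra; reflexivity).
  unfold Zt. eapply Rle_trans; [apply Cmod_triangle|]. eapply Rle_trans; [apply Rplus_le_compat_r, Cmod_triangle|].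
  rewrite B6.
  assert (B7 : Cmod s * Cmod (s + 1)%C * rzeta (fst s + 2) <= (4 + snd s) * (5 + snd s) * 3).
  { assert (0 <= rzeta (fst s + 2)).
    { replace (fst s + 2) with (1 + (fst s + 1)) by ring. eapply Rle_trans; [|apply rzeta_ge; lra].
      left; apply Rinv_0_lt_compat; lra. }
    apply Rmult_le_compat; [apply Rmult_le_pos; apply Cmod_ge_0|assumption| |exact B2].
    apply Rmult_le_compat; try apply Cmod_ge_0; assumption. }
  nra.
Qed.

(** * The Dirichlet series in Re s > 1 *)

Definition ZD (s : C) : C := CSeries (fun k => cpow (INR (S k)) s).

Lemma dominated_dirichlet (c : nat -> R) : (forall r, 0 < r -> ex_series (fun k => Rabs (c k) * rpow (INR (S k)) (1 + r))) ->
  dominated DS (fun k s => RtoC (c k) * cpow (INR (S k)) s)%C.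
Proof.
  intros Hc z Hz. unfold DS in Hz.
  exists ((fst z - 1) / 2), (fun k => Rabs (c k) * rpow (INR (S k)) (1 + (fst z - 1) / 2)).
  split; [lra|]. split; [apply Hc; lra|]. split.
  - intros w [W1 W2]. unfold DS. lra.
  - intros n w [W1 W2]. rewrite Cmod_mult, Cmod_R, Cmod_cpow.
    apply Rmult_le_compat_l; [apply Rabs_pos|]. apply rpow_mono_exp; [apply INR_S_pos|lra].
Qed.

Lemma dominated_ext (D : C -> Prop) (a b : nat -> C -> C) : (forall n z, a n z = b n z) -> dominated D a -> dominated D b.
Proof.
  intros E H z Hz. destruct (H z Hz) as [r [B [H1 [H2 [H3 H4]]]]]. exists r, B.
  split; [exact H1|split; [exact H2|split; [exact H3|]]]. intros n w Hw. rewrite <- E. apply H4, Hw.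
Qed.

Lemma dominated_ZD : dominated DS (fun k => cpow (INR (S k))).
Proof.
  apply (dominated_ext DS (fun k s => RtoC 1 * cpow (INR (S k)) s)%C); [|apply (dominated_dirichlet (fun _ => 1))].
  - intros n z. ring.
  - intros r Hr. apply (ex_series_ext (fun k => rpow (INR (S k)) (1 + r))); [|apply (ex_series_rpow r Hr)].
    intros n. rewrite Rabs_R1. symmetry; apply Rmult_1_l.
Qed.

Lemma summable_ZD (s : C) : DS s -> summable (fun k => cpow (INR (S k)) s).
Proof. intros H. apply (dominated_summable DS (fun k => cpow (INR (S k)))); [apply dominated_ZD|exact H]. Qed.

Lemma hol_ZD (m : nat) : hol m DS ZD.
Proof.
  apply (hol_CSeries m DS (fun k => cpow (INR (S k)))); [apply dominated_ZD|].
  intros; apply hol_cpow, DS_open.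
Qed.

Lemma Dc_cpow (x : R) (s : C) : Dc (cpow x) s = (RtoC (- ln x) * cpow x s)%C.
Proof.
  apply Dc_unique. apply (is_Cder_ext (fun w => Cexp (RtoC (- ln x) * w + 0)%C)).
  - apply near_true. intros w. unfold cpow. f_equal. ring.
  - assert (H := is_Cder_Cexp_affine (RtoC (- ln x)) 0 s).
    unfold cpow. replace (RtoC (- ln x) * s + 0)%C with (RtoC (- ln x) * s)%C in H by ring. exact H.
Qed.

Lemma Dc_ZD (s : C) : DS s -> Dc ZD s = CSeries (fun k => RtoC (- ln (INR (S k))) * cpow (INR (S k)) s)%C.
Proof.
  intros Hs. apply Dc_unique.
  assert (H := is_Cder_CSeries DS (fun k => cpow (INR (S k))) s dominated_ZD (fun n => hol_cpow 3 DS _ DS_open) Hs).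
  erewrite CSeries_ext; [exact H|]. intros n. simpl. rewrite Dc_cpow. reflexivity.
Qed.

(** Both are limits of [zeta_approx], whose correction term [N^(1-s)/(1-s)] tends to 0 when
    [Re s > 1]. *)
Lemma Zt_ZD (s : C) : DS s -> s <> 1%C -> Zt s = ZD s.
Proof.
  intros Hs H1. unfold DS in Hs.
  apply (is_Clim_unique (fun m => zeta_approx s (S (S m)))); [apply zeta_approx_lim; [exact H1|lra]|].
  unfold zeta_approx.
  apply is_Clim_ext with (fun m => sum_n (fun k => cpow (INR (S k)) s) (S m) + (- / (1 - s)) * cpow (INR (S (S m))) (s - 1))%C.
  - intros m. rewrite npow_one_minus_cpow. simpl pred.
    rewrite (sum_n_ext (fun k => npow_neg (S k) s) (fun k => cpow (INR (S k)) s)) by (intros; apply npow_neg_cpow).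
    unfold Cdiv. ring.
  - replace (ZD s) with (ZD s + 0)%C by ring. apply is_Clim_plus.
    + destruct (is_Clim_sum _ (summable_ZD s Hs)) as [A B].
      split; [apply -> is_lim_seq_incr_1 in A|apply -> is_lim_seq_incr_1 in B]; assumption.
    + apply is_Clim_0. apply (is_lim_seq_ext (fun m => Cmod (- / (1 - s))%C * rpow (INR (S (S m))) (fst s - 1))).
      * intros m. rewrite Cmod_mult, Cmod_cpow. reflexivity.
      * replace 0 with (Cmod (- / (1 - s))%C * 0) by ring. apply is_lim_seq_mult'; [apply is_lim_seq_const|].
        apply -> (is_lim_seq_incr_1 (fun m => rpow (INR (S m)) (fst s - 1))). apply is_lim_seq_rpow. lra.
Qed.

Lemma Cmod_ZD_le (s : C) : DS s -> Cmod (ZD s) <= rzeta (fst s).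
Proof.
  intros Hs. apply CSeries_bound.
  - intros n. rewrite Cmod_cpow. lra.
  - unfold DS in Hs. replace (fst s) with (1 + (fst s - 1)) by ring. apply ex_series_rpow. lra.
Qed.

(** For [n >= 2], [n^(-sigma)] is at most [2^(2-sigma) n^(-2)]. The decay in [sigma] closes the
    arguments that move to the right along a horizontal line. *)
Lemma ZD_near_1 (s : C) : 2 <= fst s -> Cmod (ZD s - 1)%C <= 2 * rpow 2 (fst s - 2).
Proof.
  intros Hs. assert (HD : DS s) by (unfold DS; lra).
  assert (E : (ZD s - 1)%C = CSeries (fun k => cpow (INR (S (S k))) s)).
  { unfold ZD, CSeries. assert (Sm := summable_ZD s HD).
    rewrite (Series_incr_1 (fun n => fst (cpow (INR (S n)) s))) by (apply (summable_fst _ Sm)).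
    rewrite (Series_incr_1 (fun n => snd (cpow (INR (S n)) s))) by (apply (summable_snd _ Sm)).
    assert (H1 : cpow (INR 1) s = 1%C).
    { change (INR 1) with 1. unfold cpow. rewrite ln_1, Ropp_0. rewrite <- Cexp_0. f_equal. ring. }
    rewrite H1. apply injective_projections; cbn -[INR Series]; ring. }
  rewrite E.
  eapply Rle_trans; [apply (CSeries_bound _ (fun k => rpow 2 (fst s - 2) * rpow (INR (S (S k))) (1 + 1)))|].
  - intros n. rewrite Cmod_cpow. replace (fst s) with ((fst s - 2) + (1 + 1)) at 1 by ring.
    rewrite rpow_plus. apply Rmult_le_compat_r; [left; apply rpow_pos|].
    apply rpow_antitone; [lra| |lra]. rewrite !S_INR. generalize (pos_INR n). lra.
  - apply (@ex_series_scal R_AbsRing R_NormedModule (rpow 2 (fst s - 2))).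
    apply -> (ex_series_incr_1 (fun k => rpow (INR (S k)) (1 + 1))). apply ex_series_rpow. lra.
  - rewrite Series_scal_l, (Rmult_comm 2). apply Rmult_le_compat_l; [left; apply rpow_pos|].
    assert (Hle := rzeta_le 1 Rlt_0_1). unfold rzeta in Hle.
    rewrite Series_incr_1 in Hle by (apply ex_series_rpow; lra).
    assert (0 < rpow (INR 1) (1 + 1)) by apply rpow_pos. rewrite Rinv_1 in Hle. lra.
Qed.

(** * Finite divisor sums and the von Mangoldt function *)

Fixpoint csum (f : nat -> C) (N : nat) : C :=
  match N with O => 0 | S n => csum f n + f (S n) end%C.

Lemma csum_ext (f g : nat -> C) (N : nat) : (forall n, (1 <= n <= N)%nat -> f n = g n) -> csum f N = csum g N.
Proof.
  induction N as [|N IH]; intros H; [reflexivity|]. simpl. rewrite IH by (intros; apply H; lia).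
  rewrite H by lia. reflexivity.
Qed.

Lemma csum_plus (f g : nat -> C) (N : nat) : csum (fun n => f n + g n)%C N = (csum f N + csum g N)%C.
Proof. induction N as [|N IH]; simpl; [ring|]. rewrite IH. ring. Qed.

Lemma csum_scal (c : C) (f : nat -> C) (N : nat) : csum (fun n => c * f n)%C N = (c * csum f N)%C.
Proof. induction N as [|N IH]; simpl; [ring|]. rewrite IH. ring. Qed.

Lemma csum_zero (N : nat) : csum (fun _ => 0%C) N = 0%C.
Proof. induction N as [|N IH]; simpl; [reflexivity|]. rewrite IH. ring. Qed.

Lemma csum_switch (f : nat -> nat -> C) (N M : nat) :
  csum (fun n => csum (fun m => f n m) M) N = csum (fun m => csum (fun n => f n m) N) M.
Proof.
  induction N as [|N IH]; simpl; [symmetry; apply csum_zero|]. rewrite IH, <- csum_plus. reflexivity.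
Qed.

Lemma csum_delta (a : nat) (x : C) (N : nat) : (1 <= a <= N)%nat ->
  csum (fun n => if Nat.eqb n a then x else 0%C) N = x.
Proof.
  induction N as [|N IH]; intros H; [lia|]. cbn [csum].
  destruct (Nat.eqb_spec (S N) a) as [E|E].
  - rewrite (csum_ext _ (fun _ => 0%C)), csum_zero; [ring|].
    intros n Hn. destruct (Nat.eqb_spec n a); [lia|reflexivity].
  - rewrite IH by lia. ring.
Qed.

Lemma csum_bound (f : nat -> C) (N : nat) : Cmod (csum f N) <= fst (csum (fun n => RtoC (Cmod (f n))) N).
Proof.
  induction N as [|N IH]; simpl; [rewrite Cmod_0; lra|].
  eapply Rle_trans; [apply Cmod_triangle|]. lra.
Qed.

Lemma csum_RtoC_le (f g : nat -> R) (N : nat) : (forall n, (1 <= n <= N)%nat -> f n <= g n) ->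
  fst (csum (fun n => RtoC (f n)) N) <= fst (csum (fun n => RtoC (g n)) N).
Proof.
  induction N as [|N IH]; intros H; simpl; [lra|].
  apply Rplus_le_compat; [apply IH; intros; apply H; lia|apply H; lia].
Qed.

Lemma sum_n_csum (f : nat -> C) (m : nat) : sum_n (fun k => f (S k)) m = csum f (S m).
Proof.
  induction m as [|m IH]; [rewrite sum_O; simpl; ring|].
  rewrite sum_Sn, IH. reflexivity.
Qed.

Definition dvdb (q n : nat) : bool := Nat.eqb (n mod q) 0.

Lemma csum_multiples (f : nat -> C) (q N : nat) : (1 <= q)%nat ->
  csum (fun n => if dvdb q n then f n else 0%C) N = csum (fun m => f (q * m)%nat) (N / q).
Proof.
  intros Hq. induction N as [|N IH]; [rewrite Nat.Div0.div_0_l; reflexivity|].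
  cbn [csum]. rewrite IH. unfold dvdb.
  assert (A := Nat.div_mod_eq N q). assert (B := Nat.mod_upper_bound N q ltac:(lia)).
  destruct (Nat.eq_dec (N mod q) (q - 1)) as [E|E].
  - assert (E2 : (S N = q * (N / q + 1) + 0)%nat) by nia.
    assert (D : (S N / q = S (N / q))%nat) by (symmetry; apply (Nat.div_unique (S N) q (S (N / q)) 0); lia).
    assert (M : (S N mod q = 0)%nat) by (symmetry; apply (Nat.mod_unique (S N) q (N / q + 1) 0); lia).
    rewrite M, D. simpl Nat.eqb. cbn [csum]. f_equal. f_equal. lia.
  - assert (E2 : (S N = q * (N / q) + S (N mod q))%nat) by lia.
    assert (D : (S N / q = N / q)%nat) by (symmetry; apply (Nat.div_unique (S N) q _ (S (N mod q))); lia).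
    assert (M : (S N mod q = S (N mod q))%nat) by (symmetry; apply (Nat.mod_unique (S N) q (N / q) (S (N mod q))); lia).
    rewrite M, D. replace (Nat.eqb (S (N mod q)) 0) with false by reflexivity. ring.
Qed.

Module Mangoldt.
Import ssreflect ssrfun ssrbool eqtype ssrnat seq div prime.

(** A number above 1 is a prime power iff it equals its least prime factor raised to the
    multiplicity of that factor; this is decidable and hands [mangoldt] its prime. *)
Definition is_ppow (q : nat) : bool := (1 < q)%N && (q == (pdiv q) ^ (logn (pdiv q) q))%N.
Definition mangoldt (q : nat) : R := if is_ppow q then ln (INR (pdiv q)) else 0%R.
Definition mterm (n q : nat) : C := if (q %| n)%N then RtoC (mangoldt q) else RtoC 0.

Lemma mangoldt_ge0 (q : nat) : Rle 0 (mangoldt q).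
Proof.
  rewrite /mangoldt; case: (boolP (is_ppow q)) => [/andP [q1 _]|_]; last exact: Rle_refl.
  apply: ln_ge_0. have := prime_gt0 (pdiv_prime q1). case: (pdiv q) => [//|n _]; exact: INR_S_pos.
Qed.

Lemma is_ppow_pow (p k : nat) : prime p -> is_ppow (p ^ k.+1)%N.
Proof.
  move=> pp. rewrite /is_ppow pdiv_pfactor // pfactorK // eqxx andbT.
  by apply: leq_trans (prime_gt1 pp) _; rewrite -{1}(expn1 p) leq_exp2l // prime_gt1.
Qed.

(** The prime powers dividing [p m] are those dividing [m] and one more, [p^(v+1)], with [v] the
    multiplicity of [p] in [m]. Powers of another prime are coprime to [p], so for them the factor
    [p] changes nothing. *)
Lemma mterm_step (p m q : nat) : prime p -> (0 < m)%N -> 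
  mterm (p * m) q = Cplus (mterm m q) (if Nat.eqb q (p ^ (logn p m).+1)%N then RtoC (ln (INR p)) else RtoC 0).
Proof.
  move=> pp m0. rewrite /mterm /mangoldt.
  have -> : Nat.eqb q (p ^ (logn p m).+1)%N = (q == (p ^ (logn p m).+1)%N).
  { by apply/idP/idP => [/PeanoNat.Nat.eqb_eq ->|/eqP ->]; [rewrite eqxx|apply/PeanoNat.Nat.eqb_eq]. }
  case: (boolP (is_ppow q)) => [qp|qn]; last first.
  { have -> : (q == (p ^ (logn p m).+1)%N) = false.
      by apply/negP => /eqP E; move: qn; rewrite E is_ppow_pow.
    case: (q %| p * m)%N; case: (q %| m)%N; ring. }
  move: (qp) => /andP [q1 /eqP qe].
  set r := pdiv q in qe *. set e := logn r q in qe.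
  have rp : prime r by apply: pdiv_prime.
  have [E|E] := eqVneq r p.
  - have p0 : (0 < p)%N by apply: prime_gt0.
    have v : logn p (p * m)%N = (logn p m).+1 by rewrite lognM // logn_prime // eqxx.
    have pm0 : (0 < p * m)%N by rewrite muln_gt0 p0.
    rewrite qe E (pfactor_dvdn e pp pm0) (pfactor_dvdn e pp m0) v.
    have -> : (p ^ e == p ^ (logn p m).+1)%N = (e == (logn p m).+1).
      by rewrite eqn_exp2l // prime_gt1.
    rewrite (leq_eqVlt e) ltnS.
    case: (eqVneq e (logn p m).+1) => [->|_] /=; first by rewrite ltnn; ring.
    case: (e <= logn p m)%N; ring.
  - have cop : coprime q p.
      rewrite qe coprimeXl // prime_coprime // dvdn_prime2 //.
    rewrite Gauss_dvdr //.
    have -> : (q == (p ^ (logn p m).+1)%N) = false.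
      apply/negP => /eqP F. move: E. rewrite /r F pdiv_pfactor // eqxx //.
    case: (q %| m)%N; ring.
Qed.

(** Strong induction by removal of the least prime factor [p], each removal contributing [ln p]. The
    limit [N] is free above [n] because the smaller number is summed over the same range. *)
Lemma csum_mterm (n N : nat) : (0 < n)%N -> (n <= N)%N -> csum (mterm n) N = RtoC (ln (INR n)).
Proof.
  elim/ltn_ind: n N => n IH N n0 nN.
  have [n1|n1] := leqP n 1.
  - have -> : n = 1%N by apply/eqP; rewrite eqn_leq n1 n0.
    rewrite ln_1. rewrite (csum_ext _ (fun _ => RtoC 0)); first exact: csum_zero.
    move=> q [/leP q0 _]. rewrite /mterm dvdn1. case: eqP => [->|//].
    by rewrite /mangoldt /is_ppow.
  - set p := pdiv n. have pp : prime p by apply: pdiv_prime.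
    have pd : (p %| n)%N by apply: pdiv_dvd.
    set m := (n %/ p)%N. have nE : n = (p * m)%N by rewrite mulnC divnK.
    have m0 : (0 < m)%N by rewrite divn_gt0 ?prime_gt0 // dvdn_leq.
    have mn : (m < n)%N by apply: ltn_Pdiv => //; apply: prime_gt1.
    rewrite {1}nE. rewrite (csum_ext _ _ _ (fun q _ => mterm_step p m q pp m0)).
    rewrite csum_plus (IH m mn N m0 (leq_trans (ltnW mn) nN)) csum_delta; last first.
    { split; first by apply/leP; rewrite expn_gt0 prime_gt0.
      apply/leP; apply: leq_trans nN. apply: dvdn_leq => //.
      have p0 : (0 < p)%N by apply: prime_gt0.
      have v : logn p (p * m)%N = (logn p m).+1 by rewrite lognM // logn_prime // eqxx.
      have pm0 : (0 < p * m)%N by rewrite muln_gt0 p0.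
      by rewrite nE (pfactor_dvdn _ pp pm0) v. }
    rewrite nE mult_INR. rewrite -RtoC_plus ln_mult. 
    + by rewrite Rplus_comm.
    + by apply: lt_0_INR; apply/ltP; apply: prime_gt0.
    + by apply: lt_0_INR; apply/ltP.
Qed.

Lemma dvdn_dvdb (q n : nat) : (0 < q)%N -> (q %| n)%N = dvdb q n.
Proof.
  move=> q0. apply/idP/idP.
  - move=> /dvdnP [k ->]. rewrite /dvdb. apply/PeanoNat.Nat.eqb_eq. exact: PeanoNat.Nat.Div0.mod_mul.
  - move=> /PeanoNat.Nat.eqb_eq E. have A := PeanoNat.Nat.div_mod_eq n q.
    rewrite E PeanoNat.Nat.add_0_r in A. apply/dvdnP. exists (Nat.div n q). rewrite mulnC. exact: A.
Qed.

Lemma mangoldt_spec (n N : nat) : le 1 n /\ le n N ->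
  csum (fun q => if dvdb q n then RtoC (mangoldt q) else RtoC 0) N = RtoC (ln (INR n)).
Proof.
  move=> [/leP n0 /leP nN]. rewrite -(csum_mterm n N n0 nN). apply: csum_ext => q [/leP q0 _].
  by rewrite /mterm dvdn_dvdb.
Qed.

Lemma mangoldt_le_ln (q : nat) : le 1 q -> Rle (mangoldt q) (ln (INR q)).
Proof.
  move=> /leP q0. have q0' : Rlt 0 (INR q) by apply: lt_0_INR; apply/ltP.
  rewrite /mangoldt; case: (boolP (is_ppow q)) => [/andP [q1 _]|_].
  - apply: ln_le; first by apply: lt_0_INR; apply/ltP; apply: prime_gt0; apply: pdiv_prime.
    by apply: le_INR; apply/leP; apply: pdiv_leq.
  - by apply: ln_ge_0; apply: (le_INR 1); apply/leP.
Qed.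
End Mangoldt.

Definition mangoldt := Mangoldt.mangoldt.

(** * The series of log n and of the von Mangoldt function *)

Definition phi_log (r x : R) : R := (ln x / r + / (r * r)) * rpow x r.

(** [phi_log r x] is the integral of [ln v * v^(-1-r)] from [x] to infinity in closed form, used for
    an integral test. *)
Lemma is_derive_phi_log (r x : R) : 0 < r -> 0 < x ->
  is_derive (phi_log r) x (- (ln x * rpow x (1 + r))).
Proof.
  intros Hr Hx. rewrite (rpow_plus x 1 r), rpow_1 by exact Hx. unfold phi_log, rpow.
  auto_derive; [repeat split; lra|]. field. lra.
Qed.

Lemma ln_3_ge_1 : 1 <= ln 3.
Proof. rewrite <- (ln_exp 1). apply ln_le; [apply exp_pos|apply exp_le_3]. Qed.

Lemma ln_3_le : ln 3 <= 3 / 2.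
Proof.
  rewrite <- (ln_exp (3 / 2)). apply ln_le; [lra|].
  assert (H := exp_ineq1_le (3 / 4)). replace (3 / 2) with (3 / 4 + 3 / 4) by field. rewrite exp_plus. nra.
Qed.

Lemma ln_2_le : ln 2 <= 1.
Proof.
  rewrite <- (ln_exp 1). apply ln_le; [lra|]. generalize (exp_ineq1_le 1). lra.
Qed.

Lemma log_term_antitone (r a b : R) : 0 < r -> 3 <= a -> a <= b ->
  ln b * rpow b (1 + r) <= ln a * rpow a (1 + r).
Proof.
  intros Hr Ha [Hab|Hab]; [|subst; lra].
  destruct (MVT_cor2 (fun x => ln x * rpow x (1 + r)) (fun x => (1 - (1 + r) * ln x) * rpow x (1 + r + 1)) a b Hab) as [c [Hc1 Hc2]].
  - intros c Hc. apply is_derive_Reals.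
    rewrite (rpow_plus c (1 + r) 1), rpow_1 by lra. unfold rpow.
    auto_derive; [repeat split; lra|]. field. lra.
  - assert (L : 1 <= ln c) by (eapply Rle_trans; [apply ln_3_ge_1|apply ln_le; lra]).
    assert (P := rpow_pos c (1 + r + 1)).
    assert ((1 - (1 + r) * ln c) <= 0) by nra.
    assert ((1 - (1 + r) * ln c) * rpow c (1 + r + 1) <= 0) by nra.
    nra.
Qed.

Lemma phi_log_step (r x : R) : 0 < r -> 3 <= x ->
  ln (x + 1) * rpow (x + 1) (1 + r) <= phi_log r x - phi_log r (x + 1).
Proof.
  intros Hr Hx.
  destruct (MVT_cor2 (phi_log r) (fun v => - (ln v * rpow v (1 + r))) x (x + 1)) as [c [Hc1 Hc2]]; [lra| |].
  - intros c Hc. apply is_derive_Reals, is_derive_phi_log; lra.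
  - generalize (log_term_antitone r c (x + 1) Hr ltac:(lra) ltac:(lra)). nra.
Qed.

Lemma ln_le_rpow (p x : R) : 0 < p -> 1 <= x -> ln x <= / p * rpow x (- p).
Proof.
  intros Hp Hx. unfold rpow. assert (H := exp_ineq1_le (- - p * ln x)).
  apply Rmult_le_reg_l with p; [exact Hp|]. rewrite <- Rmult_assoc, Rinv_r, Rmult_1_l by lra. lra.
Qed.

Lemma is_lim_phi_log (r : R) : 0 < r -> is_lim_seq (fun k => phi_log r (INR (S k))) 0.
Proof.
  intros Hr.
  apply (is_lim_seq_le_le (fun _ => 0) _ (fun k => (/ (r / 2) / r + / (r * r)) * rpow (INR (S k)) (r / 2))).
  - intros k. assert (Hk := INR_S_pos k). assert (Hl := ln_ge_0 _ Hk).
    assert (I1 : 0 < / r) by (apply Rinv_0_lt_compat; lra).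
    assert (I2 : 0 < / (r * r)) by (apply Rinv_0_lt_compat; nra).
    assert (P := rpow_pos (INR (S k)) r). split.
    + unfold phi_log. apply Rmult_le_pos; [|lra]. unfold Rdiv. nra.
    + unfold phi_log. rewrite !Rmult_plus_distr_r. apply Rplus_le_compat.
      * assert (L := ln_le_rpow (r / 2) (INR (S k)) ltac:(lra) Hk).
        replace (rpow (INR (S k)) (r / 2)) with (rpow (INR (S k)) (- (r / 2)) * rpow (INR (S k)) r).
        2:{ rewrite <- rpow_plus. f_equal. field. }
        unfold Rdiv at 1 2. rewrite <- Rmult_assoc. apply Rmult_le_compat_r; [lra|].
        unfold Rdiv in L |- *. nra.
      * apply Rmult_le_compat_l; [lra|]. apply rpow_mono_exp; [exact Hk|lra].
  - apply is_lim_seq_const.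
  - replace 0 with ((/ (r / 2) / r + / (r * r)) * 0) by ring.
    apply is_lim_seq_mult'; [apply is_lim_seq_const|]. apply is_lim_seq_rpow. lra.
Qed.

(** The terms are monotone only from 3 on, so those at 2 and 3 are bounded apart, by [1/2] each, and
    those from 4 on by the integral from 3. That integral is at most [1/r^2] because
    [1 + r ln 3 <= 3^r]. *)
Lemma log_series (r : R) : 0 < r -> ex_series (fun k => ln (INR (S k)) * rpow (INR (S k)) (1 + r)) /\
  Series (fun k => ln (INR (S k)) * rpow (INR (S k)) (1 + r)) <= / (r * r) + 1.
Proof.
  intros Hr. set (a := fun k => ln (INR (S k)) * rpow (INR (S k)) (1 + r)).
  set (b := fun k => phi_log r (INR (S (S (S k)))) - phi_log r (INR (S (S (S (S k)))))).
  assert (Hb : is_series b (phi_log r 3)).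
  { replace 3 with (INR 3) by (simpl; ring).
    apply (is_series_telescope (fun k => phi_log r (INR (S (S (S k)))))).
    apply (is_lim_seq_ext (fun k => phi_log r (INR (S (k + 2))))); [intros; do 2 f_equal; lia|].
    apply -> (is_lim_seq_incr_n (fun k => phi_log r (INR (S k))) 2). apply is_lim_phi_log, Hr. }
  assert (Hab : forall k, 0 <= a (S (S (S k))) <= b k).
  { intros k. unfold a, b. split.
    - apply Rmult_le_pos; [apply ln_ge_0, INR_S_pos|left; apply rpow_pos].
    - rewrite (S_INR (S (S (S k)))). apply phi_log_step; [exact Hr|]. rewrite !S_INR. generalize (pos_INR k). lra. }
  assert (E3 : ex_series (fun k => a (S (S (S k))))).
  { apply (@ex_series_le R_AbsRing R_CompleteNormedModule _ b).
    - intros n. change (Rabs (a (S (S (S n)))) <= b n). rewrite Rabs_right; [apply Hab|apply Rle_ge, Hab].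
    - exists (phi_log r 3); exact Hb. }
  assert (E2 : ex_series (fun k => a (S (S k)))) by (apply (ex_series_incr_1 (fun k => a (S (S k)))), E3).
  assert (E1 : ex_series (fun k => a (S k))) by (apply (ex_series_incr_1 (fun k => a (S k))), E2).
  assert (E0 : ex_series a) by (apply (ex_series_incr_1 a), E1).
  split; [exact E0|].
  rewrite Series_incr_1 by exact E0.
  rewrite (Series_incr_1 (fun k => a (S k))) by exact E1.
  rewrite (Series_incr_1 (fun k => a (S (S k)))) by exact E2.
  assert (B3 : Series (fun k => a (S (S (S k)))) <= phi_log r 3).
  { rewrite <- (is_series_unique _ _ Hb). apply Series_le; [exact Hab|]. exists (phi_log r 3); exact Hb. }
  assert (I : 0 < / (r * r)) by (apply Rinv_0_lt_compat; nra).
  assert (B4 : phi_log r 3 <= / (r * r)).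
  { unfold phi_log, rpow.
    assert (H := exp_ineq1_le (r * ln 3)).
    replace (- r * ln 3) with (- (r * ln 3)) by ring. rewrite exp_Ropp.
    replace (ln 3 / r + / (r * r)) with ((1 + r * ln 3) * / (r * r)) by (field; lra).
    assert (P := exp_pos (r * ln 3)).
    apply Rmult_le_reg_r with (exp (r * ln 3)); [exact P|].
    rewrite !Rmult_assoc, Rinv_l, Rmult_1_r by lra. nra. }
  assert (A0 : a 0%nat = 0) by (unfold a; simpl; rewrite ln_1; ring).
  assert (A1 : a 1%nat <= / 2).
  { unfold a. replace (INR 2) with 2 by (simpl; ring).
    assert (P : rpow 2 (1 + r) <= / 2) by (rewrite <- (rpow_1 2) by lra; apply rpow_mono_exp; lra).
    generalize ln_2_le (ln_ge_0 2 ltac:(lra)) (rpow_pos 2 (1 + r)). nra. }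
  assert (A2 : a 2%nat <= / 2).
  { unfold a. replace (INR 3) with 3 by (simpl; ring).
    assert (P : rpow 3 (1 + r) <= / 3) by (rewrite <- (rpow_1 3) by lra; apply rpow_mono_exp; lra).
    generalize ln_3_le ln_3_ge_1 (rpow_pos 3 (1 + r)). nra. }
  lra.
Qed.

(** The Dirichlet series of [- zeta'/zeta]; [rDL] gives its values on the real axis. *)
Definition DL (s : C) : C := CSeries (fun k => RtoC (mangoldt (S k)) * cpow (INR (S k)) s)%C.
Definition rDL (p : R) : R := Series (fun k => mangoldt (S k) * rpow (INR (S k)) p).

Lemma mangoldt_bound (k : nat) : 0 <= mangoldt (S k) <= ln (INR (S k)).
Proof. split; [apply Mangoldt.mangoldt_ge0|apply Mangoldt.mangoldt_le_ln; lia]. Qed.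

Lemma ex_series_mangoldt (r : R) : 0 < r -> ex_series (fun k => mangoldt (S k) * rpow (INR (S k)) (1 + r)).
Proof.
  intros Hr. apply (@ex_series_le R_AbsRing R_CompleteNormedModule _ (fun k => ln (INR (S k)) * rpow (INR (S k)) (1 + r))).
  - intros n. change (Rabs (mangoldt (S n) * rpow (INR (S n)) (1 + r)) <= ln (INR (S n)) * rpow (INR (S n)) (1 + r)).
    generalize (mangoldt_bound n) (rpow_pos (INR (S n)) (1 + r)). intros [A B] P.
    rewrite Rabs_right by nra. nra.
  - apply log_series, Hr.
Qed.

Lemma summable_DL (s : C) : DS s -> summable (fun k => RtoC (mangoldt (S k)) * cpow (INR (S k)) s)%C.
Proof.
  intros Hs. unfold DS in Hs. apply summable_le with (fun k => mangoldt (S k) * rpow (INR (S k)) (1 + (fst s - 1))).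
  - intros n. rewrite Cmod_mult, Cmod_R, Cmod_cpow, Rabs_right by (apply Rle_ge, mangoldt_bound).
    replace (1 + (fst s - 1)) with (fst s) by ring. lra.
  - apply ex_series_mangoldt. lra.
Qed.

Lemma summable_log (s : C) : DS s -> summable (fun k => RtoC (ln (INR (S k))) * cpow (INR (S k)) s)%C.
Proof.
  intros Hs. unfold DS in Hs. apply summable_le with (fun k => ln (INR (S k)) * rpow (INR (S k)) (1 + (fst s - 1))).
  - intros n. rewrite Cmod_mult, Cmod_R, Cmod_cpow, Rabs_right by (apply Rle_ge, ln_ge_0, INR_S_pos).
    replace (1 + (fst s - 1)) with (fst s) by ring. lra.
  - apply log_series. lra.
Qed.

Lemma Cmod_DL_le (s : C) : DS s -> Cmod (DL s) <= rDL (fst s).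
Proof.
  intros Hs. unfold DS in Hs. apply CSeries_bound.
  - intros n. rewrite Cmod_mult, Cmod_R, Cmod_cpow, Rabs_right by (apply Rle_ge, mangoldt_bound). lra.
  - replace (fst s) with (1 + (fst s - 1)) by ring. apply ex_series_mangoldt. lra.
Qed.

Lemma cpow_mult (x y : R) (s : C) : 0 < x -> 0 < y -> cpow (x * y) s = (cpow x s * cpow y s)%C.
Proof.
  intros Hx Hy. unfold cpow. rewrite <- Cexp_plus, ln_mult by assumption. f_equal.
  rewrite !RtoC_opp, RtoC_plus. ring.
Qed.

Lemma ZD_tail (s : C) (M : nat) : DS s -> (1 <= M)%nat ->
  Cmod (ZD s - csum (fun m => cpow (INR m) s) M)%C <= / (fst s - 1) * rpow (INR M) (fst s - 1).
Proof.
  intros Hs HM. assert (Hs' := Hs). unfold DS in Hs'. set (r := fst s - 1).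
  assert (Sm : forall M, summable (fun k => cpow (INR (M + S k)) s)).
  { intros K. induction K as [|K IH]; [apply summable_ZD, Hs|].
    apply (ex_series_incr_1 (fun k => Cmod (cpow (INR (K + S k)) s))) in IH.
    apply (ex_series_ext (fun k => Cmod (cpow (INR (K + S (S k))) s))); [|exact IH]. intros n. cbv beta. assert (En : (K + S (S n) = S K + S n)%nat) by lia. rewrite En. reflexivity. }
  assert (E : forall M, (ZD s - csum (fun m => cpow (INR m) s) M)%C = CSeries (fun k => cpow (INR (M + S k)) s)).
  { intros K. induction K as [|K IH].
    - simpl csum. replace (ZD s - 0)%C with (ZD s) by ring. reflexivity.
    - cbn [csum]. replace (ZD s - (csum (fun m : nat => cpow (INR m) s) K + cpow (INR (S K)) s))%C
        with ((ZD s - csum (fun m : nat => cpow (INR m) s) K) - cpow (INR (S K)) s)%C by ring.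
      rewrite IH. unfold CSeries.
      rewrite (Series_incr_1 (fun n => fst (cpow (INR (K + S n)) s))) by (apply (summable_fst _ (Sm K))).
      rewrite (Series_incr_1 (fun n => snd (cpow (INR (K + S n)) s))) by (apply (summable_snd _ (Sm K))).
      replace (K + 1)%nat with (S K) by lia.
      rewrite (Series_ext (fun k => fst (cpow (INR (K + S (S k))) s)) (fun k => fst (cpow (INR (S K + S k)) s)))
        by (intros k; assert (En : (K + S (S k) = S K + S k)%nat) by lia; rewrite En; reflexivity).
      rewrite (Series_ext (fun k => snd (cpow (INR (K + S (S k))) s)) (fun k => snd (cpow (INR (S K + S k)) s)))
        by (intros k; assert (En : (K + S (S k) = S K + S k)%nat) by lia; rewrite En; reflexivity).
      apply injective_projections; cbn -[INR Series cpow]; ring. }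
  rewrite E.
  assert (HT : is_series (fun k => / r * (rpow (INR (M + k)) r - rpow (INR (M + S k)) r)) (/ r * rpow (INR M) r)).
  { apply (@is_series_scal R_AbsRing R_NormedModule (/ r)).
    replace (INR M) with (INR (M + 0)) by (f_equal; lia).
    apply (is_series_telescope (fun k => rpow (INR (M + k)) r)).
    destruct M as [|M']; [lia|].
    apply (is_lim_seq_ext (fun k => rpow (INR (S (k + M'))) r)); [intros; do 2 f_equal; lia|].
    apply -> (is_lim_seq_incr_n (fun k => rpow (INR (S k)) r) M'). apply is_lim_seq_rpow. unfold r; lra. }
  rewrite <- (is_series_unique _ _ HT).
  apply CSeries_bound; [|exists (/ r * rpow (INR M) r); exact HT].
  intros k. rewrite Cmod_cpow. replace (fst s) with (1 + r) by (unfold r; ring).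
  replace (M + S k)%nat with (S (M + k)) by lia. rewrite S_INR. apply rpow_step; [unfold r; lra|].
  apply lt_0_INR. lia.
Qed.

(** The logarithm is the Dirichlet convolution of the von Mangoldt function with 1; the order of
    summation is exchanged while everything is finite. *)
Lemma log_convolution (s : C) (N : nat) :
  csum (fun n => RtoC (ln (INR n)) * cpow (INR n) s)%C N =
  csum (fun q => RtoC (mangoldt q) * cpow (INR q) s * csum (fun m => cpow (INR m) s) (N / q))%C N.
Proof.
  transitivity (csum (fun n => csum (fun q => if dvdb q n then RtoC (mangoldt q) * cpow (INR n) s else 0)%C N) N).
  - apply csum_ext. intros n Hn. rewrite <- (Mangoldt.mangoldt_spec n N) by lia.
    rewrite Cmult_comm, <- csum_scal. apply csum_ext. intros q Hq. destruct (dvdb q n); [apply Cmult_comm|ring].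
  - rewrite csum_switch. apply csum_ext. intros q Hq.
    rewrite (csum_multiples (fun n => RtoC (mangoldt q) * cpow (INR n) s)%C) by lia.
    rewrite <- csum_scal. apply csum_ext. intros m Hm.
    rewrite mult_INR, cpow_mult; [ring| |]; apply lt_0_INR; lia.
Qed.

Lemma csum_le_Series (a : nat -> R) (N : nat) : (forall n, 0 <= a n) -> ex_series a ->
  fst (csum (fun n => RtoC (a (pred n))) N) <= Series a.
Proof.
  intros Ha He.
  assert (H0 : 0 <= Series a).
  { replace 0 with (Series (fun n => 0 * a n)) by (rewrite Series_scal_l; ring).
    apply Series_le; [|exact He]. intros n. generalize (Ha n). lra. }
  destruct N as [|N]; [simpl; exact H0|].
  rewrite <- (sum_n_csum (fun n => RtoC (a (pred n)))), fst_sum_n. simpl.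
  apply (is_lim_seq_incr_compare (sum_n a)).
  - apply Series_correct, He.
  - intros n. rewrite sum_Sn. generalize (Ha (S n)). unfold plus; simpl. lra.
Qed.

(** The inner sums over [m <= N/q] are replaced by [ZD s], at the cost of a tail of size
    [(N/q)^(-r) / r]. Half of this exponent is given up to get [N^(-r/2) q^(r/2)]: the error tends
    to 0 with [N], and the sum of [mangoldt q * q^(-1-r/2)] still converges. *)
Lemma log_series_product (s : C) : DS s ->
  CSeries (fun k => RtoC (ln (INR (S k))) * cpow (INR (S k)) s)%C = (DL s * ZD s)%C.
Proof.
  intros Hs. assert (Hs' := Hs). unfold DS in Hs'. set (r := fst s - 1). assert (Hr : 0 < r) by (unfold r; lra).
  apply (is_Clim_unique (sum_n (fun k => RtoC (ln (INR (S k))) * cpow (INR (S k)) s)%C)); [apply is_Clim_sum, summable_log, Hs|].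
  apply is_Clim_ext with (fun m => ZD s * sum_n (fun k => RtoC (mangoldt (S k)) * cpow (INR (S k)) s) m +
     csum (fun q => RtoC (mangoldt q) * cpow (INR q) s * - (ZD s - csum (fun m => cpow (INR m) s) (S m / q))) (S m))%C.
  { intros m. rewrite (sum_n_csum (fun n => RtoC (ln (INR n)) * cpow (INR n) s)%C).
    rewrite (sum_n_csum (fun n => RtoC (mangoldt n) * cpow (INR n) s)%C).
    rewrite log_convolution, <- csum_scal, <- csum_plus. apply csum_ext. intros q Hq. ring. }
  replace (DL s * ZD s)%C with (ZD s * DL s + 0)%C by ring.
  apply is_Clim_plus.
  - destruct (is_Clim_sum _ (summable_DL s Hs)) as [A B]. fold (DL s) in A, B.
    split; simpl.
    + apply is_lim_seq_minus'; apply is_lim_seq_mult'; try assumption; apply is_lim_seq_const.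
    + apply is_lim_seq_plus'; apply is_lim_seq_mult'; try assumption; apply is_lim_seq_const.
  - apply is_Clim_0.
    set (K := / r * exp (r / 2 * ln 2) * Series (fun k => mangoldt (S k) * rpow (INR (S k)) (1 + r / 2))).
    apply (is_lim_seq_le_le (fun _ => 0) _ (fun m => K * rpow (INR (S m)) (r / 2))).
    + intros m. split; [apply Cmod_ge_0|].
      eapply Rle_trans; [apply csum_bound|].
      apply Rle_trans with (fst (csum (fun n => RtoC (/ r * exp (r / 2 * ln 2) * rpow (INR (S m)) (r / 2) * (mangoldt n * rpow (INR n) (1 + r / 2)))) (S m))).
      * apply csum_RtoC_le. intros q Hq.
        rewrite !Cmod_mult, Cmod_opp, Cmod_R, Cmod_cpow.
        assert (Hq1 : 1 <= INR q) by (apply (le_INR 1); lia).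
        destruct q as [|q]; [lia|]. rewrite Rabs_right by (apply Rle_ge, mangoldt_bound).
        set (M := (S m / S q)%nat).
        assert (HM : (1 <= M)%nat) by (unfold M; apply Nat.div_le_lower_bound; lia).
        (* Rounding the quotient down loses at most a factor 2, since it is at least 1. *)
        assert (HMR : INR (S m) / (2 * INR (S q)) <= INR M).
        { assert (A := Nat.div_mod_eq (S m) (S q)). assert (B := Nat.mod_upper_bound (S m) (S q) ltac:(lia)). fold M in A.
          assert (Hm : (S m <= 2 * S q * M)%nat) by nia.
          apply le_INR in Hm. rewrite !mult_INR in Hm. replace (INR 2) with 2 in Hm by (simpl; ring).
          apply Rmult_le_reg_r with (2 * INR (S q)); [lra|].
          unfold Rdiv. rewrite Rmult_assoc, Rinv_l by lra. lra. }
        assert (T := ZD_tail s M Hs HM). fold r in T.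
        assert (HMp : 1 <= INR M) by (apply (le_INR 1); lia).
        assert (T2 : rpow (INR M) r <= exp (r / 2 * ln 2) * rpow (INR (S m)) (r / 2) * rpow (INR (S q)) (- (r / 2))).
        { apply Rle_trans with (rpow (INR M) (r / 2)); [apply rpow_mono_exp; lra|].
          assert (Hm0 := INR_S_pos m).
          apply Rle_trans with (rpow (INR (S m) / (2 * INR (S q))) (r / 2)).
          - apply rpow_antitone; [|exact HMR|lra]. apply Rdiv_lt_0_compat; lra.
          - right. unfold rpow. rewrite <- !exp_plus. f_equal.
            rewrite ln_div by lra. rewrite ln_mult by lra. ring. }
        assert (P := rpow_pos (INR (S q)) (fst s)). destruct (mangoldt_bound q) as [L0 _].
        assert (Ir : 0 < / r) by (apply Rinv_0_lt_compat; exact Hr).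
        apply Rle_trans with (mangoldt (S q) * rpow (INR (S q)) (fst s) *
           (/ r * (exp (r / 2 * ln 2) * rpow (INR (S m)) (r / 2) * rpow (INR (S q)) (- (r / 2))))).
        -- apply Rmult_le_compat_l; [apply Rmult_le_pos; lra|].
           eapply Rle_trans; [exact T|]. apply Rmult_le_compat_l; [lra|exact T2].
        -- right. replace (fst s) with ((1 + r / 2) + r / 2) by (unfold r; field).
           rewrite (rpow_plus (INR (S q)) (1 + r / 2) (r / 2)).
           assert (E : rpow (INR (S q)) (r / 2) * rpow (INR (S q)) (- (r / 2)) = 1).
           { rewrite <- rpow_plus. replace (r / 2 + - (r / 2)) with 0 by ring. unfold rpow. rewrite Ropp_0, Rmult_0_l. apply exp_0. }
           transitivity (mangoldt (S q) * rpow (INR (S q)) (1 + r / 2) * (/ r * (exp (r / 2 * ln 2) * rpow (INR (S m)) (r / 2))) * (rpow (INR (S q)) (r / 2) * rpow (INR (S q)) (- (r / 2)))); [ring|].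
           rewrite E. ring.
      * assert (E : forall c f N, fst (csum (fun n => RtoC (c * f n)) N) = c * fst (csum (fun n => RtoC (f n)) N)).
        { intros c f N. induction N as [|N IH]; simpl; [ring|]. rewrite IH. ring. }
        rewrite (E _ (fun n => mangoldt n * rpow (INR n) (1 + r / 2))). unfold K.
        assert (I : fst (csum (fun n => RtoC (mangoldt n * rpow (INR n) (1 + r / 2))) (S m)) <=
          Series (fun k => mangoldt (S k) * rpow (INR (S k)) (1 + r / 2))).
        { rewrite (csum_ext _ (fun n => RtoC ((fun k => mangoldt (S k) * rpow (INR (S k)) (1 + r / 2)) (pred n)))).
          - apply (csum_le_Series (fun k => mangoldt (S k) * rpow (INR (S k)) (1 + r / 2))).
            + intros n. apply Rmult_le_pos; [apply mangoldt_bound|left; apply rpow_pos].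
            + apply ex_series_mangoldt. lra.
          - intros n Hn. destruct n; [lia|]. reflexivity. }
        assert (Q : 0 <= / r * exp (r / 2 * ln 2) * rpow (INR (S m)) (r / 2)).
        { apply Rmult_le_pos; [apply Rmult_le_pos|left; apply rpow_pos]; left; [apply Rinv_0_lt_compat, Hr|apply exp_pos]. }
        nra.
    + apply is_lim_seq_const.
    + replace 0 with (K * 0) by ring. apply is_lim_seq_mult'; [apply is_lim_seq_const|]. apply is_lim_seq_rpow. lra.
Qed.

Lemma Dc_ZD_DL (s : C) : DS s -> Dc ZD s = (- (DL s * ZD s))%C.
Proof.
  intros Hs. rewrite Dc_ZD, <- log_series_product by exact Hs.
  replace (- CSeries (fun k => RtoC (ln (INR (S k))) * cpow (INR (S k)) s))%C
    with ((-(1)) * CSeries (fun k => RtoC (ln (INR (S k))) * cpow (INR (S k)) s))%C by ring.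
  rewrite <- CSeries_scal by (apply summable_log, Hs).
  apply CSeries_ext. intros n. rewrite RtoC_opp. ring.
Qed.

Lemma cpow_real (x p : R) : cpow x (p, 0) = RtoC (rpow x p).
Proof.
  unfold cpow, Cexp, rpow. simpl. replace (- ln x * 0 + 0 * p) with 0 by ring. rewrite cos_0, sin_0.
  unfold RtoC. f_equal; [|ring]. rewrite Rmult_1_r. f_equal. ring.
Qed.

Lemma CSeries_real (a : nat -> R) : CSeries (fun n => RtoC (a n)) = RtoC (Series a).
Proof.
  unfold CSeries, RtoC. simpl. f_equal.
  transitivity (0 * Series (fun _ : nat => 0)); [|ring].
  rewrite <- Series_scal_l. apply Series_ext. intros; ring.
Qed.

Lemma ZD_real (p : R) : ZD (p, 0) = RtoC (rzeta p).
Proof. unfold ZD, rzeta. rewrite <- CSeries_real. apply CSeries_ext. intros n. apply cpow_real. Qed.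

Lemma DL_real (p : R) : DL (p, 0) = RtoC (rDL p).
Proof.
  unfold DL, rDL. rewrite <- CSeries_real. apply CSeries_ext. intros n. rewrite cpow_real, RtoC_mult. reflexivity.
Qed.

(** [log_series_product] at the real point [1 + r], divided by [zeta(1 + r) >= 1/r]. The term [1/r]
    has the right leading constant, which matters later at [r = 1/D] on the right side of the
    strip. *)
Lemma rDL_bound (r : R) : 0 < r -> rDL (1 + r) <= / r + r.
Proof.
  intros Hr. assert (Hs : DS (1 + r, 0)) by (unfold DS; simpl; lra).
  assert (E := log_series_product _ Hs). rewrite DL_real, ZD_real in E.
  rewrite (CSeries_ext _ (fun k => RtoC (ln (INR (S k)) * rpow (INR (S k)) (1 + r)))) in E.
  2:{ intros n. rewrite cpow_real, RtoC_mult. reflexivity. }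
  rewrite CSeries_real in E. apply (f_equal fst) in E. cbn -[INR] in E.
  destruct (log_series r Hr) as [_ B]. assert (Z := rzeta_ge r Hr).
  assert (Ir : 0 < / r) by (apply Rinv_0_lt_compat; exact Hr).
  assert (E2 : rDL (1 + r) * rzeta (1 + r) <= / (r * r) + 1) by lra.
  destruct (Rle_dec (rDL (1 + r)) 0); [lra|].
  assert (rDL (1 + r) * / r <= / (r * r) + 1) by nra.
  apply Rmult_le_reg_r with (/ r); [exact Ir|].
  replace ((/ r + r) * / r) with (/ (r * r) + 1) by (field; lra). assumption.
Qed.

Lemma antitone_of_derive (f f' : R -> R) (a b : R) : a <= b ->
  (forall x, a <= x <= b -> is_derive f x (f' x)) -> (forall x, a <= x <= b -> f' x <= 0) -> f b <= f a.
Proof.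
  intros [Hab|Hab] Hd Hn; [|subst; lra].
  destruct (MVT_cor2 f f' a b Hab) as [c [Hc1 Hc2]].
  - intros c Hc. apply is_derive_Reals, Hd, Hc.
  - specialize (Hn c ltac:(lra)). nra.
Qed.

Lemma rDL_antitone (p q : R) : 1 < p -> p <= q -> rDL q <= rDL p.
Proof.
  intros Hp Hq. apply Series_le.
  - intros n. generalize (mangoldt_bound n) (rpow_pos (INR (S n)) q). intros [A _] B. split; [nra|].
    apply Rmult_le_compat_l; [exact A|]. apply rpow_mono_exp; [apply INR_S_pos|exact Hq].
  - replace p with (1 + (p - 1)) by ring. apply ex_series_mangoldt. lra.
Qed.

(** * Absence of zeros on and to the right of Re s = 1, and under RH for Re s > 1/2 *)

Lemma ZD_deriv (s : C) : DS s -> is_Cder ZD s (- (DL s * ZD s))%C.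
Proof.
  intros Hs. rewrite <- Dc_ZD_DL by exact Hs. apply (hol_ZD 1), Hs.
Qed.

Lemma ZD_large (s : C) : 4 <= fst s -> Cmod (ZD s - 1)%C <= / 2.
Proof.
  intros H. eapply Rle_trans; [apply ZD_near_1; lra|].
  assert (P : rpow 2 (fst s - 2) <= rpow 2 (1 + 1)) by (apply rpow_mono_exp; lra).
  rewrite rpow_plus, rpow_1 in P by lra. lra.
Qed.

(** [|ZD|^2 exp (- 2 K x)] is decreasing on a horizontal line, so a zero would propagate to the right, where [ZD] is near 1. *)
Lemma ZD_neq_0 (s : C) : DS s -> ZD s <> 0%C.
Proof.
  destruct s as [a y]. intros Hs H0. unfold DS in Hs; simpl in Hs.
  set (b := Rmax a 4). assert (Hab : a <= b) by apply Rmax_l. assert (Hb4 : 4 <= b) by apply Rmax_r.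
  (* [rDL] decreases, so [K] bounds [|zeta'/zeta|] on the whole half-line to the right of [a]. *)
  set (K := rDL a).
  assert (M : Cmod (ZD (b, y)) * Cmod (ZD (b, y)) * exp (- 2 * K * b) <= Cmod (ZD (a, y)) * Cmod (ZD (a, y)) * exp (- 2 * K * a)).
  { apply (antitone_of_derive (fun x => Cmod (ZD (x, y)) * Cmod (ZD (x, y)) * exp (- 2 * K * x))
      (fun x => (- 2 * fst (DL (x, y)) - 2 * K) * (Cmod (ZD (x, y)) * Cmod (ZD (x, y))) * exp (- 2 * K * x))); [exact Hab| |].
    - intros x Hx. assert (HD : DS (x, y)) by (unfold DS; simpl; lra).
      destruct (is_Cder_x _ _ _ _ (ZD_deriv _ HD)) as [A B].
      set (z := ZD (x, y)) in *. set (d := DL (x, y)) in *.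
      apply (is_derive_ext (fun x => (fst (ZD (x, y)) * fst (ZD (x, y)) + snd (ZD (x, y)) * snd (ZD (x, y))) * exp (- 2 * K * x))).
      { intros t. rewrite Cmod_sq. reflexivity. }
      replace ((- 2 * fst d - 2 * K) * (Cmod z * Cmod z) * exp (- 2 * K * x))
        with (((fst (- (d * z))%C * fst z + fst z * fst (- (d * z))%C) + (snd (- (d * z))%C * snd z + snd z * snd (- (d * z))%C)) * exp (- 2 * K * x)
           + (fst z * fst z + snd z * snd z) * (- 2 * K * exp (- 2 * K * x))).
      2:{ rewrite Cmod_sq. simpl. ring. }
      apply (is_derive_mult (fun x => fst (ZD (x, y)) * fst (ZD (x, y)) + snd (ZD (x, y)) * snd (ZD (x, y))) (fun x => exp (- 2 * K * x))).
      + apply (is_derive_plus (fun x : R => fst (ZD (x, y)) * fst (ZD (x, y))) (fun x : R => snd (ZD (x, y)) * snd (ZD (x, y)))).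
        * apply (is_derive_mult (fun x : R => fst (ZD (x, y))) (fun x : R => fst (ZD (x, y)))); [exact A|exact A|intros; apply Rmult_comm].
        * apply (is_derive_mult (fun x : R => snd (ZD (x, y))) (fun x : R => snd (ZD (x, y)))); [exact B|exact B|intros; apply Rmult_comm].
      + auto_derive; [exact I|ring].
      + intros; apply Rmult_comm.
    - intros x Hx. assert (HD : DS (x, y)) by (unfold DS; simpl; lra).
      assert (L : - fst (DL (x, y)) <= K).
      { apply Rle_trans with (Cmod (DL (x, y))).
        - generalize (fst_le_Cmod (DL (x, y))) (Rabs_maj2 (fst (DL (x, y)))). lra.
        - eapply Rle_trans; [apply Cmod_DL_le, HD|]. apply rDL_antitone; simpl; lra. }
      assert (0 <= Cmod (ZD (x, y)) * Cmod (ZD (x, y))) by (apply Rmult_le_pos; apply Cmod_ge_0).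
      assert (P := exp_pos (- 2 * K * x)).
      assert ((- 2 * fst (DL (x, y)) - 2 * K) * (Cmod (ZD (x, y)) * Cmod (ZD (x, y))) <= 0) by nra.
      nra. }
  rewrite H0, Cmod_0, !Rmult_0_l in M.
  assert (E : 1 / 2 <= Cmod (ZD (b, y))).
  { assert (A := ZD_large (b, y) Hb4). assert (B := Cmod_triangle_inv 1 (ZD (b, y))).
    rewrite Cmod_1, Cmod_minus_sym in B. lra. }
  assert (P := exp_pos (- 2 * K * b)).
  assert (0 < Cmod (ZD (b, y)) * Cmod (ZD (b, y)) * exp (- 2 * K * b)).
  { apply Rmult_lt_0_compat; [apply Rmult_lt_0_compat; lra|exact P]. }
  lra.
Qed.

Lemma fst_cpow (x p y : R) : fst (cpow x (p, y)) = rpow x p * cos (y * ln x).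
Proof.
  unfold cpow, Cexp, rpow. simpl. f_equal.
  - f_equal. ring.
  - rewrite <- cos_neg. f_equal. ring.
Qed.

Lemma fst_DL (p y : R) : fst (DL (p, y)) = Series (fun k => mangoldt (S k) * rpow (INR (S k)) p * cos (y * ln (INR (S k)))).
Proof.
  unfold DL, CSeries. cbn [fst]. apply Series_ext. intros n.
  rewrite Rmult_assoc, <- fst_cpow. simpl. ring.
Qed.

Lemma ex_series_DL_cos (p y : R) : 1 < p -> ex_series (fun k => mangoldt (S k) * rpow (INR (S k)) p * cos (y * ln (INR (S k)))).
Proof.
  intros Hp. apply (ex_series_ext (fun k => fst (RtoC (mangoldt (S k)) * cpow (INR (S k)) (p, y))%C)).
  - intros n. rewrite Rmult_assoc, <- fst_cpow. simpl. apply Rminus_0_r_alt || (unfold Rminus; ring).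
  - apply summable_fst. apply summable_DL. exact Hp.
Qed.

(** The sum is decreasing in [p], its derivative being minus a series of nonnegative terms, and tends to 0. *)
Lemma trig_positivity (c0 c1 c2 : R) : 0 <= c0 -> 0 <= c1 -> 0 <= c2 ->
  (forall th, 0 <= c0 + c1 * cos th + c2 * cos (2 * th)) ->
  forall p y, 1 < p ->
  0 <= c0 * ln (Cmod (ZD (p, 0))) + c1 * ln (Cmod (ZD (p, y))) + c2 * ln (Cmod (ZD (p, 2 * y))).
Proof.
  intros H0 H1 H2 Ht p y Hp.
  set (H := fun x => c0 * ln (Cmod (ZD (x, 0))) + c1 * ln (Cmod (ZD (x, y))) + c2 * ln (Cmod (ZD (x, 2 * y)))).
  change (0 <= H p).
  assert (Hd : forall v x, 1 < x -> is_derive (fun x => ln (Cmod (ZD (x, v)))) x (- fst (DL (x, v)))).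
  { intros v x Hx. assert (HD : DS (x, v)) by exact Hx.
    replace (- fst (DL (x, v))) with (fst (- (DL (x, v) * ZD (x, v)) / ZD (x, v))%C).
    - apply (is_derive_ln_Cmod (fun r => ZD (r, v))); [apply is_Cder_x, ZD_deriv, HD|apply ZD_neq_0, HD].
    - replace (- (DL (x, v) * ZD (x, v)) / ZD (x, v))%C with (- DL (x, v))%C by (field; apply ZD_neq_0, HD). reflexivity. }
  assert (Hanti : forall q, p <= q -> H q <= H p).
  { intros q Hq. apply (antitone_of_derive H (fun x => c0 * - fst (DL (x, 0)) + c1 * - fst (DL (x, y)) + c2 * - fst (DL (x, 2 * y)))); [exact Hq| |].
    - intros x Hx. unfold H.
      apply (is_derive_plus (fun x => c0 * ln (Cmod (ZD (x, 0))) + c1 * ln (Cmod (ZD (x, y)))) (fun x => c2 * ln (Cmod (ZD (x, 2 * y))))).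
      + apply (is_derive_plus (fun x => c0 * ln (Cmod (ZD (x, 0)))) (fun x => c1 * ln (Cmod (ZD (x, y))))); apply is_derive_scal, Hd; lra.
      + apply is_derive_scal, Hd; lra.
    - intros x Hx. rewrite !fst_DL.
      set (A := fun v k => mangoldt (S k) * rpow (INR (S k)) x * cos (v * ln (INR (S k)))).
      assert (EA : forall v, ex_series (A v)) by (intros v; apply ex_series_DL_cos; lra).
      change (c0 * - Series (A 0) + c1 * - Series (A y) + c2 * - Series (A (2 * y)) <= 0).
      assert (E : c0 * Series (A 0) + c1 * Series (A y) + c2 * Series (A (2 * y)) = Series (fun k => c0 * A 0 k + c1 * A y k + c2 * A (2 * y) k)).
      { rewrite Series_plus, Series_plus, !Series_scal_l; [reflexivity| | | |];
          try (apply (@ex_series_plus R_AbsRing R_NormedModule)); apply (@ex_series_scal R_AbsRing R_NormedModule); apply EA. }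
      assert (P : 0 <= Series (fun k => c0 * A 0 k + c1 * A y k + c2 * A (2 * y) k)).
      { assert (EX : ex_series (fun k => c0 * A 0 k + c1 * A y k + c2 * A (2 * y) k)).
        { apply (@ex_series_plus R_AbsRing R_NormedModule _ (fun k => c2 * A (2 * y) k));
          [apply (@ex_series_plus R_AbsRing R_NormedModule (fun k => c0 * A 0 k) (fun k => c1 * A y k))|];
          apply (@ex_series_scal R_AbsRing R_NormedModule); apply EA. }
        apply Rle_trans with (Series (fun k => 0 * (c0 * A 0 k + c1 * A y k + c2 * A (2 * y) k))); [rewrite Series_scal_l; lra|].
        apply Series_le; [|exact EX].
        intros n. rewrite Rmult_0_l. split; [lra|].
        unfold A. rewrite Rmult_0_l, cos_0.
        destruct (mangoldt_bound n) as [L _]. assert (Q := rpow_pos (INR (S n)) x).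
        specialize (Ht (y * ln (INR (S n)))). rewrite <- Rmult_assoc in Ht.
        set (w := mangoldt (S n) * rpow (INR (S n)) x) in *.
        assert (Hw : 0 <= w) by (apply Rmult_le_pos; lra).
        assert (Hm := Rmult_le_pos _ _ Hw Ht). lra. }
      lra. }
  (* A quantitative form of [ln |zeta| -> 0], from [|ZD - 1| <= 2 * 2^(2-q)] and
     [ln m >= 1 - 1/m]. *)
  assert (Hlow : forall v q, 4 <= q -> - (4 * rpow 2 (q - 2)) <= ln (Cmod (ZD (q, v)))).
  { intros v q Hq. assert (A := ZD_near_1 (q, v) ltac:(simpl; lra)). cbn [fst] in A.
    assert (A2 := ZD_large (q, v) Hq).
    assert (B := Cmod_triangle_inv 1 (ZD (q, v))). rewrite Cmod_1, Cmod_minus_sym in B.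
    set (m := Cmod (ZD (q, v))) in *. assert (Hm : / 2 <= m) by lra.
    assert (L : 1 - / m <= ln m).
    { assert (K := exp_ineq1_le (- ln m)). rewrite exp_Ropp, exp_ln in K by lra. lra. }
    assert (I : / m - 1 = (1 - m) * / m) by (field; lra).
    assert (Im : / m <= 2) by (rewrite <- (Rinv_inv 2); apply Rinv_le_contravar; lra).
    assert (Ip : 0 < / m) by (apply Rinv_0_lt_compat; lra).
    assert (P := rpow_pos 2 (q - 2)).
    destruct (Rle_dec m 1); nra. }
  set (S4 := 4 * (c0 + c1 + c2)).
  assert (Hb : forall q, 4 <= q -> p <= q -> - (S4 * rpow 2 (q - 2)) <= H p).
  { intros q Hq1 Hq2. eapply Rle_trans; [|apply Hanti, Hq2]. unfold H, S4.
    generalize (Hlow 0 q Hq1) (Hlow y q Hq1) (Hlow (2 * y) q Hq1). nra. }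
  apply Rnot_lt_le. intros Hneg.
  (* Large enough that [S4 * 2^(2-q)] drops below [- H p], by way of [2^v >= 1 + v/2]. *)
  set (q := 2 + (p + 2 + 4 * S4 / - H p)).
  assert (HS : 0 <= S4 / - H p) by (apply Rmult_le_pos; [unfold S4; lra|left; apply Rinv_0_lt_compat; lra]).
  assert (Hq1 : 4 <= q) by (unfold q; lra). assert (Hq2 : p <= q) by (unfold q; lra).
  specialize (Hb q Hq1 Hq2).
  assert (L2 : / 2 <= ln 2).
  { assert (K := exp_ineq1_le (- ln 2)). rewrite exp_Ropp, exp_ln in K by lra. lra. }
  assert (R2 : rpow 2 (q - 2) * (1 + (q - 2) / 2) <= 1).
  { unfold rpow. assert (K := exp_ineq1_le ((q - 2) * ln 2)).
    replace (- (q - 2) * ln 2) with (- ((q - 2) * ln 2)) by ring. rewrite exp_Ropp.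
    assert (P := exp_pos ((q - 2) * ln 2)).
    apply Rmult_le_reg_l with (exp ((q - 2) * ln 2)); [exact P|].
    rewrite <- Rmult_assoc, Rinv_r by lra. nra. }
  assert (P := rpow_pos 2 (q - 2)).
  assert (E : S4 = (S4 / - H p) * (- H p)) by (field; lra).
  assert (HS0 : 0 <= S4) by (unfold S4; lra).
  assert (S4 * (rpow 2 (q - 2) * (1 + (q - 2) / 2)) <= S4) by nra.
  assert (Q : (q - 2) / 2 >= 2 * (S4 / - H p)) by (unfold q; lra).
  assert ((- H p) * (1 + (q - 2) / 2) <= S4).
  { apply Rle_trans with (S4 * rpow 2 (q - 2) * (1 + (q - 2) / 2)); [|lra].
    apply Rmult_le_compat_r; lra. }
  nra.
Qed.

Lemma rzeta_gt_0 (p : R) : 1 < p -> 0 < rzeta p.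
Proof.
  intros H. replace p with (1 + (p - 1)) by ring. eapply Rlt_le_trans; [|apply rzeta_ge; lra].
  apply Rinv_0_lt_compat; lra.
Qed.

Lemma Cmod_ZD_real (p : R) : 1 < p -> Cmod (ZD (p, 0)) = rzeta p.
Proof. intros H. rewrite ZD_real, Cmod_R, Rabs_right; [reflexivity|]. generalize (rzeta_gt_0 p H). lra. Qed.

(** The case [1 + cos >= 0] of [trig_positivity], that is, [zeta(p) |zeta(p + i y)| >= 1]. *)
Lemma ln_ZD_ge (s : C) : DS s -> - ln (rzeta (fst s)) <= ln (Cmod (ZD s)).
Proof.
  destruct s as [p y]. intros Hs. unfold DS in Hs; cbn [fst] in *.
  assert (A := trig_positivity 1 1 0 ltac:(lra) ltac:(lra) ltac:(lra)).
  assert (B := A ltac:(intros th; generalize (COS_bound th); lra) p y Hs).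
  rewrite Cmod_ZD_real in B by exact Hs. lra.
Qed.

Lemma ln_ZD_le (s : C) : DS s -> ln (Cmod (ZD s)) <= ln (rzeta (fst s)).
Proof.
  intros Hs. apply ln_le; [apply Cmod_gt_0, ZD_neq_0, Hs|apply Cmod_ZD_le, Hs].
Qed.

Lemma ln_monomial (u k m : R) : 0 < u -> 0 < k -> 0 < m ->
  ln (u * u * u * (k * k * k * k) * m) = 3 * ln u + 4 * ln k + ln m.
Proof.
  intros Hu Hk Hm. assert (0 < u * u) by nra. assert (0 < u * u * u) by nra.
  assert (0 < k * k) by nra. assert (0 < k * k * k) by nra. assert (0 < k * k * k * k) by nra.
  assert (0 < u * u * u * (k * k * k * k)) by nra.
  rewrite !ln_mult by assumption. ring.
Qed.

(** Mertens' argument with [3 + 4 cos th + cos (2 th) = 2 (1 + cos th)^2]: the product of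
    [zeta(1+r)^3], [|zeta(1+r+iy)|^4] and [|zeta(1+r+2iy)|] is at least 1, while a zero at [1 + i y]
    bounds it by [(2/r)^3 (K r)^4 K2 = 8 K^4 K2 r]. *)
Lemma Zt_line_1 (y : R) : 0 < y -> Zt (1, y) <> 0%C.
Proof.
  intros Hy H0.
  assert (D1 : DZ (1, y)) by (unfold DZ; simpl; lra).
  assert (D2 : DZ (1, 2 * y)) by (unfold DZ; simpl; lra).
  destruct (hol_Zt 1) as [Hd _].
  set (K := Cmod (Dc Zt (1, y)) + 1). set (K2 := Cmod (Zt (1, 2 * y)) + 1).
  assert (HK : 1 <= K) by (unfold K; generalize (Cmod_ge_0 (Dc Zt (1, y))); lra).
  assert (HK2 : 1 <= K2) by (unfold K2; generalize (Cmod_ge_0 (Zt (1, 2 * y))); lra).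
  destruct (is_Cder_lip _ _ _ (Hd _ D1)) as [d1 [Hd1 L1]].
  destruct (is_Cder_cont _ _ _ (Hd _ D2) 1 Rlt_0_1) as [d2 [Hd2 L2]].
  (* Small enough for both neighbourhoods and for [8 K^4 K2 r < 1]. *)
  set (r := Rmin (Rmin d1 d2) (Rmin 1 (/ (8 * (K * K * K * K) * K2))) / 2).
  assert (HK4 : 1 <= K * K * K * K).
  { assert (1 <= K * K) by nra. assert (1 <= K * K * K) by nra. nra. }
  assert (Hpos : 0 < 8 * (K * K * K * K) * K2) by (apply Rmult_lt_0_compat; lra).
  assert (Hr : 0 < r /\ r < d1 /\ r < d2 /\ r < 1 /\ r < / (8 * (K * K * K * K) * K2)).
  { assert (0 < Rmin (Rmin d1 d2) (Rmin 1 (/ (8 * (K * K * K * K) * K2)))).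
    { repeat apply Rmin_pos; try lra. apply Rinv_0_lt_compat, Hpos. }
    generalize (Rmin_l (Rmin d1 d2) (Rmin 1 (/ (8 * (K * K * K * K) * K2)))) (Rmin_r (Rmin d1 d2) (Rmin 1 (/ (8 * (K * K * K * K) * K2))))
      (Rmin_l d1 d2) (Rmin_r d1 d2) (Rmin_l 1 (/ (8 * (K * K * K * K) * K2))) (Rmin_r 1 (/ (8 * (K * K * K * K) * K2))).
    unfold r. lra. }
  destruct Hr as [Hr0 [Hr1 [Hr2 [Hr3 Hr4]]]].
  assert (Hdist : forall v : R, Cmod (((1 + r)%R, v) - (1%R, v))%C = r).
  { intros v. replace (((1 + r)%R, v) - (1%R, v))%C with (RtoC r).
    - rewrite Cmod_R, Rabs_right; lra.
    - apply injective_projections; simpl; ring. }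
  assert (A1 : Cmod (Zt (1 + r, y)) <= K * r).
  { assert (Q := L1 (1 + r, y)). rewrite Hdist in Q. specialize (Q Hr1). rewrite H0 in Q.
    replace (Zt ((1 + r)%R, y) - 0)%C with (Zt ((1 + r)%R, y)) in Q by ring. exact Q. }
  assert (A2 : Cmod (Zt (1 + r, 2 * y)) <= K2).
  { assert (Q := L2 (1 + r, 2 * y)). rewrite Hdist in Q. specialize (Q Hr2).
    generalize (Cmod_triangle_inv (Zt (1 + r, 2 * y)) (Zt (1, 2 * y))). unfold K2. lra. }
  assert (Hs : forall v, DS (1 + r, v)) by (intros v; unfold DS; simpl; lra).
  assert (Hne : forall v, 0 < v -> (1 + r, v) <> RtoC 1).
  { intros v Hv E. apply (f_equal snd) in E. simpl in E. lra. }
  rewrite Zt_ZD in A1 by (auto). rewrite Zt_ZD in A2 by (try apply Hne; auto; lra).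
  assert (T := trig_positivity 3 4 1 ltac:(lra) ltac:(lra) ltac:(lra)).
  assert (T2 := T ltac:(intros th; rewrite cos_2a_cos; generalize (Rle_0_sqr (cos th + 1)); unfold Rsqr; lra) (1 + r) y ltac:(lra)).
  rewrite Cmod_ZD_real in T2 by lra.
  assert (P1 : 0 < Cmod (ZD (1 + r, y))) by (apply Cmod_gt_0, ZD_neq_0, Hs).
  assert (P2 : 0 < Cmod (ZD (1 + r, 2 * y))) by (apply Cmod_gt_0, ZD_neq_0, Hs).
  assert (B0 : ln (rzeta (1 + r)) <= ln (2 / r)).
  { apply ln_le; [apply rzeta_gt_0; lra|]. eapply Rle_trans; [apply rzeta_le, Hr0|].
    apply Rmult_le_reg_r with r; [exact Hr0|]. unfold Rdiv. rewrite Rmult_plus_distr_r, Rmult_assoc, Rinv_l; lra. }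
  assert (B1 := ln_le _ _ P1 A1). assert (B2 := ln_le _ _ P2 A2).
  assert (F : 0 <= ln ((2 / r) * (2 / r) * (2 / r) * ((K * r) * (K * r) * (K * r) * (K * r)) * K2)).
  { assert (X : 0 < 2 / r) by (apply Rdiv_lt_0_compat; lra). assert (Y : 0 < K * r) by nra.
    rewrite ln_monomial by (assumption || lra). lra. }
  replace ((2 / r) * (2 / r) * (2 / r) * ((K * r) * (K * r) * (K * r) * (K * r)) * K2)
    with (8 * (K * K * K * K) * K2 * r) in F by (field; lra).
  assert (G : 8 * (K * K * K * K) * K2 * r < 1).
  { apply (Rmult_lt_compat_l (8 * (K * K * K * K) * K2)) in Hr4; [|exact Hpos].
    rewrite Rinv_r in Hr4 by lra. exact Hr4. }
  assert (G0 : 0 < 8 * (K * K * K * K) * K2 * r) by (apply Rmult_lt_0_compat; lra).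
  apply ln_increasing in G; [|exact G0]. rewrite ln_1 in G. lra.
Qed.

Definition DR (z : C) : Prop := / 2 < fst z /\ 0 < snd z.

Lemma DR_open : Copen DR.
Proof. intros z [H1 H2]. apply near_and; [apply half_plane_near_fst|apply half_plane_near_snd]; assumption. Qed.

Lemma DR_DZ (z : C) : DR z -> DZ z.
Proof. unfold DR, DZ. lra. Qed.

(** RH covers [Re s < 1], Mertens' argument the line [Re s = 1], and the Dirichlet series the
    rest. *)
Lemma Zt_neq_0 (z : C) : RH -> DR z -> Zt z <> 0%C.
Proof.
  intros Hrh Hz H0. assert (Hz1 : z <> 1%C) by (apply DZ_ne_1, DR_DZ, Hz).
  destruct z as [x y]. destruct Hz as [Hx Hy]; simpl in Hx, Hy.
  destruct (Rtotal_order x 1) as [L|[E|G]].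
  - assert (A : zeta (x, y) = RtoC 0) by (rewrite zeta_Zt; [exact H0|exact Hz1|simpl; lra]).
    assert (B := Hrh (x, y) ltac:(simpl; lra) A). simpl in B. lra.
  - subst x. apply (Zt_line_1 y Hy), H0.
  - apply (ZD_neq_0 (x, y)); [exact G|]. rewrite <- Zt_ZD; [exact H0|exact G|exact Hz1].
Qed.

(** * The logarithmic derivative *)

Definition FZ (z : C) : C := (Dc Zt z / Zt z)%C.

Lemma hol_FZ (m : nat) : RH -> hol m DR FZ.
Proof.
  intros Hrh. assert (H := hol_Zt (S m)). apply (hol_sub _ DZ DR) in H; [|apply DR_DZ].
  unfold FZ. apply hol_div; [apply DR_open|intros z Hz; apply Zt_neq_0; assumption|apply H|apply hol_S, H].
Qed.

(** * A gradient estimate for log |f| in a disc *)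

Lemma is_lap_grad_const_minus (h : C -> R) (k : R) (p : C) (u g : R) : is_lap_grad h p u g ->
  is_lap_grad (fun z => k - h z) p (- u) g.
Proof.
  intros [a [b [a' [b' [H1 [H2 [H3 H4]]]]]]].
  assert (S : forall phi x a b, is_der2 phi x a b -> is_der2 (fun r => k - phi r) x (- a) (- b)).
  { intros phi x c d [f' [F1 [F2 F3]]]. exists (fun r => - f' r). split; [|split].
    - generalize F1. apply filter_imp. intros r A.
      replace (- f' r) with (0 - f' r) by ring.
      apply (is_derive_minus (fun _ => k) phi); [apply @is_derive_const|exact A].
    - rewrite F2; reflexivity.
    - apply (is_derive_opp f'), F3. }
  exists (- a), (- b), (- a'), (- b'). split; [apply S, H1|split; [apply S, H2|]].
  split; [rewrite H3|rewrite H4]; ring.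
Qed.

Definition disc_defect (r : R) (c z : C) : R :=
  r * r - ((fst z - fst c) * (fst z - fst c) + (snd z - snd c) * (snd z - snd c)).

Lemma is_der2_sq (k a x : R) : is_der2 (fun r => k - (r - a) * (r - a)) x (- 2 * (x - a)) (- 2).
Proof.
  exists (fun r => - 2 * (r - a)). split; [|split; [reflexivity|]].
  - apply filter_forall. intros r. auto_derive; [exact I|ring].
  - auto_derive; [exact I|ring].
Qed.

Lemma is_lap_grad_disc (r : R) (c p : C) :
  is_lap_grad (disc_defect r c) p (- 4)
    (4 * ((fst p - fst c) * (fst p - fst c) + (snd p - snd c) * (snd p - snd c))).
Proof.
  exists (- 2 * (fst p - fst c)), (- 2), (- 2 * (snd p - snd c)), (- 2). split; [|split; [|split; ring]].
  - eapply is_der2_ext; [|apply (is_der2_sq (r * r - (snd p - snd c) * (snd p - snd c)))].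
    apply filter_forall. intros t. unfold disc_defect; simpl. ring.
  - eapply is_der2_ext; [|apply (is_der2_sq (r * r - (fst p - fst c) * (fst p - fst c)))].
    apply filter_forall. intros t. unfold disc_defect; simpl. ring.
Qed.

Lemma Rcont_disc (r : R) (c z : C) : Rcont (disc_defect r c) z.
Proof.
  assert (H : forall k f, Rcont f z -> Rcont (fun w => f w - k) z).
  { intros k f Hf. apply (Rcont_plus f (fun _ => - k)); [exact Hf|apply Rcont_const]. }
  apply (Rcont_ext_near (fun w => r * r + (-1) * ((fst w - fst c) * (fst w - fst c) + (snd w - snd c) * (snd w - snd c)))).
  - apply near_true. intros w. unfold disc_defect. ring.
  - apply Rcont_plus; [apply Rcont_const|]. apply Rcont_scal. apply Rcont_plus; apply Rcont_mult; apply H;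
    first [apply Rcont_fst|apply Rcont_snd].
Qed.

Lemma Rcont_ln_Cmod (f : C -> C) (z : C) : Ccont f z -> f z <> 0%C -> Rcont (fun w => ln (Cmod (f w))) z.
Proof.
  intros Hf H0. apply (Rcont_comp ln (fun w => Cmod (f w))); [apply Rcont_Cmod, Hf|].
  apply Cmod_gt_0 in H0. auto_derive. exact H0.
Qed.

Lemma sq_lt_between (a r : R) : 0 < r -> a * a < r * r -> - r < a < r.
Proof. intros Hr H. split; apply Rnot_le_lt; intros K; nra. Qed.

(** Gradient estimate for the positive harmonic function [M - log|f|] in a disc. At a maximum of
    [|f'/f| d / (M - log|f|)], [d] the defect function of the disc, the Laplacian of its logarithm
    is nonpositive, which bounds the value there (this is Ahlfors' proof of the Schwarz lemma). *)
Lemma gradient_estimate (D : C -> Prop) (f : C -> C) (c : C) (r M : R) :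
  Copen D -> 0 < r -> (forall z, square c r z -> D z) -> hol 3 D f -> (forall z, D z -> f z <> 0%C) ->
  (forall z, square c r z -> ln (Cmod (f z)) < M) ->
  forall z, square c r z -> Cmod (Dc f z / f z)%C * disc_defect r c z <= 2 * r * (M - ln (Cmod (f z))).
Proof.
  intros HD Hr Hsq Hf Hne HM z Hz.
  set (F := fun w => (Dc f w / f w)%C). set (v := fun w => M - ln (Cmod (f w))).
  assert (HF : hol 2 D F) by (apply hol_div; [exact HD|exact Hne|apply Hf|apply hol_S, Hf]).
  assert (Hv : forall w, square c r w -> 0 < v w) by (intros w Hw; unfold v; specialize (HM w Hw); lra).
  assert (Cv : forall w, square c r w -> Rcont v w).
  { intros w Hw. unfold v. apply (Rcont_ext_near (fun w => M + (-1) * ln (Cmod (f w)))); [apply near_true; intros; ring|].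
    apply Rcont_plus; [apply Rcont_const|]. apply Rcont_scal, Rcont_ln_Cmod; [|apply Hne, Hsq, Hw].
    apply (hol_cont 2 D); [exact Hf|apply Hsq, Hw]. }
  set (W := fun w => Cmod (F w) * (/ v w * disc_defect r c w)).
  assert (Cw : forall w, square c r w -> Rcont W w).
  { intros w Hw. apply Rcont_mult; [apply Rcont_Cmod, (hol_cont 1 D F w HF (Hsq w Hw))|].
    apply Rcont_mult; [|apply Rcont_disc]. apply (Rcont_comp (fun t => / t) v); [apply Cv, Hw|].
    specialize (Hv w Hw). auto_derive. lra. }
  destruct (rect_max W (fst c - r) (fst c + r) (snd c - r) (snd c + r)) as [p [Hp Hmax]]; [lra|lra|exact Cw|].
  assert (Hle : W p <= 2 * r).
  { apply Rnot_lt_le. intros Hlt.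
    assert (Hvp := Hv p Hp). assert (Ivp : 0 < / v p) by (apply Rinv_0_lt_compat, Hvp).
    assert (HFp := Cmod_ge_0 (F p)).
    assert (Hdp : 0 < disc_defect r c p).
    { apply Rnot_le_lt. intros K. assert (W p <= 0); [|lra]. unfold W.
      assert (K2 : / v p * disc_defect r c p <= 0) by nra. clear Hlt Hmax. nra. }
    assert (HFp0 : F p <> 0%C).
    { intros K. unfold W in Hlt. rewrite K, Cmod_0 in Hlt. lra. }
    assert (Hpi : rint (fst c - r) (fst c + r) (snd c - r) (snd c + r) p).
    { unfold disc_defect in Hdp. 
      assert (Q1 := sq_lt_between (fst p - fst c) r Hr ltac:(generalize (Rle_0_sqr (snd p - snd c)); unfold Rsqr; lra)).
      assert (Q2 := sq_lt_between (snd p - snd c) r Hr ltac:(generalize (Rle_0_sqr (fst p - fst c)); unfold Rsqr; lra)).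
      unfold rint. lra. }
    assert (Hfp0 := Hne p (Hsq p Hp)).
    assert (G1 := is_lap_grad_lap _ _ _ _ (is_lap_ln_Cmod D F p HD (Hsq p Hp) HF HFp0)).
    assert (G2 := is_lap_opp _ _ _ (is_lap_ln v p _ _ (is_lap_grad_const_minus _ M _ _ _ (is_lap_ln_Cmod D f p HD (Hsq p Hp) (hol_S _ _ _ Hf) Hfp0)) Hvp)).
    assert (G3 := is_lap_ln _ p _ _ (is_lap_grad_disc r c p) Hdp).
    assert (G := is_lap_plus _ _ _ _ _ (is_lap_plus _ _ _ _ _ G1 G2) G3).
    apply is_lap_max in G.
    - fold (F p) in G.
      set (q := (fst p - fst c) * (fst p - fst c) + (snd p - snd c) * (snd p - snd c)) in *.
      set (d := disc_defect r c p) in *. assert (Ed : d = r * r - q) by reflexivity.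
      set (A := Cmod (F p)) in *.
      (* [G] reads [A^2/v^2 <= 4/d + 4 q/d^2], with [q] the squared distance to the centre. Since
         [d + q = r^2], the right side is [4 r^2/d^2], and this contradicts [W p > 2 r]. *)
      assert (K : A * A / (v p * v p) <= 4 * (r * r) / (d * d)).
      { replace (4 * (r * r) / (d * d)) with (4 / d + 4 * q / (d * d)).
        - replace (0 + - (- 0 / v p - A * A / (v p * v p)) + (-4 / d - 4 * q / (d * d)))
            with (A * A / (v p * v p) - (4 / d + 4 * q / (d * d))) in G by (field; split; lra).
          lra.
        - replace (4 / d + 4 * q / (d * d)) with (4 * (d + q) / (d * d)) by (field; lra).
          rewrite Ed at 1. f_equal. ring. }
      unfold W in Hlt. fold A d in Hlt.
      assert (B : 2 * r * v p < A * d).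
      { apply (Rmult_lt_compat_r (v p)) in Hlt; [|exact Hvp].
        replace (A * (/ v p * d) * v p) with (A * d) in Hlt by (field; lra). exact Hlt. }
      assert (B2 : A * A * (d * d) <= 4 * (r * r) * (v p * v p)).
      { assert (0 < v p * v p) by nra. assert (0 < d * d) by nra.
        apply (Rmult_le_compat_r ((v p * v p) * (d * d))) in K; [|nra].
        replace (A * A / (v p * v p) * ((v p * v p) * (d * d))) with (A * A * (d * d)) in K by (field; lra).
        replace (4 * (r * r) / (d * d) * ((v p * v p) * (d * d))) with (4 * (r * r) * (v p * v p)) in K by (field; lra).
        exact K. }
      assert (0 < 2 * r * v p) by (apply Rmult_lt_0_compat; lra).
      assert ((2 * r * v p) * (2 * r * v p) < (A * d) * (A * d)) by (apply Rmult_le_0_lt_compat; lra).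
      nra.
    - assert (N1 := near_neq_0 F p (hol_cont 1 D F p HF (Hsq p Hp)) HFp0).
      assert (N2 : near p (fun w => 0 < disc_defect r c w)).
      { generalize (Rcont_disc r c p _ Hdp). apply near_imp. intros w Hw. apply Rabs_def2 in Hw. lra. }
      assert (HL : forall w, square c r w -> F w <> 0%C -> 0 < disc_defect r c w ->
        ln (Cmod (F w)) + - ln (v w) + ln (disc_defect r c w) = ln (W w)).
      { intros w Hw A B. apply Cmod_gt_0 in A. specialize (Hv w Hw).
        assert (0 < / v w) by (apply Rinv_0_lt_compat, Hv).
        unfold W. rewrite ln_mult, ln_mult, ln_Rinv; try assumption; [ring|].
        apply Rmult_lt_0_compat; assumption. }
      generalize (near_and _ _ _ (rint_near _ _ _ _ _ Hpi) (near_and _ _ _ N1 N2)).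
      apply near_imp. intros w [Hw [A B]].
      assert (Hws : square c r w) by (destruct Hw; split; lra).
      fold (F w). fold (F p). fold (v w). fold (v p). rewrite (HL w), (HL p) by assumption. apply ln_le.
      + unfold W. apply Cmod_gt_0 in A. specialize (Hv w Hws).
        assert (0 < / v w) by (apply Rinv_0_lt_compat, Hv). repeat apply Rmult_lt_0_compat; assumption.
      + apply Hmax, Hws. }
  specialize (Hmax z Hz). specialize (Hv z Hz).
  assert (HW : W z <= 2 * r) by lra. unfold W in HW.
  apply (Rmult_le_compat_r (v z)) in HW; [|lra].
  replace (Cmod (F z) * (/ v z * disc_defect r c z) * v z) with (Cmod (F z) * disc_defect r c z) in HW by (field; lra).
  exact HW.
Qed.

(** * Harnack bounds up to the critical line *)

Section Harnack.
Variables (y0 M : R).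
Hypothesis (Hrh : RH) (Hy0 : 2 <= y0).
Hypothesis HM : forall z, DR z -> fst z <= 3 -> Rabs (snd z - y0) <= 1 -> ln (Cmod (Zt z)) < M.

(** [gradient_estimate] on the disc about [3/2 + i y0] of radius [1 - e]: radius 1 would touch the
    critical line, so [e] tends to 0 afterwards. At [1/2 + x] the defect function tends to
    [2 x - x^2]. *)
Lemma harnack_gradient (x : R) : 0 < x <= 1 ->
  Cmod (FZ (/ 2 + x, y0)) * (2 * x - x * x) <= 2 * (M - ln (Cmod (Zt (/ 2 + x, y0)))).
Proof.
  intros Hx. set (z := (/ 2 + x, y0)).
  set (g := fun e => 2 * (1 - e) * (M - ln (Cmod (Zt z))) - Cmod (FZ z) * ((1 - e) * (1 - e) - (1 - x) * (1 - x))).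
  assert (Hg : 0 <= g 0).
  { apply (limit_ge g 0 (x / 2)); [unfold g; auto_derive; exact I|lra|].
    intros e He.
    assert (Hin : forall w, square (3 / 2, y0) (1 - e) w -> DR w /\ fst w <= 3 /\ Rabs (snd w - y0) <= 1).
    { intros w [W1 W2]. simpl in W1, W2. unfold DR. repeat split; try lra. apply Rabs_le. lra. }
    assert (G := gradient_estimate DR Zt (3 / 2, y0) (1 - e) M DR_open ltac:(lra)
      (fun w Hw => proj1 (Hin w Hw)) (hol_sub _ _ _ _ DR_DZ (hol_Zt 3)) (fun w Hw => Zt_neq_0 w Hrh Hw)).
    specialize (G ltac:(intros w Hw; destruct (Hin w Hw) as [A [B E]]; apply HM; assumption) z).
    specialize (G ltac:(unfold z, square, rect; simpl; lra)).
    unfold disc_defect in G. fold (FZ z) in G. unfold z in G at 2 3 4 5. cbn [fst snd] in G.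
    unfold g. replace (/ 2 + x - 3 / 2) with (- (1 - x)) in G by field.
    replace (y0 - y0) with 0 in G by ring. nra. }
  unfold g in Hg. nra.
Qed.

(** With [v = M - ln |zeta|], the gradient bound says that [v x * (x / (2 - x))] is nondecreasing,
    and at [x = 1], in the region of absolute convergence, [v] is at most [M + ln 3]. This is
    Harnack's inequality along a radius. *)
Lemma harnack_value (x : R) : 0 < x <= 1 ->
  M - ln (Cmod (Zt (/ 2 + x, y0))) <= (M + 2) * (2 - x) / x.
Proof.
  intros Hx.
  set (v := fun x => M - ln (Cmod (Zt (/ 2 + x, y0)))).
  assert (A : - (v 1 * (1 / (2 - 1))) <= - (v x * (x / (2 - x)))).
  { apply (antitone_of_derive (fun x => - (v x * (x / (2 - x))))
      (fun x => - (- fst (FZ (/ 2 + x, y0)) * (x / (2 - x)) + v x * (2 / ((2 - x) * (2 - x)))))); [lra| |].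
    - intros t Ht. apply (is_derive_opp (fun x => v x * (x / (2 - x)))).
      assert (HD : DR (/ 2 + t, y0)) by (unfold DR; simpl; lra).
      apply (is_derive_mult v (fun x => x / (2 - x))); [| |intros; apply Rmult_comm].
      + replace (- fst (FZ (/ 2 + t, y0))) with (0 - fst (FZ (/ 2 + t, y0))) by ring.
        apply (is_derive_minus (fun _ => M) (fun x => ln (Cmod (Zt (/ 2 + x, y0))))); [apply @is_derive_const|].
        apply (is_derive_ln_Cmod (fun x => Zt (/ 2 + x, y0))); [|apply Zt_neq_0; assumption].
        destruct (hol_Zt 1) as [Hd _]. specialize (Hd _ (DR_DZ _ HD)).
        apply is_Cder_x in Hd. destruct Hd as [D1 D2]. split.
        * replace (fst (Dc Zt (/ 2 + t, y0))) with (1 * fst (Dc Zt (/ 2 + t, y0))) by ring.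
          apply (is_derive_comp (fun r => fst (Zt (r, y0))) (fun x => / 2 + x)); [exact D1|auto_derive; [exact I|ring]].
        * replace (snd (Dc Zt (/ 2 + t, y0))) with (1 * snd (Dc Zt (/ 2 + t, y0))) by ring.
          apply (is_derive_comp (fun r => snd (Zt (r, y0))) (fun x => / 2 + x)); [exact D2|auto_derive; [exact I|ring]].
      + auto_derive; [lra|field; lra].
    - intros t Ht. assert (G := harnack_gradient t ltac:(lra)).
      assert (B := fst_le_Cmod (FZ (/ 2 + t, y0))). assert (B2 := Rle_abs (fst (FZ (/ 2 + t, y0)))).
      fold (v t) in G. set (f := fst (FZ (/ 2 + t, y0))) in *.
      assert (K : f * (2 * t - t * t) <= 2 * v t).
      { eapply Rle_trans; [|exact G]. apply Rmult_le_compat_r; [nra|lra]. }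
      replace (- (- f * (t / (2 - t)) + v t * (2 / ((2 - t) * (2 - t)))))
        with ((f * (2 * t - t * t) - 2 * v t) * / ((2 - t) * (2 - t))) by (field; lra).
      assert (0 < / ((2 - t) * (2 - t))) by (apply Rinv_0_lt_compat; nra). nra. }
  assert (V1 : v 1 <= M + 2).
  { unfold v. assert (HD : DS (/ 2 + 1, y0)) by (unfold DS; simpl; lra).
    rewrite Zt_ZD; [|exact HD|intro E; apply (f_equal snd) in E; simpl in E; lra].
    assert (L := ln_ZD_ge _ HD). cbn [fst] in L.
    assert (B : rzeta (/ 2 + 1) <= 3).
    { rewrite Rplus_comm. eapply Rle_trans; [apply rzeta_le; lra|]. lra. }
    assert (L2 := ln_le _ _ (rzeta_gt_0 (/ 2 + 1) ltac:(lra)) B).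
    generalize ln_3_le. lra. }
  fold (v x). apply Rmult_le_reg_r with (x / (2 - x)); [apply Rdiv_lt_0_compat; lra|].
  replace ((M + 2) * (2 - x) / x * (x / (2 - x))) with (M + 2) by (field; lra). lra.
Qed.

(** The value and gradient bounds combine to the order [1/x^2], which is just what the double zeros
    of [strip_mult] can absorb. *)
Lemma log_deriv_crude (x : R) : 0 < x <= 1 -> Cmod (FZ (/ 2 + x, y0)) <= 2 * (M + 2) / (x * x).
Proof.
  intros Hx. assert (G := harnack_gradient x Hx). assert (V := harnack_value x Hx).
  apply Rmult_le_reg_r with (2 * x - x * x); [nra|].
  eapply Rle_trans; [exact G|]. replace (2 * (M + 2) / (x * x) * (2 * x - x * x)) with (2 * ((M + 2) * (2 - x) / x)) by (field; lra).
  lra.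
Qed.

End Harnack.

(** * Reflection in a vertical line and the one-sided bound for zeta'/zeta *)

Lemma derive_nonpos_right (f : R -> R) (l d : R) : is_derive f 0 l -> 0 < d ->
  (forall x, 0 < x < d -> f x <= f 0) -> l <= 0.
Proof.
  intros Hf Hd H. apply Rnot_lt_le. intros Hl. apply is_derive_Reals in Hf.
  destruct (Hf (l / 2)) as [e He]; [lra|]. assert (He0 := cond_pos e).
  set (h := Rmin d e / 2). assert (0 < Rmin d e) by (apply Rmin_pos; assumption).
  generalize (Rmin_l d e) (Rmin_r d e). intros.
  assert (Hh : 0 < h < d /\ h < e) by (unfold h; lra).
  specialize (He h ltac:(lra) ltac:(rewrite Rabs_right; lra)).
  rewrite Rplus_0_l in He. specialize (H h ltac:(lra)). apply Rabs_def2 in He.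
  assert ((f h - f 0) / h <= 0).
  { unfold Rdiv. assert (0 < / h) by (apply Rinv_0_lt_compat; lra). nra. }
  lra.
Qed.

(** Two Poisson kernels with poles at corners of a rectangle: they absorb bounds of order [1/x] on its horizontal
    sides at a cost [O(x/H^2)] in the centre. *)
Definition barrier (e y1 H : R) (z : C) : R :=
  fst (/ (z - (- e, y1 + H)%R))%C + fst (/ (z - (- e, y1 - H)%R))%C.

Lemma fst_Cinv (z : C) : fst (/ z)%C = fst z / (fst z * fst z + snd z * snd z).
Proof. unfold Cinv. simpl. f_equal. ring. Qed.

Lemma pole_nonneg (z w : C) : fst w < fst z -> 0 <= fst (/ (z - w))%C.
Proof.
  intros H. rewrite fst_Cinv. simpl. apply Rmult_le_pos; [lra|].
  left. apply Rinv_0_lt_compat. apply Rplus_lt_le_0_compat; [apply Rmult_lt_0_compat; lra|].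
  apply (Rle_0_sqr (snd z + - snd w)).
Qed.

Lemma barrier_nonneg (e y1 H : R) (z : C) : - e < fst z -> 0 <= barrier e y1 H z.
Proof.
  intros Hz. apply Rplus_le_le_0_compat; apply pole_nonneg; simpl; lra.
Qed.

(** The pole at the height of the side contributes exactly [1/(x + e)], and the other one is
    nonnegative. *)
Lemma barrier_side (e y1 H : R) (z : C) : - e < fst z -> snd z = y1 - H \/ snd z = y1 + H ->
  / (fst z + e) <= barrier e y1 H z.
Proof.
  intros Hz Hs. unfold barrier.
  assert (P1 := pole_nonneg z (- e, y1 + H) Hz). assert (P2 := pole_nonneg z (- e, y1 - H) Hz).
  destruct Hs as [E|E].
  - assert (K : fst (/ (z - (- e, y1 - H)%R))%C = / (fst z + e)).
    { rewrite fst_Cinv. simpl. rewrite E, Rplus_opp_r, Rmult_0_l, Rplus_0_r, Ropp_involutive. field. lra. }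
    lra.
  - assert (K : fst (/ (z - (- e, y1 + H)%R))%C = / (fst z + e)).
    { rewrite fst_Cinv. simpl. rewrite E, Rplus_opp_r, Rmult_0_l, Rplus_0_r, Ropp_involutive. field. lra. }
    lra.
Qed.

Lemma barrier_center (e y1 H x : R) : 0 < H -> 0 <= x + e ->
  barrier e y1 H (x, y1) <= 2 * (x + e) / (H * H).
Proof.
  intros HH Hx. unfold barrier. rewrite !fst_Cinv. simpl.
  assert (Q : forall k, k * k = H * H -> (x + - - e) / ((x + - - e) * (x + - - e) + k * k) <= (x + e) / (H * H)).
  { intros k Hk. rewrite Hk. replace (x + - - e) with (x + e) by ring.
    apply Rmult_le_compat_l; [exact Hx|]. apply Rinv_le_contravar; nra. }
  assert (A := Q (y1 + - (y1 + H)) ltac:(ring)). assert (B := Q (y1 + - (y1 - H)) ltac:(ring)).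
  replace (2 * (x + e) / (H * H)) with ((x + e) / (H * H) + (x + e) / (H * H)) by (field; lra). lra.
Qed.

Lemma Dpole_open (e : R) : Copen (fun z => - e < fst z).
Proof. intros z Hz. apply half_plane_near_fst, Hz. Qed.

Lemma pole_ne (e v : R) (z : C) : - e < fst z -> (z - (- e, v)%R)%C <> 0%C.
Proof. intros H E. apply (f_equal fst) in E. simpl in E. lra. Qed.

Lemma hol_pole (m : nat) (e v : R) : hol m (fun z => - e < fst z) (fun z => / (z - (- e, v)%R))%C.
Proof.
  assert (HD := Dpole_open e). apply hol_inv; [exact HD|intros z Hz; apply pole_ne, Hz|].
  apply hol_minus; [exact HD|apply hol_id, HD|apply hol_const, HD].
Qed.

Lemma is_lap_barrier (e y1 H : R) (p : C) : - e < fst p -> is_lap (barrier e y1 H) p 0.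
Proof.
  intros Hp. replace 0 with (0 + 0) by ring.
  apply (is_lap_plus (fun z => fst (/ (z - ((- e)%R, (y1 + H)%R)))%C) (fun z => fst (/ (z - ((- e)%R, (y1 - H)%R)))%C));
    (eapply is_lap_grad_lap, (is_lap_Re (fun z => - e < fst z)); [apply Dpole_open|exact Hp|apply hol_pole]).
Qed.

Lemma Rcont_barrier (e y1 H : R) (p : C) : - e < fst p -> Rcont (barrier e y1 H) p.
Proof.
  intros Hp. apply (Rcont_plus (fun z => fst (/ (z - ((- e)%R, (y1 + H)%R)))%C) (fun z => fst (/ (z - ((- e)%R, (y1 - H)%R)))%C));
    apply Rcont_Re, (hol_cont 0 (fun z => - e < fst z)); [apply hol_pole|exact Hp|apply hol_pole|exact Hp].
Qed.

Lemma Rcont_reflect (f : C -> R) (k : R) (p : C) : Rcont f (k - fst p, snd p) ->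
  Rcont (fun z => f (k - fst z, snd z)) p.
Proof.
  intros Hf e He. destruct (Hf e He) as [d [Hd H]]. exists d. split; [exact Hd|].
  intros w Hw. apply H.
  replace (Cmod ((k - fst w, snd w)%R - (k - fst p, snd p)%R)%C) with (Cmod (w - p)%C); [exact Hw|].
  unfold Cmod. simpl. f_equal. ring.
Qed.

Lemma is_lap_linear (a b : R) (p : C) : is_lap (fun z => a * fst z + b) p 0.
Proof.
  exists a, 0, 0, 0. split; [|split; [|ring]].
  - apply (is_der2_affine a b).
  - apply (is_der2_const (a * fst p + b)).
Qed.

Section Reflection.
Variables (y1 H M : R).
Hypothesis (Hrh : RH) (HH : 0 < H) (Hlow : 10 <= y1 - H - 1) (HM0 : 0 <= M).
Hypothesis HM : forall z, - / 2 <= fst z <= 3 -> Rabs (snd z - y1) <= H + 1 -> Cmod (Zt z) < exp M.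

Lemma ln_Zt_lt (z : C) : DR z -> fst z <= 3 -> Rabs (snd z - y1) <= H + 1 -> ln (Cmod (Zt z)) < M.
Proof.
  intros Hz Hz2 Hy. rewrite <- (ln_exp M). apply ln_increasing.
  - apply Cmod_gt_0, Zt_neq_0; assumption.
  - apply HM; [unfold DR in Hz; lra|exact Hy].
Qed.

(** Harnack's inequality reaches [X = 1]; beyond, [- ln |zeta| <= ln 3] by absolute convergence.
    Both are put into the form [B / X] that [barrier] can absorb on horizontal sides. *)
Lemma ln_Zt_deficit (X y : R) : 0 < X <= 2 -> Rabs (y - y1) <= H ->
  M - ln (Cmod (Zt (/ 2 + X, y))) <= (5 * M + 10) / X.
Proof.
  intros HX Hy. apply Rabs_le_between in Hy.
  destruct (Rle_dec X 1) as [L|L].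
  - assert (A := harnack_value y M Hrh ltac:(lra)).
    assert (B : forall z, DR z -> fst z <= 3 -> Rabs (snd z - y) <= 1 -> ln (Cmod (Zt z)) < M).
    { intros z Hz Hz2 Hz3. apply ln_Zt_lt; [exact Hz|exact Hz2|]. apply Rabs_le_between in Hz3. apply Rabs_le. lra. }
    specialize (A B X ltac:(lra)). eapply Rle_trans; [exact A|].
    apply Rmult_le_compat_r; [left; apply Rinv_0_lt_compat; lra|]. nra.
  - assert (HD : DS (/ 2 + X, y)) by (unfold DS; simpl; lra).
    rewrite Zt_ZD; [|exact HD|intro E; apply (f_equal snd) in E; simpl in E; lra].
    assert (L1 := ln_ZD_ge _ HD). cbn [fst] in L1.
    assert (B : rzeta (/ 2 + X) <= 3).
    { eapply Rle_trans; [apply (rzeta_antitone (1 + / 2)); lra|]. eapply Rle_trans; [apply rzeta_le; lra|]. lra. }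
    assert (L2 := ln_le _ _ (rzeta_gt_0 (/ 2 + X) ltac:(lra)) B).
    assert (L3 := ln_3_le).
    apply Rmult_le_reg_r with X; [lra|]. unfold Rdiv. rewrite Rmult_assoc, Rinv_l by lra. nra.
Qed.

(** Maximum principle for [|zeta(z)| / |zeta(z')|] times [exp (- b)], with [z'] the mirror image of
    [z] in [Re s = c]. On the mirror line the quotient is 1. On [Re s = -1/2] the linear part of [b]
    reaches [M + 2], enough for [|zeta(z)| <= exp M] and [- ln |zeta(z')| <= ln 3]. On the
    horizontal sides the barrier covers [ln_Zt_deficit]. Zeros of the numerator only make the
    function small; by RH the denominator has none. *)
Lemma reflection_ineq (c x e : R) : / 2 < c <= 1 -> 0 <= x <= c + / 2 -> 0 < e <= c - / 2 ->
  Cmod (Zt (c - x, y1)) <=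
  Cmod (Zt (c + x, y1)) * exp ((M + 2) / (c + / 2) * x + (5 * M + 10) * (2 * (x + e) / (H * H))).
Proof.
  intros Hc Hx He. set (B := 5 * M + 10). set (k := (M + 2) / (c + / 2)).
  set (b := fun z : C => k * fst z + 0 + B * barrier e y1 H z).
  set (h := fun z : C => - ln (Cmod (Zt (2 * c - fst z, snd z))) + - b (c - fst z, snd z)).
  assert (HB : 0 <= B) by (unfold B; lra).
  assert (Hk : 0 <= k) by (apply Rmult_le_pos; [lra|left; apply Rinv_0_lt_compat; lra]).
  assert (Hin : forall z, rect (- / 2) c (y1 - H) (y1 + H) z -> DZ z /\ DR (2 * c - fst z, snd z) /\ - e < c - fst z /\ Rabs (snd z - y1) <= H).
  { intros z [Z1 Z2]. unfold DZ, DR. simpl. repeat split; try lra. apply Rabs_le. lra. }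
  assert (Hb0 : forall z, rect (- / 2) c (y1 - H) (y1 + H) z -> 0 <= b (c - fst z, snd z)).
  { intros z Hz. destruct (Hin z Hz) as [_ [_ [A _]]]. destruct Hz as [Z1 Z2].
    assert (P := barrier_nonneg e y1 H (c - fst z, snd z) A). unfold b. cbn [fst snd].
    assert (0 <= k * (c - fst z)) by (apply Rmult_le_pos; lra). nra. }
  assert (HW : forall z, rect (- / 2) c (y1 - H) (y1 + H) z -> Cmod (Zt z) * exp (h z) <= 1).
  { apply max_principle; try lra.
    - intros z Hz. destruct (Hin z Hz) as [A1 [A2 [A3 A4]]].
      apply Rcont_mult.
      + apply Rcont_Cmod, (hol_cont 0 DZ); [apply hol_Zt|exact A1].
      + apply (Rcont_comp exp h); [|auto_derive; exact I].
        unfold h. apply Rcont_plus.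
        * apply (Rcont_ext_near (fun w => (-1) * ln (Cmod (Zt (2 * c - fst w, snd w))))); [apply near_true; intros; ring|].
          apply Rcont_scal. apply (Rcont_reflect (fun w => ln (Cmod (Zt w)))).
          apply Rcont_ln_Cmod; [apply (hol_cont 0 DZ); [apply hol_Zt|apply DR_DZ, A2]|apply Zt_neq_0; assumption].
        * apply (Rcont_ext_near (fun w => (-1) * b (c - fst w, snd w))); [apply near_true; intros; ring|].
          apply Rcont_scal. apply (Rcont_reflect b).
          unfold b. apply Rcont_plus; [apply Rcont_plus; [apply Rcont_scal, Rcont_fst|apply Rcont_const]|].
          apply Rcont_scal, Rcont_barrier. exact A3.
    - intros z Hz Hbd. destruct (Hin z Hz) as [A1 [A2 [A3 A4]]]. assert (Hbz := Hb0 z Hz).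
      assert (HZ : Cmod (Zt z) <= exp M).
      { left. apply HM; [destruct Hz; lra|lra]. }
      assert (Gen : M - ln (Cmod (Zt (2 * c - fst z, snd z))) <= b (c - fst z, snd z) -> Cmod (Zt z) * exp (h z) <= 1).
      { intros K. apply Rle_trans with (exp M * exp (h z)); [apply Rmult_le_compat_r; [left; apply exp_pos|exact HZ]|].
        rewrite <- exp_plus, <- exp_0. apply exp_le. unfold h. lra. }
      destruct Hz as [Z1 Z2]. set (X := 2 * c - fst z - / 2).
      assert (HX : 0 < X <= 2) by (unfold X; lra).
      assert (EX : (2 * c - fst z, snd z) = (/ 2 + X, snd z)) by (unfold X; f_equal; ring).
      assert (Hside : snd z = y1 - H \/ snd z = y1 + H -> Cmod (Zt z) * exp (h z) <= 1).
      { intros Hs. apply Gen. rewrite EX. eapply Rle_trans; [apply ln_Zt_deficit; [exact HX|exact A4]|].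
        assert (P := barrier_side e y1 H (c - fst z, snd z) A3 Hs). cbn [fst snd] in P.
        unfold b. cbn [fst snd].
        (* This is where [e <= c - 1/2] enters: [X] is [c - Re z + (c - 1/2)]. *)
        assert (I : / X <= / (c - fst z + e)) by (apply Rinv_le_contravar; unfold X; lra).
        assert (0 <= k * (c - fst z)) by (apply Rmult_le_pos; lra).
        fold B. unfold Rdiv. assert (B * / X <= B * barrier e y1 H (c - fst z, snd z)) by (apply Rmult_le_compat_l; lra).
        lra. }
      destruct Hbd as [E|[E|[E|E]]]; [| |apply Hside; left; exact E|apply Hside; right; exact E].
      + apply Gen. assert (HD : DS (2 * c - fst z, snd z)) by (unfold DS; simpl; lra).
        rewrite Zt_ZD; [|exact HD|intro K; apply (f_equal snd) in K; simpl in K; lra].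
        assert (L1 := ln_ZD_ge _ HD). cbn [fst] in L1.
        assert (B3 : rzeta (2 * c - fst z) <= 3).
        { eapply Rle_trans; [apply (rzeta_antitone (1 + / 2)); lra|]. eapply Rle_trans; [apply rzeta_le; lra|]. lra. }
        assert (L2 := ln_le _ _ (rzeta_gt_0 (2 * c - fst z) ltac:(lra)) B3). assert (L3 := ln_3_le).
        assert (P := barrier_nonneg e y1 H (c - fst z, snd z) A3). unfold b. cbn [fst snd].
        assert (Ek : k * (c - fst z) = M + 2) by (rewrite E; unfold k; field; lra).
        assert (0 <= B * barrier e y1 H (c - fst z, snd z)) by (apply Rmult_le_pos; assumption). lra.
      + unfold h. replace (2 * c - fst z, snd z) with z by (destruct z as [zx zy]; simpl in *; subst zx; f_equal; ring).
        rewrite exp_plus, exp_Ropp, exp_ln.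
        * rewrite <- Rmult_assoc, Rinv_r, Rmult_1_l.
          -- rewrite <- exp_0. apply exp_le. lra.
          -- apply Rgt_not_eq, Cmod_gt_0, Zt_neq_0; [exact Hrh|]. unfold DR in *. simpl in *. lra.
        * apply Cmod_gt_0, Zt_neq_0; [exact Hrh|]. unfold DR in *. simpl in *. lra.
    - intros z Hz Hlt. assert (Hzr : rect (- / 2) c (y1 - H) (y1 + H) z) by (destruct Hz; split; lra).
      destruct (Hin z Hzr) as [A1 [A2 [A3 A4]]].
      apply (is_lap_Cmod_exp DZ Zt h z (- 0 + - (0 + B * 0))).
      + apply DZ_open.
      + exact A1.
      + apply hol_Zt.
      + intros K. rewrite K, Cmod_0, Rmult_0_l in Hlt. lra.
      + unfold h. apply is_lap_plus.
        * apply is_lap_opp. apply (is_lap_reflect (fun w => ln (Cmod (Zt w)))).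
          eapply is_lap_grad_lap, (is_lap_ln_Cmod DZ); [apply DZ_open|apply DR_DZ, A2|apply hol_Zt|apply Zt_neq_0; assumption].
        * apply is_lap_opp. apply (is_lap_reflect b). unfold b. apply is_lap_plus; [apply is_lap_linear|].
          destruct (is_lap_ex_grad _ _ _ (is_lap_barrier e y1 H (c - fst z, snd z) A3)) as [g [_ G]].
          eapply is_lap_grad_lap, is_lap_scal, G.
      + lra. }
  assert (Hz : rect (- / 2) c (y1 - H) (y1 + H) (c - x, y1)) by (split; simpl; lra).
  specialize (HW _ Hz). unfold h in HW. cbn [fst snd] in HW.
  replace (2 * c - (c - x)) with (c + x) in HW by ring. replace (c - (c - x)) with x in HW by ring.
  assert (HD : DR (c + x, y1)) by (unfold DR; simpl; lra).
  assert (HZ : 0 < Cmod (Zt (c + x, y1))) by (apply Cmod_gt_0, Zt_neq_0; assumption).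
  rewrite exp_plus, exp_Ropp, exp_ln in HW by exact HZ.
  assert (Bc := barrier_center e y1 H x HH ltac:(lra)).
  assert (Hbx : b (x, y1) <= k * x + B * (2 * (x + e) / (H * H))).
  { unfold b. cbn [fst]. assert (B * barrier e y1 H (x, y1) <= B * (2 * (x + e) / (H * H))) by (apply Rmult_le_compat_l; assumption). lra. }
  apply exp_le in Hbx. rewrite exp_Ropp in HW.
  assert (P := exp_pos (b (x, y1))).
  apply Rle_trans with (Cmod (Zt (c + x, y1)) * exp (b (x, y1))); [|apply Rmult_le_compat_l; lra].
  apply (Rmult_le_compat_r (Cmod (Zt (c + x, y1)) * exp (b (x, y1)))) in HW; [|apply Rmult_le_pos; lra].
  replace (Cmod (Zt (c - x, y1)) * (/ Cmod (Zt (c + x, y1)) * / exp (b (x, y1))) * (Cmod (Zt (c + x, y1)) * exp (b (x, y1))))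
    with (Cmod (Zt (c - x, y1))) in HW by (field; split; lra).
  lra.
Qed.

(** For [e = 0] the reflection inequality is an equality at [x = 0], so it may be differentiated
    there, and the difference of the two logarithms has derivative [- 2 Re F(c)]. [e] must tend to 0
    before [x] does, as the barrier costs a multiple of [x + e]. The slope is at most [M + 2]
    because [c + 1/2 > 1]. *)
Lemma log_deriv_lower (c : R) : / 2 < c <= 1 ->
  - fst (FZ (c, y1)) <= (M + 2) / 2 + (5 * M + 10) / (H * H).
Proof.
  intros Hc. set (kap := (M + 2) / (c + / 2) + (5 * M + 10) * (2 / (H * H))).
  assert (Hx : forall x, 0 <= x < c - / 2 -> ln (Cmod (Zt (c - x, y1))) - ln (Cmod (Zt (c + x, y1))) - kap * x <= 0).
  { intros x Hx.
    assert (HD1 : DR (c - x, y1)) by (unfold DR; simpl; lra).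
    assert (HD2 : DR (c + x, y1)) by (unfold DR; simpl; lra).
    assert (P1 : 0 < Cmod (Zt (c - x, y1))) by (apply Cmod_gt_0, Zt_neq_0; assumption).
    assert (P2 : 0 < Cmod (Zt (c + x, y1))) by (apply Cmod_gt_0, Zt_neq_0; assumption).
    assert (A : ln (Cmod (Zt (c - x, y1))) <= ln (Cmod (Zt (c + x, y1))) + kap * x).
    { set (g := fun e => ln (Cmod (Zt (c + x, y1))) + ((M + 2) / (c + / 2) * x + (5 * M + 10) * (2 * (x + e) * / (H * H)))).
      replace (ln (Cmod (Zt (c + x, y1))) + kap * x) with (g 0) by (unfold g, kap; field; split; lra).
      apply (limit_ge g _ (c - / 2)); [unfold g; auto_derive; exact I|lra|].
      intros e He. assert (R := reflection_ineq c x e Hc ltac:(lra) ltac:(lra)).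
      apply ln_le in R; [|exact P1]. rewrite ln_mult, ln_exp in R; [exact R|exact P2|apply exp_pos]. }
    lra. }
  assert (HD : DR (c, y1)) by (unfold DR; simpl; lra).
  assert (Hd : is_derive (fun x => ln (Cmod (Zt (x, y1)))) c (fst (FZ (c, y1)))).
  { destruct (hol_Zt 1) as [Hz _]. specialize (Hz _ (DR_DZ _ HD)).
    apply (is_derive_ln_Cmod (fun x => Zt (x, y1))); [apply is_Cder_x, Hz|apply Zt_neq_0; assumption]. }
  assert (K : - 2 * fst (FZ (c, y1)) - kap <= 0).
  { apply (derive_nonpos_right (fun x => ln (Cmod (Zt (c - x, y1))) - ln (Cmod (Zt (c + x, y1))) - kap * x) _ (c - / 2)); [|lra|].
    - replace (- 2 * fst (FZ (c, y1)) - kap) with ((-1) * fst (FZ (c, y1)) - 1 * fst (FZ (c, y1)) - kap) by ring.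
      apply (is_derive_minus (fun x => ln (Cmod (Zt (c - x, y1))) - ln (Cmod (Zt (c + x, y1)))) (fun x => kap * x)).
      + apply (is_derive_minus (fun x => ln (Cmod (Zt (c - x, y1)))) (fun x => ln (Cmod (Zt (c + x, y1))))).
        * apply (is_derive_comp (fun x => ln (Cmod (Zt (x, y1)))) (fun x => c - x)).
          -- rewrite Rminus_0_r. exact Hd.
          -- auto_derive; [exact I|ring].
        * apply (is_derive_comp (fun x => ln (Cmod (Zt (x, y1)))) (fun x => c + x)).
          -- rewrite Rplus_0_r. exact Hd.
          -- auto_derive; [exact I|ring].
      + auto_derive; [exact I|ring].
    - intros x Hx0. rewrite Rminus_0_r, Rplus_0_r, Rmult_0_r.
      specialize (Hx x ltac:(lra)). lra. }
  assert (I : (M + 2) / (c + / 2) <= M + 2).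
  { rewrite <- (Rmult_1_r (M + 2)) at 2. apply Rmult_le_compat_l; [lra|]. rewrite <- Rinv_1. apply Rinv_le_contravar; lra. }
  unfold kap in K. replace ((5 * M + 10) * (2 / (H * H))) with (2 * ((5 * M + 10) / (H * H))) in K by (field; lra).
  lra.
Qed.
End Reflection.

(** * The maximum principle in the strip to the right of the critical line *)

Definition Ccosh (z : C) : C := ((Cexp z + Cexp (- z)) * / 2)%C.
Definition ch (w : R) : R := (exp w + exp (- w)) / 2.

Lemma Ccosh_xy (x y : R) : Ccosh (x, y) = (ch x * cos y, (exp x - exp (- x)) / 2 * sin y).
Proof.
  unfold Ccosh, Cexp, ch. simpl. rewrite cos_neg, sin_neg.
  apply injective_projections; simpl; field.
Qed.

(** [ch w - 1] equals [(exp w - 1)^2 exp (- w) / 2], and [exp w - 1 <= w exp w]. *)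
Lemma ch_bound (w : R) : 0 <= w -> 0 <= ch w - 1 <= w * w / 2 * exp w.
Proof.
  intros Hw. assert (P := exp_pos w). assert (Q := exp_pos (- w)).
  assert (E : exp w * exp (- w) = 1) by (rewrite <- exp_plus, Rplus_opp_r; apply exp_0).
  assert (A : ch w - 1 = (exp w - 1) * (exp w - 1) * exp (- w) / 2).
  { unfold ch. replace ((exp w - 1) * (exp w - 1) * exp (- w) / 2) with ((exp w * (exp w * exp (- w)) - 2 * (exp w * exp (- w)) + exp (- w)) / 2) by field.
    rewrite E. field. }
  assert (B1 := exp_ineq1_le w). assert (B2 := exp_ineq1_le (- w)).
  assert (B3 : exp w - 1 <= w * exp w).
  { assert (exp w * (1 + - w) <= 1) by (rewrite <- E; apply Rmult_le_compat_l; lra). lra. }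
  rewrite A. split.
  - apply Rmult_le_pos; [apply Rmult_le_pos; [apply Rmult_le_pos; lra|lra]|lra].
  - assert (C1 : (exp w - 1) * (exp w - 1) <= (w * exp w) * (w * exp w)) by (apply Rmult_le_compat; lra).
    apply Rle_trans with ((w * exp w) * (w * exp w) * exp (- w) / 2).
    + apply Rmult_le_compat_r; [lra|]. apply Rmult_le_compat_r; lra.
    + right. replace (w * exp w * (w * exp w) * exp (- w) / 2) with (w * w / 2 * exp w * (exp w * exp (- w))) by field.
      rewrite E. ring.
Qed.

Lemma hol_Cexp_scaled (m : nat) (D : C -> Prop) (k : R) (s0 : C) : Copen D ->
  hol m D (fun s => Cexp (RtoC k * (s - s0))%C).
Proof.
  intros HD. apply hol_ext with (fun s => Cexp (RtoC k * s + - (RtoC k * s0))%C); [exact HD| |apply hol_Cexp_affine, HD].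
  intros z _. f_equal. ring.
Qed.

Section Strip.
Variables (t H L1 K F1 Dl X sg : R).
Hypothesis (Hrh : RH) (Ht : 0 < t - H) (HH : 0 < H) (HL1 : 0 <= L1) (HK : 0 <= K) (HF1 : 0 <= F1) (HDl : 0 < Dl).
Hypothesis (HX : / 2 < X <= 1).
Hypothesis (Hsg : sg = 1 \/ sg = - 1) (Hcos : cos (Dl * H) = - sg) (Hsin : sin (Dl * H) = 0).
Hypothesis HFlow : forall c y, Rabs (y - t) <= H -> / 2 < c <= 1 -> - fst (FZ (c, y)) <= L1.
Hypothesis HFcrude : forall x y, Rabs (y - t) <= H -> 0 < x <= 1 -> Cmod (FZ (/ 2 + x, y)) <= K / (x * x).
Hypothesis HFright : forall y, Rabs (y - t) <= H -> Cmod (FZ (/ 2 + X, y)) <= F1.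

(** [S] bounds the product of [FZ] and [strip_mult] on the right side [Re s = 1/2 + X]; [S3] is the
    weight with which the barrier covers the horizontal sides. *)
Let S := F1 * (3 / 2 + exp (Dl * X) / 2).
Let S3 := K * (Dl * Dl) * exp (Dl * X).

(** Since [cos (Dl H) = - sg], this vanishes to second order at the corners at heights [t - H] and [t + H], which
    cancels the bound [K / x^2] for [FZ] there. *)
Definition strip_mult (et : R) (s : C) : C := (1 + sg * Ccosh (RtoC Dl * (s - (/ 2 + et, t)%R)))%C.

Lemma strip_mult_hol (et : R) : hol 2 DR (strip_mult et).
Proof.
  assert (HD := DR_open). unfold strip_mult, Ccosh.
  apply hol_plus; [exact HD|apply hol_const, HD|]. apply hol_mult; [exact HD|apply hol_const, HD|].
  apply hol_mult; [exact HD| |apply hol_const, HD].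
  apply hol_plus; [exact HD|apply hol_Cexp_scaled, HD|].
  apply hol_ext with (fun s => Cexp (RtoC (- Dl) * (s - (/ 2 + et, t)%R))%C); [exact HD| |apply hol_Cexp_scaled, HD].
  intros z _. f_equal. rewrite RtoC_opp. ring.
Qed.

Lemma strip_arg (et x y : R) : (RtoC Dl * ((/ 2 + et + x, y)%R - (/ 2 + et, t)%R))%C = (Dl * x, Dl * (y - t)).
Proof. apply injective_projections; simpl; ring. Qed.

Lemma strip_arg_neg (et x y : R) : (RtoC (- Dl) * ((/ 2 + et + x, y)%R - (/ 2 + et, t)%R))%C = (- (Dl * x), - (Dl * (y - t))).
Proof. apply injective_projections; simpl; ring. Qed.

(** Maximum principle for [Re Psi] minus the barrier on a rectangle that stays [et] away from the
    critical line, where [FZ] may have poles. On the left side the multiplier is [1 + sg cos], real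
    and nonnegative, and the term with [L1] has the same factor, so the one-sided bound for [Re F]
    suffices. On the right side the linear term reaches [S]; on the horizontal sides the barrier
    dominates. *)
Lemma strip_ineq (et e x : R) : 0 < et < x -> et <= / 2 -> x <= X -> 0 < e <= 1 ->
  - fst (FZ (/ 2 + x, t)) * (1 + sg * ch (Dl * (x - et))) <=
  L1 * (1 + sg * exp (- (Dl * (x - et)))) + S / (X - et) * (x - et) + S3 * (2 * (x - et + e) / (H * H)).
Proof.
  intros Het Het2 Hx He.
  assert (HS : 0 <= S) by (unfold S; apply Rmult_le_pos; [exact HF1|generalize (exp_pos (Dl * X)); lra]).
  assert (HS3 : 0 <= S3).
  { unfold S3. apply Rmult_le_pos; [apply Rmult_le_pos; [exact HK|nra]|left; apply exp_pos]. }
  set (Psi := fun s : C => (- (FZ s * strip_mult et s) + - (RtoC L1 * (1 + RtoC sg * Cexp (RtoC (- Dl) * (s - (/ 2 + et, t)%R)))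
     + RtoC (S / (X - et)) * (s - (/ 2 + et, t)%R)))%C).
  assert (HPsi : hol 2 DR Psi).
  { assert (HD := DR_open). unfold Psi. apply hol_plus; [exact HD| |].
    - apply hol_opp; [exact HD|]. apply hol_mult; [exact HD|apply hol_FZ, Hrh|apply strip_mult_hol].
    - apply hol_opp; [exact HD|]. apply hol_plus; [exact HD| |].
      + apply hol_mult; [exact HD|apply hol_const, HD|]. apply hol_plus; [exact HD|apply hol_const, HD|].
        apply hol_mult; [exact HD|apply hol_const, HD|apply hol_Cexp_scaled, HD].
      + apply hol_mult; [exact HD|apply hol_const, HD|]. apply hol_minus; [exact HD|apply hol_id, HD|apply hol_const, HD]. }
  (* The poles of the barrier thus lie on [Re s = 1/2 + et - e], at distance [e] to the left of the
     rectangle. *)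
  set (e' := e - (/ 2 + et)).
  set (W := fun s : C => fst (Psi s) + - (S3 * barrier e' t H s)).
  assert (HPsiE : forall x y, fst (Psi (/ 2 + et + x, y)) =
    - fst (FZ (/ 2 + et + x, y)%R * strip_mult et (/ 2 + et + x, y)%R)%C
    - L1 * (1 + sg * (exp (- (Dl * x)) * cos (Dl * (y - t)))) - S / (X - et) * x).
  { intros a y. unfold Psi. rewrite strip_arg_neg. unfold Cexp. cbn [fst snd]. rewrite cos_neg.
    set (P := (FZ (/ 2 + et + a, y)%R * strip_mult et (/ 2 + et + a, y)%R)%C). simpl. ring. }
  assert (HSME : forall x y, strip_mult et (/ 2 + et + x, y) =
     (1 + sg * (ch (Dl * x) * cos (Dl * (y - t))), sg * ((exp (Dl * x) - exp (- (Dl * x))) / 2 * sin (Dl * (y - t))))).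
  { intros a y. unfold strip_mult. rewrite strip_arg, Ccosh_xy. apply injective_projections; simpl; ring. }
  assert (Hsgb : forall a b, 0 <= a -> - 1 <= b <= 1 -> 0 <= 1 + sg * (exp (- (Dl * a)) * b)).
  { intros a b Ha Hb. assert (E1 : 0 < exp (- (Dl * a)) <= 1).
    { split; [apply exp_pos|]. rewrite <- exp_0. apply exp_le. nra. }
    destruct Hsg as [G|G]; rewrite G; nra. }
  assert (HW : forall s, rect (/ 2 + et) (/ 2 + X) (t - H) (t + H) s -> W s <= 0).
  { assert (Hin : forall s, rect (/ 2 + et) (/ 2 + X) (t - H) (t + H) s -> DR s /\ - e' < fst s).
    { intros s [S1 S2]. unfold DR, e'. lra. }
    apply max_principle; [lra|lra| | |].
    - intros s Hs. destruct (Hin s Hs) as [A1 A2]. apply Rcont_plus.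
      + apply Rcont_Re, (hol_cont 1 DR); [exact HPsi|exact A1].
      + apply (Rcont_ext_near (fun w => (- S3) * barrier e' t H w)); [apply near_true; intros; ring|].
        apply Rcont_scal, Rcont_barrier, A2.
    - intros s Hs Hbd. destruct (Hin s Hs) as [A1 A2].
      destruct s as [a0 y]. destruct Hs as [S1 S2]. cbn [fst snd] in *.
      set (a := a0 - (/ 2 + et)). assert (Ea : a0 = / 2 + et + a) by (unfold a; ring).
      assert (Ha : 0 <= a <= X - et) by (unfold a; lra).
      assert (Hy : Rabs (y - t) <= H) by (apply Rabs_le; lra).
      assert (Hb0 := barrier_nonneg e' t H (a0, y) A2).
      assert (Hlin : 0 <= S / (X - et) * a).
      { apply Rmult_le_pos; [|lra]. apply Rmult_le_pos; [exact HS|left; apply Rinv_0_lt_compat; lra]. }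
      assert (Hb1 : 0 <= S3 * barrier e' t H (a0, y)) by (apply Rmult_le_pos; assumption).
      assert (HL := Hsgb a (cos (Dl * (y - t))) ltac:(lra) (COS_bound _)).
      assert (HL2 : 0 <= L1 * (1 + sg * (exp (- (Dl * a)) * cos (Dl * (y - t))))) by (apply Rmult_le_pos; assumption).
      unfold W. rewrite Ea at 1. rewrite HPsiE.
      assert (Hside : snd (a0, y) = t - H \/ snd (a0, y) = t + H ->
        - fst (FZ (/ 2 + et + a, y)%R * strip_mult et (/ 2 + et + a, y)%R)%C <= S3 * barrier e' t H (a0, y)).
      { intros Hs. assert (Hbs := barrier_side e' t H (a0, y) A2 Hs). cbn [fst snd] in Hbs, Hs.
        assert (Hc : cos (Dl * (y - t)) = - sg /\ sin (Dl * (y - t)) = 0).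
        { destruct Hs as [E|E]; rewrite E.
          - replace (Dl * (t - H - t)) with (- (Dl * H)) by ring. rewrite cos_neg, sin_neg, Hcos, Hsin. split; ring.
          - replace (Dl * (t + H - t)) with (Dl * H) by ring. split; assumption. }
        destruct Hc as [Hc1 Hc2].
        assert (Hch := ch_bound (Dl * a) ltac:(nra)).
        assert (HM : Cmod (strip_mult et (/ 2 + et + a, y)) <= Dl * a * (Dl * a) / 2 * exp (Dl * X)).
        { rewrite HSME, Hc1, Hc2. eapply Rle_trans; [apply Cmod_le_abs|]. cbn [fst snd].
          rewrite !Rmult_0_r, Rabs_R0, Rplus_0_r.
          assert (Hs2 : sg * sg = 1) by (destruct Hsg as [G|G]; rewrite G; ring).
          replace (1 + sg * (ch (Dl * a) * - sg)) with (- (ch (Dl * a) - 1)).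
          2:{ replace (sg * (ch (Dl * a) * - sg)) with (- (ch (Dl * a)) * (sg * sg)) by ring. rewrite Hs2. ring. }
          rewrite Rabs_Ropp, Rabs_right by lra. eapply Rle_trans; [apply Hch|].
          apply Rmult_le_compat_l; [assert (0 <= Dl * a) by nra; nra|]. apply exp_le. apply Rmult_le_compat_l; lra. }
        assert (HFc := HFcrude (et + a) y Hy ltac:(lra)). rewrite <- Rplus_assoc in HFc.
        (* The barrier is at least [1/2] on the whole horizontal side, as [a + e <= 2]. *)
        apply Rle_trans with (S3 * / 2).
        - apply Rle_trans with (Cmod (FZ (/ 2 + et + a, y)%R * strip_mult et (/ 2 + et + a, y)%R)%C).
          { generalize (fst_le_Cmod (FZ (/ 2 + et + a, y)%R * strip_mult et (/ 2 + et + a, y)%R)%C)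
              (Rabs_maj2 (fst (FZ (/ 2 + et + a, y)%R * strip_mult et (/ 2 + et + a, y)%R)%C)). lra. }
          rewrite Cmod_mult.
          apply Rle_trans with (K / ((et + a) * (et + a)) * (Dl * a * (Dl * a) / 2 * exp (Dl * X))).
          + apply Rmult_le_compat; try apply Cmod_ge_0; assumption.
          + unfold S3. assert (Pe := exp_pos (Dl * X)).
            replace (K / ((et + a) * (et + a)) * (Dl * a * (Dl * a) / 2 * exp (Dl * X)))
              with ((K * (Dl * Dl) * exp (Dl * X) * / 2) * (a * a * / ((et + a) * (et + a)))) by (field; lra).
            rewrite <- (Rmult_1_r (K * (Dl * Dl) * exp (Dl * X) * / 2)) at 2.
            apply Rmult_le_compat_l.
            * apply Rmult_le_pos; [|lra]. apply Rmult_le_pos; [apply Rmult_le_pos; nra|lra].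
            * apply Rmult_le_reg_r with ((et + a) * (et + a)); [nra|].
              rewrite Rmult_assoc, Rinv_l by nra. nra.
        - apply Rmult_le_compat_l; [exact HS3|]. eapply Rle_trans; [|exact Hbs].
          apply Rinv_le_contravar; unfold e'; lra. }
      destruct Hbd as [E|[E|[E|E]]]; [| |specialize (Hside (or_introl E)); lra|specialize (Hside (or_intror E)); lra].
      + assert (Ha0 : a = 0) by (unfold a; lra). rewrite Ha0 in *.
        assert (HFl := HFlow a0 y Hy ltac:(lra)). rewrite Ea in HFl.
        rewrite HSME. rewrite Rmult_0_r, Ropp_0, exp_0. unfold ch. rewrite Ropp_0, exp_0.
        set (cc := cos (Dl * (y - t))) in *. unfold Cmult. cbn [fst snd].
        assert (Hcc : 0 <= 1 + sg * cc).
        { destruct (COS_bound (Dl * (y - t))) as [C1 C2]. fold cc in C1, C2. destruct Hsg as [G|G]; rewrite G; lra. }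
        rewrite Rmult_0_r, Ropp_0, exp_0 in *.
        assert (Q := Rmult_le_compat_r _ _ _ Hcc HFl).
        set (f1 := fst (FZ (/ 2 + et + 0, y))) in *. set (f2 := snd (FZ (/ 2 + et + 0, y))) in *. lra.
      + assert (Ha0 : a = X - et) by (unfold a; lra).
        assert (E2 : / 2 + et + a = / 2 + X) by lra.
        assert (Hlin2 : S / (X - et) * a = S) by (rewrite Ha0; field; lra). rewrite Hlin2.
        assert (HM : Cmod (strip_mult et (/ 2 + et + a, y)) <= 3 / 2 + exp (Dl * X) / 2).
        { unfold strip_mult. rewrite strip_arg. eapply Rle_trans; [apply Cmod_triangle|].
          rewrite Cmod_1, Cmod_mult, Cmod_R.
          assert (Rabs sg = 1) by (destruct Hsg as [G|G]; rewrite G; [apply Rabs_R1|rewrite Rabs_left; lra]).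
          unfold Ccosh. rewrite Cmod_mult.
          replace (Cmod (/ 2)%C) with (/ 2) by (rewrite <- RtoC_inv, Cmod_R, Rabs_right by lra; reflexivity).
          assert (T := Cmod_triangle (Cexp (Dl * a, Dl * (y - t))%R) (Cexp (- (Dl * a, Dl * (y - t))%R)%C)).
          rewrite !Cmod_Cexp in T. cbn [fst Copp] in T.
          assert (B1 : exp (Dl * a) <= exp (Dl * X)) by (apply exp_le, Rmult_le_compat_l; lra).
          assert (B2 : exp (- (Dl * a)) <= 1) by (rewrite <- exp_0; apply exp_le; assert (0 <= Dl * a) by (apply Rmult_le_pos; lra); lra).
          assert (B3 := Cmod_ge_0 (Cexp (Dl * a, Dl * (y - t))%R + Cexp (- (Dl * a, Dl * (y - t))%R))%C).
          rewrite H0. simpl in T |- *. lra. }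
        assert (Q : - fst (FZ (/ 2 + et + a, y)%R * strip_mult et (/ 2 + et + a, y)%R)%C <= S).
        { apply Rle_trans with (Cmod (FZ (/ 2 + et + a, y)%R * strip_mult et (/ 2 + et + a, y)%R)%C).
          { generalize (fst_le_Cmod (FZ (/ 2 + et + a, y)%R * strip_mult et (/ 2 + et + a, y)%R)%C)
              (Rabs_maj2 (fst (FZ (/ 2 + et + a, y)%R * strip_mult et (/ 2 + et + a, y)%R)%C)). lra. }
          rewrite Cmod_mult. unfold S. apply Rmult_le_compat; try apply Cmod_ge_0; [|exact HM].
          rewrite E2. apply HFright, Hy. }
        lra.
    - intros s Hs _. assert (Hsr : rect (/ 2 + et) (/ 2 + X) (t - H) (t + H) s) by (destruct Hs; split; lra).
      destruct (Hin s Hsr) as [A1 A2]. exists (0 + - (S3 * 0)). split; [lra|].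
      unfold W. apply is_lap_plus.
      + eapply is_lap_grad_lap, (is_lap_Re DR); [apply DR_open|exact A1|exact HPsi].
      + apply is_lap_opp. destruct (is_lap_ex_grad _ _ _ (is_lap_barrier e' t H s A2)) as [g [_ G]].
        eapply is_lap_grad_lap, is_lap_scal, G. }
  assert (Hz : rect (/ 2 + et) (/ 2 + X) (t - H) (t + H) (/ 2 + x, t)) by (split; simpl; lra).
  specialize (HW _ Hz). unfold W in HW.
  assert (Ex : / 2 + x = / 2 + et + (x - et)) by ring.
  assert (Bc := barrier_center e' t H (/ 2 + x) HH ltac:(unfold e'; lra)).
  rewrite Ex in HW at 1. rewrite HPsiE, HSME in HW. rewrite <- Ex in HW.
  replace (Dl * (t - t)) with 0 in HW by ring. rewrite cos_0, sin_0 in HW. unfold Cmult in HW. cbn [fst snd] in HW.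
  assert (Hb : S3 * barrier e' t H (/ 2 + x, t) <= S3 * (2 * (x - et + e) / (H * H))).
  { apply Rmult_le_compat_l; [exact HS3|]. eapply Rle_trans; [exact Bc|]. right. unfold e'. f_equal. ring. }
  rewrite !Rmult_0_r, !Rmult_1_r in HW. lra.
Qed.

(** [et] and [e] are set equal in [strip_ineq] and tend to 0 together. *)
Lemma strip_bound (x : R) : 0 < x <= X ->
  - fst (FZ (/ 2 + x, t)) * (1 + sg * ch (Dl * x)) <=
  L1 * (1 + sg * exp (- (Dl * x))) + (S / X + 2 * S3 / (H * H)) * x.
Proof.
  intros Hx.
  set (g := fun e => L1 * (1 + sg * exp (- (Dl * (x - e)))) + S / (X - e) * (x - e) + S3 * (2 * (x - e + e) / (H * H))
     - (- fst (FZ (/ 2 + x, t)) * (1 + sg * ((exp (Dl * (x - e)) + exp (- (Dl * (x - e)))) / 2)))).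
  assert (Hg : 0 <= g 0).
  { apply (limit_ge g 0 (Rmin x (/ 2))); [unfold g; auto_derive; lra|apply Rmin_pos; lra|].
    intros e He. assert (M1 := Rmin_l x (/ 2)). assert (M2 := Rmin_r x (/ 2)).
    assert (A := strip_ineq e e x ltac:(lra) ltac:(lra) ltac:(lra) ltac:(lra)). unfold g, ch in *. lra. }
  unfold g in Hg. rewrite !Rminus_0_r, Rplus_0_r in Hg. unfold ch.
  replace ((S / X + 2 * S3 / (H * H)) * x) with (S / X * x + S3 * (2 * x / (H * H))) by (field; lra). lra.
Qed.
End Strip.

(** * Elementary inequalities and numerical values of exp *)

Lemma exp_ge_quadratic (w : R) : 0 <= w -> 1 + w + w * w / 2 <= exp w.
Proof.
  intros Hw.
  assert (A := antitone_of_derive (fun x => 1 + x + x * x / 2 - exp x) (fun x => 1 + x - exp x) 0 w Hw).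
  cbv beta in A. rewrite exp_0 in A.
  assert (1 + w + w * w / 2 - exp w <= 1 + 0 + 0 * 0 / 2 - 1); [|lra]. apply A.
  - intros x _. auto_derive; [exact I|field].
  - intros x _. generalize (exp_ineq1_le x). lra.
Qed.

(** Taylor minorants in turn: [ch >= 1] gives [sinh v >= v], doubling the argument gives
    [ch v - 1 >= v^2/2], and comparison of derivatives gives the cubic term. *)
Lemma sinh_ge (u : R) : 0 <= u -> u + u * u * u / 6 <= (exp u - exp (- u)) / 2.
Proof.
  assert (S1 : forall v, 0 <= v -> v <= (exp v - exp (- v)) / 2).
  { intros v Hv.
    assert (A := antitone_of_derive (fun x => x - (exp x - exp (- x)) / 2) (fun x => 1 - ch x) 0 v Hv).
    cbv beta in A. rewrite Ropp_0, exp_0 in A.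
    assert (v - (exp v - exp (- v)) / 2 <= 0 - (1 - 1) / 2); [|lra]. apply A.
    - intros x _. unfold ch. auto_derive; [exact I|field].
    - intros x Hx. generalize (ch_bound x ltac:(lra)). lra. }
  assert (C1 : forall v, 0 <= v -> v * v / 2 <= ch v - 1).
  { intros v Hv. specialize (S1 (v / 2) ltac:(lra)).
    set (a := exp (v / 2)) in *. set (b := exp (- (v / 2))) in *.
    assert (E1 : exp v = a * a) by (unfold a; rewrite <- exp_plus; f_equal; field).
    assert (E2 : exp (- v) = b * b) by (unfold b; rewrite <- exp_plus; f_equal; field).
    assert (E3 : a * b = 1) by (unfold a, b; rewrite <- exp_plus, Rplus_opp_r; apply exp_0).
    unfold ch. rewrite E1, E2. nra. }
  intros Hu.
  assert (A := antitone_of_derive (fun x => x + x * x * x / 6 - (exp x - exp (- x)) / 2) (fun x => 1 + x * x / 2 - ch x) 0 u Hu).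
  cbv beta in A. rewrite Ropp_0, exp_0 in A.
  assert (u + u * u * u / 6 - (exp u - exp (- u)) / 2 <= 0 + 0 * 0 * 0 / 6 - (1 - 1) / 2); [|lra]. apply A.
  - intros x _. unfold ch. auto_derive; [exact I|field].
  - intros x Hx. generalize (C1 x ltac:(lra)). lra.
Qed.

Lemma ch_ge (w : R) : 0 <= w -> 1 + w * w / 2 + w * w * w * w / 24 <= ch w.
Proof.
  intros Hw. assert (S := sinh_ge (w / 2) ltac:(lra)).
  set (a := exp (w / 2)) in *. set (b := exp (- (w / 2))) in *.
  assert (E1 : exp w = a * a) by (unfold a; rewrite <- exp_plus; f_equal; field).
  assert (E2 : exp (- w) = b * b) by (unfold b; rewrite <- exp_plus; f_equal; field).
  assert (E3 : a * b = 1) by (unfold a, b; rewrite <- exp_plus, Rplus_opp_r; apply exp_0).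
  assert (E : ch w - 1 = 2 * (((a - b) / 2) * ((a - b) / 2))).
  { unfold ch. rewrite E1, E2. replace (2 * ((a - b) / 2 * ((a - b) / 2))) with ((a * a + b * b) / 2 - a * b) by field. rewrite E3. ring. }
  set (m := w / 2 + w / 2 * (w / 2) * (w / 2) / 6) in *.
  assert (Hm : 0 <= m).
  { unfold m. assert (0 <= w / 2 * (w / 2)) by nra. assert (0 <= w / 2 * (w / 2) * (w / 2)) by (apply Rmult_le_pos; lra). lra. }
  assert (Q : m * m <= (a - b) / 2 * ((a - b) / 2)) by (apply Rmult_le_compat; lra).
  assert (Em : m * m = w * w / 4 + w * w * w * w / 48 + (w / 2 * (w / 2) * (w / 2) / 6) * (w / 2 * (w / 2) * (w / 2) / 6)) by (unfold m; field).
  assert (0 <= (w / 2 * (w / 2) * (w / 2) / 6) * (w / 2 * (w / 2) * (w / 2) / 6)) by apply Rle_0_sqr.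
  lra.
Qed.

Lemma exp_double (x : R) : exp (x + x) = exp x * exp x.
Proof. apply exp_plus. Qed.

(** Repeated squaring. It yields [L^(1/3) >= 26] once [log L >= 10]. *)
Lemma exp_10_3_ge : 26 <= exp (10 / 3).
Proof.
  assert (H0 := exp_ge_quadratic (5 / 48) ltac:(lra)).
  assert (H1 : 123 / 100 <= exp (5 / 24)).
  { replace (5 / 24) with (5 / 48 + 5 / 48) by field. rewrite exp_double. nra. }
  assert (H2 : 151 / 100 <= exp (5 / 12)).
  { replace (5 / 12) with (5 / 24 + 5 / 24) by field. rewrite exp_double. nra. }
  assert (H3 : 228 / 100 <= exp (5 / 6)).
  { replace (5 / 6) with (5 / 12 + 5 / 12) by field. rewrite exp_double. nra. }
  assert (H4 : 51984 / 10000 <= exp (5 / 3)).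
  { replace (5 / 3) with (5 / 6 + 5 / 6) by field. rewrite exp_double. nra. }
  replace (10 / 3) with (5 / 3 + 5 / 3) by field. rewrite exp_double. nra.
Qed.

(** Repeated squaring of [exp (-1/32) >= 31/32]. In the error estimate of the strip the bound 3
    would overshoot the constant [1756/1000]. *)
Lemma exp_1_le : exp 1 <= 279 / 100.
Proof.
  assert (H0 := exp_ineq1_le (- (1 / 32))).
  assert (H1 : 938 / 1000 <= exp (- (1 / 16))).
  { replace (- (1 / 16)) with (- (1 / 32) + - (1 / 32)) by field. rewrite exp_double. nra. }
  assert (H2 : 8798 / 10000 <= exp (- (1 / 8))).
  { replace (- (1 / 8)) with (- (1 / 16) + - (1 / 16)) by field. rewrite exp_double. nra. }
  assert (H3 : 774 / 1000 <= exp (- (1 / 4))).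
  { replace (- (1 / 4)) with (- (1 / 8) + - (1 / 8)) by field. rewrite exp_double. nra. }
  assert (H4 : 599 / 1000 <= exp (- (1 / 2))).
  { replace (- (1 / 2)) with (- (1 / 4) + - (1 / 4)) by field. rewrite exp_double. nra. }
  assert (H5 : 3588 / 10000 <= exp (- 1)).
  { replace (- 1) with (- (1 / 2) + - (1 / 2)) by field. rewrite exp_double. nra. }
  assert (E : exp 1 * exp (- 1) = 1) by (rewrite <- exp_plus; replace (1 + - 1) with 0 by ring; apply exp_0).
  assert (P := exp_pos 1). nra.
Qed.

Lemma exp_2_ge : 72 / 10 <= exp 2.
Proof.
  assert (H0 := exp_ge_quadratic (1 / 4) ltac:(lra)).
  assert (H1 : 164 / 100 <= exp (1 / 2)).
  { replace (1 / 2) with (1 / 4 + 1 / 4) by field. rewrite exp_double. nra. }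
  assert (H2 : 2689 / 1000 <= exp 1).
  { replace 1 with (1 / 2 + 1 / 2) by field. rewrite exp_double. nra. }
  replace 2 with (1 + 1) by ring. rewrite exp_double. nra.
Qed.

Lemma exp_7_ge : 1000 <= exp 7.
Proof.
  assert (H2 := exp_2_ge).
  assert (H1 : 2683 / 1000 <= exp 1).
  { assert (P := exp_pos 1). assert (E : exp 1 * exp 1 = exp 2) by (rewrite <- exp_double; f_equal; ring).
    apply Rnot_lt_le. intros K. nra. }
  assert (H4 : 5184 / 100 <= exp 4) by (replace 4 with (2 + 2) by ring; rewrite exp_double; nra).
  assert (H6 : 373248 / 1000 <= exp 6) by (replace 6 with (4 + 2) by ring; rewrite exp_plus; nra).
  replace 7 with (6 + 1) by ring. rewrite exp_plus. nra.
Qed.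

Lemma height_ge_2000 (t : R) : 2 * exp (exp 2) <= t -> 2000 <= t.
Proof. intros H. assert (A := exp_le 7 (exp 2) ltac:(generalize exp_2_ge; lra)). generalize exp_7_ge. lra. Qed.

(** The tangent of the logarithm at [e^8], with [e^8 >= 1000]. *)
Lemma ln_2t_le (t : R) : 0 < t -> ln (2 * t) <= t / 500 + 7.
Proof.
  intros Ht. assert (A := exp_ineq1_le (ln (2 * t) - 8)).
  unfold Rminus in A at 2. rewrite exp_plus, exp_ln in A by lra.
  assert (B : exp (Ropp 8) <= / 1000).
  { rewrite exp_Ropp. apply Rinv_le_contravar; [lra|]. eapply Rle_trans; [apply exp_7_ge|apply exp_le; lra]. }
  nra.
Qed.

(** * Bounds for zeta'/zeta near height t *)

Section Height.
Variable t : R.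
Hypothesis (Hrh : RH) (Ht : 2000 <= t).

(** [exp M = e^2 (2 t)^2] exceeds the growth bound [7 y^2] at all heights [y <= 3 t/2 + 1] in
    use. *)
Let M := 2 * ln (2 * t) + 2.

Lemma M_bounds : 2 <= M <= t / 250 + 16.
Proof.
  unfold M. assert (A := ln_2t_le t ltac:(lra)). assert (B := ln_ge_0 (2 * t) ltac:(lra)). lra.
Qed.

Lemma Zt_lt_expM (z : C) : - / 2 <= fst z <= 3 -> Rabs (snd z - t) <= t / 2 + 1 -> Cmod (Zt z) < exp M.
Proof.
  intros H1 H2. apply Rabs_le_between in H2.
  assert (G := Zt_growth z ltac:(lra) ltac:(lra)).
  eapply Rle_lt_trans; [exact G|]. unfold M.
  replace (2 * ln (2 * t) + 2) with (ln (2 * t) + ln (2 * t) + 2) by ring.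
  rewrite !exp_plus, exp_ln by lra. assert (E := exp_2_ge).
  assert (snd z * snd z <= (3 / 2 * t + 1) * (3 / 2 * t + 1)) by (apply Rmult_le_compat; lra).
  nra.
Qed.

(** The reflection on a rectangle of half-height [t/4] about [y]: half of [M + 2] is [ln (2 t) + 2],
    and the barrier costs at most 1. All heights stay within [t/2 + 1] of [t], the range of
    [Zt_lt_expM]. *)
Lemma FZ_lower (c y : R) : Rabs (y - t) <= t / 4 -> / 2 < c <= 1 -> - fst (FZ (c, y)) <= ln (2 * t) + 3.
Proof.
  intros Hy Hc. assert (HM := M_bounds). apply Rabs_le_between in Hy.
  assert (A := log_deriv_lower y (t / 4) M Hrh ltac:(lra) ltac:(lra) ltac:(lra)).
  assert (B : forall z, - / 2 <= fst z <= 3 -> Rabs (snd z - y) <= t / 4 + 1 -> Cmod (Zt z) < exp M).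
  { intros z Hz1 Hz2. apply Zt_lt_expM; [exact Hz1|]. apply Rabs_le_between in Hz2. apply Rabs_le. lra. }
  specialize (A B c Hc). eapply Rle_trans; [exact A|].
  assert (Q : (5 * M + 10) / (t / 4 * (t / 4)) <= 1).
  { apply Rmult_le_reg_r with (t / 4 * (t / 4)); [nra|]. unfold Rdiv at 1. rewrite Rmult_assoc, Rinv_l by nra. nra. }
  unfold M in *. lra.
Qed.

Lemma FZ_crude (x y : R) : Rabs (y - t) <= t / 4 -> 0 < x <= 1 ->
  Cmod (FZ (/ 2 + x, y)) <= (4 * ln (2 * t) + 8) / (x * x).
Proof.
  intros Hy Hx. apply Rabs_le_between in Hy.
  replace (4 * ln (2 * t) + 8) with (2 * (M + 2)) by (unfold M; ring).
  apply log_deriv_crude; [exact Hrh|lra| |exact Hx].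
  intros z Hz1 Hz2 Hz3. rewrite <- (ln_exp M). apply ln_increasing; [apply Cmod_gt_0, Zt_neq_0; assumption|].
  apply Rabs_le_between in Hz3. apply Zt_lt_expM; [unfold DR in Hz1; lra|]. apply Rabs_le. lra.
Qed.
End Height.

(** [Zt] and [ZD] agree in a neighbourhood, hence so do their derivatives, and the series of
    [- zeta'/zeta] is largest on the real axis. *)
Lemma FZ_right (r y : R) : 0 < r -> 0 < y -> Cmod (FZ (1 + r, y)) <= / r + r.
Proof.
  intros Hr Hy. assert (HD : DS (1 + r, y)) by (unfold DS; simpl; lra).
  assert (Hne : forall z, DS z /\ 0 < snd z -> Zt z = ZD z).
  { intros z [Hz1 Hz2]. apply Zt_ZD; [exact Hz1|]. intro E. apply (f_equal snd) in E. simpl in E. lra. }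
  assert (E1 : Zt (1 + r, y) = ZD (1 + r, y)) by (apply Hne; split; [exact HD|exact Hy]).
  assert (E2 : Dc Zt (1 + r, y) = Dc ZD (1 + r, y)).
  { apply Dc_unique. apply is_Cder_ext with ZD.
    - generalize (near_and _ _ _ (DS_open _ HD) (half_plane_near_snd 0 (1 + r, y) Hy)).
      apply near_imp. intros w Hw. symmetry. apply Hne, Hw.
    - apply (hol_ZD 1), HD. }
  unfold FZ. rewrite E1, E2, Dc_ZD_DL by exact HD.
  replace (- (DL (1 + r, y)%R * ZD (1 + r, y)%R) / ZD (1 + r, y)%R)%C with (- DL (1 + r, y)%R)%C
    by (field; apply ZD_neq_0, HD).
  rewrite Cmod_opp. eapply Rle_trans; [apply Cmod_DL_le, HD|]. apply rDL_bound, Hr.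
Qed.

(** * The end point, the height of the rectangle and the integrable bounds *)

Lemma ln_rzeta_le (p Dl : R) : 0 < Dl -> 1 + / Dl <= p -> ln (rzeta p) <= Dl.
Proof.
  intros HD Hp. assert (I : 0 < / Dl) by (apply Rinv_0_lt_compat, HD).
  assert (A : rzeta p <= 1 + Dl).
  { eapply Rle_trans; [apply (rzeta_antitone (1 + / Dl)); lra|]. eapply Rle_trans; [apply rzeta_le, I|].
    rewrite Rinv_inv. lra. }
  apply Rle_trans with (ln (1 + Dl)); [apply ln_le; [apply rzeta_gt_0; lra|exact A]|].
  rewrite <- (ln_exp Dl) at 2. apply ln_le; [lra|]. apply exp_ineq1_le.
Qed.

(** [Dl * H] is an even multiple of pi for [sg = -1] and an odd one for [sg = 1]. The period
    [2 pi / Dl] is short against [t/8], so such an [H] lies in the given interval. *)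
Lemma cos_height (Dl t sg : R) : 13 <= Dl -> 2000 <= t -> sg = 1 \/ sg = - 1 ->
  exists H, t / 8 <= H <= t / 4 /\ cos (Dl * H) = - sg /\ sin (Dl * H) = 0.
Proof.
  intros HD Ht Hsg. assert (P := PI_RGT_0). assert (P4 := PI_4).
  destruct (nfloor_ex (Dl * (t / 8) / (2 * PI))) as [n [Hn1 Hn2]].
  { apply Rmult_le_pos; [nra|left; apply Rinv_0_lt_compat; lra]. }
  assert (A1 : Dl * (t / 8) <= 2 * (INR n + 1) * PI).
  { apply (Rmult_lt_compat_r (2 * PI)) in Hn2; [|lra]. unfold Rdiv at 1 in Hn2. rewrite Rmult_assoc, Rinv_l in Hn2 by lra. lra. }
  assert (A2 : 2 * INR n * PI <= Dl * (t / 8)).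
  { apply (Rmult_le_compat_r (2 * PI)) in Hn1; [|lra]. unfold Rdiv at 1 in Hn1. rewrite (Rmult_assoc (Dl * (t / 8))), Rinv_l in Hn1 by lra. lra. }
  set (base := if Rle_dec sg 0 then 0 else PI).
  assert (Hbase : 0 <= base <= PI /\ cos base = - sg /\ sin base = 0).
  { unfold base. destruct (Rle_dec sg 0) as [L|L], Hsg as [G|G]; rewrite G in *; try lra.
    - rewrite cos_0, sin_0. lra.
    - rewrite cos_PI, sin_PI. lra. }
  destruct Hbase as [B1 [B2 B3]].
  (* [S n] full periods reach at least [t/8]; the excess of at most one period plus [base] stays
     below [t/4]. *)
  exists ((base + 2 * INR (S n) * PI) / Dl).
  assert (E : Dl * ((base + 2 * INR (S n) * PI) / Dl) = base + 2 * INR (S n) * PI) by (field; lra).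
  rewrite E, cos_period, sin_period. split; [|split; assumption].
  rewrite S_INR. split; (apply Rmult_le_reg_l with Dl; [lra|]); rewrite S_INR in E; rewrite E; nra.
Qed.

Lemma exp_exp_opp (w : R) : exp w * exp (- w) = 1.
Proof. rewrite <- exp_plus, Rplus_opp_r. apply exp_0. Qed.

(** In essence [f <= 2 L1 / (exp w - 1)], because [ch w - 1 = (exp w - 1) (1 - exp (- w)) / 2]; the quadratic minorant of [exp]
    makes the bound integrable in closed form. *)
Lemma sinh_type_bound (f w L1 E : R) : 0 < w -> 0 <= L1 -> 0 <= E ->
  - f * (1 + - 1 * ch w) <= L1 * (1 + - 1 * exp (- w)) + E * w ->
  f <= 4 * (L1 + 3 / 2 * E) / (w * (w + 2)).
Proof.
  intros Hw HL HE H.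
  set (D := ch w - 1). set (p := w * (w + 2)).
  assert (Hp : 0 < p) by (unfold p; nra).
  assert (HD := ch_ge w ltac:(lra)). assert (He := exp_ge_quadratic w ltac:(lra)).
  assert (Eo := exp_exp_opp w). assert (P := exp_pos (- w)). assert (P1 := exp_pos w).
  assert (Q1 : exp (- w) <= 1) by (rewrite <- exp_0; apply exp_le; lra).
  assert (E1 : (1 - exp (- w)) * (exp w - 1) = 2 * D).
  { unfold D, ch. replace ((1 - exp (- w)) * (exp w - 1)) with (exp w + exp (- w) - 1 - exp w * exp (- w)) by ring. rewrite Eo. field. }
  assert (B1 : (1 - exp (- w)) * p <= 4 * D).
  { assert ((1 - exp (- w)) * (p / 2) <= (1 - exp (- w)) * (exp w - 1)) by (apply Rmult_le_compat_l; unfold p; lra). lra. }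
  assert (Hw2 : 0 < w * w) by nra. assert (Hw4 : 0 <= w * w * w * w) by (replace (w * w * w * w) with ((w * w) * (w * w)) by ring; nra).
  (* By [ch_ge], [6 D] is at least [3 w^2 + w^4/4], which exceeds [w p] by [w^2 (1 - w/2)^2]. This
     is the source of the factor [3/2] before [E]. *)
  assert (B2 : w * p <= 6 * D).
  { assert (0 <= w * w * ((1 - w / 2) * (1 - w / 2))) by (apply Rmult_le_pos; [lra|apply Rle_0_sqr]).
    unfold D, p. nra. }
  assert (HDp : 0 < D) by (unfold D; lra).
  assert (F : f * D <= L1 * (1 - exp (- w)) + E * w) by (unfold D; lra).
  apply Rmult_le_reg_r with (D * p); [apply Rmult_lt_0_compat; assumption|].
  replace (4 * (L1 + 3 / 2 * E) / p * (D * p)) with (L1 * (4 * D) + E * (6 * D)) by (field; lra).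
  apply Rle_trans with ((L1 * (1 - exp (- w)) + E * w) * p).
  - replace (f * (D * p)) with (f * D * p) by ring. apply Rmult_le_compat_r; lra.
  - assert (L1 * ((1 - exp (- w)) * p) <= L1 * (4 * D)) by (apply Rmult_le_compat_l; assumption).
    assert (E * (w * p) <= E * (6 * D)) by (apply Rmult_le_compat_l; assumption). lra.
Qed.

(** As [1 + ch w] is half of [(1 + exp (- w)) (exp w + 1)], the main term is [2 L1 / (exp w + 1)].
    With the minorant [(1 + w/2)^2] of [exp w + 1] its integral over [w > 0] becomes [4 L1]. *)
Lemma cosh_type_bound (f w L1 E : R) : 0 < w -> 0 <= L1 -> 0 <= E ->
  - f * (1 + 1 * ch w) <= L1 * (1 + 1 * exp (- w)) + E * w ->
  - f <= 2 * (L1 + E) / ((1 + w / 2) * (1 + w / 2)).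
Proof.
  intros Hw HL HE H.
  set (D := ch w + 1). set (p := (1 + w / 2) * (1 + w / 2)).
  assert (Hp : 0 < p) by (unfold p; nra).
  assert (HD := ch_ge w ltac:(lra)). assert (He := exp_ge_quadratic w ltac:(lra)).
  assert (Eo := exp_exp_opp w). assert (P := exp_pos (- w)).
  assert (E1 : (1 + exp (- w)) * (exp w + 1) = 2 * D).
  { unfold D, ch. replace ((1 + exp (- w)) * (exp w + 1)) with (exp w + exp (- w) + 1 + exp w * exp (- w)) by ring. rewrite Eo. field. }
  assert (Hw2 : 0 < w * w) by nra.
  assert (B1 : (1 + exp (- w)) * p <= 2 * D).
  { rewrite <- E1. apply Rmult_le_compat_l; [lra|]. unfold p. lra. }
  (* After insertion of [ch_ge] the claim is [w^4 - 3 w^3 - 12 w + 48 >= 0]. Minus the first square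
     below, this is a quadratic with negative discriminant and its minimum near 4, hence the
     second. *)
  assert (B2 : w * p <= 2 * D).
  { assert (S1 := Rle_0_sqr (w * w - 3 / 2 * w - 23 / 10)). assert (S2 := Rle_0_sqr (w - 4)). unfold Rsqr in S1, S2.
    unfold D, p. nra. }
  assert (Hw4 : 0 <= w * w * w * w) by (replace (w * w * w * w) with ((w * w) * (w * w)) by ring; nra).
  assert (HDp : 0 < D) by (unfold D; lra).
  assert (F : - f * D <= L1 * (1 + exp (- w)) + E * w) by (unfold D; lra).
  apply Rmult_le_reg_r with (D * p); [apply Rmult_lt_0_compat; assumption|].
  replace (2 * (L1 + E) / p * (D * p)) with (L1 * (2 * D) + E * (2 * D)) by (field; lra).
  apply Rle_trans with ((L1 * (1 + exp (- w)) + E * w) * p).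
  - replace (- f * (D * p)) with (- f * D * p) by ring. apply Rmult_le_compat_r; lra.
  - assert (L1 * ((1 + exp (- w)) * p) <= L1 * (2 * D)) by (apply Rmult_le_compat_l; assumption).
    assert (E * (w * p) <= E * (2 * D)) by (apply Rmult_le_compat_l; assumption). lra.
Qed.

(** * Integration to the left from Re s = 1 + 1/D *)

Section Final.
Variables (t L : R).
Hypothesis (Hrh : RH) (Ht : 2000 <= t) (HtL : ln (2 * t) <= L) (HLp : 0 < L) (Hl : 10 <= ln L).

Let l := ln L.
(** The main coefficient is [2 / Dl = (3/2) / l], while the error is governed by
    [exp (Dl * X) = e L^(2/3)]; a larger factor lowers the one and raises the other. With [4/3] and
    [l >= 10] the error brings the coefficient from [3/2] to [1.75], just below the required
    [1.756]. *)
Let Dl := 4 / 3 * l.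
Let X := / 2 + / Dl.

Lemma Dl_bounds : 40 / 3 <= Dl /\ 0 < / Dl <= 3 / 40.
Proof.
  assert (A : 40 / 3 <= Dl) by (unfold Dl, l; lra). split; [exact A|]. split; [apply Rinv_0_lt_compat; lra|].
  replace (3 / 40) with (/ (40 / 3)) by field. apply Rinv_le_contravar; lra.
Qed.

(** [q] is [L^(-1/3)], so that [L^(2/3) = L q] and the errors become [L] times powers of
    [q <= 1/26]. The bound for [l * q] is [10/26] rounded up, the case [l = 10]. *)
Lemma cube_root_bounds : exists q, 0 < q <= / 26 /\ 1 = L * (q * q * q) /\ exp (Dl * X) <= 279 / 100 * (L * q) /\ l * q <= 385 / 1000 /\ 17576 <= L.
Proof.
  set (q := exp (- (l / 3))). exists q.
  assert (EL : L = exp l) by (unfold l; rewrite exp_ln; [reflexivity|exact HLp]).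
  assert (Hq : 0 < q) by apply exp_pos.
  assert (E3 : 26 * (1 + (l - 10) / 3) <= exp (l / 3)).
  { replace (l / 3) with (10 / 3 + (l - 10) / 3) by field. rewrite exp_plus.
    apply Rmult_le_compat; [lra|unfold l; lra|apply exp_10_3_ge|apply exp_ineq1_le]. }
  assert (Eq : q * exp (l / 3) = 1) by (unfold q; rewrite <- exp_plus; replace (- (l / 3) + l / 3) with 0 by ring; apply exp_0).
  assert (Hl' : 10 <= l) by exact Hl.
  assert (Q26 : q * 26 <= 1) by nra.
  assert (E3q : 1 = L * (q * q * q)).
  { rewrite EL. unfold q. rewrite <- !exp_plus. rewrite <- exp_0 at 1. f_equal. field. }
  split; [lra|]. split; [exact E3q|]. split; [|split].
  - destruct Dl_bounds as [D1 D2].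
    replace (Dl * X) with (1 + (l + - (l / 3))).
    + rewrite exp_plus, exp_plus. fold q. rewrite <- EL. apply Rmult_le_compat_r; [|apply exp_1_le].
      apply Rmult_le_pos; lra.
    + unfold X. rewrite Rmult_plus_distr_l, Rinv_r by lra. unfold Dl. field.
  - assert (q * (26 * (1 + (l - 10) / 3)) <= 1) by (rewrite <- Eq; apply Rmult_le_compat_l; lra). nra.
  - assert (q * q <= / 26 * / 26) by (apply Rmult_le_compat; lra).
    assert (q * q * q <= / 26 * / 26 * / 26) by (apply Rmult_le_compat; nra). nra.
Qed.

(** [E] collects two errors per unit of [Dl * x]: [S / X], of order [Dl L^(2/3)], gives at most
    [0.1086 L], and the barrier, small because [H] is of order [t], at most [0.0024 L]. *)
Lemma strip_bound_small_error (sg : R) : sg = 1 \/ sg = - 1 -> exists E, 0 <= E <= 111 / 1000 * L /\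
  forall x, 0 < x <= X -> - fst (FZ (/ 2 + x, t)) * (1 + sg * ch (Dl * x)) <=
    (L + 3) * (1 + sg * exp (- (Dl * x))) + E * (Dl * x).
Proof.
  intros Hsg. destruct Dl_bounds as [D1 [D2 D3]].
  destruct (cos_height Dl t sg ltac:(lra) Ht Hsg) as [H [[H1 H2] [H3 H4]]].
  destruct cube_root_bounds as [q [[Q1 Q2] [Q3 [Q4 [Q5 Q6]]]]].
  set (K := 4 * ln (2 * t) + 8). set (F1 := Dl + / Dl).
  assert (Hln := ln_2t_le t ltac:(lra)). assert (Hln0 := ln_ge_0 (2 * t) ltac:(lra)).
  assert (Rin : forall y, Rabs (y - t) <= H -> Rabs (y - t) <= t / 4) by (intros; lra).
  assert (SB := strip_bound t H (L + 3) K F1 Dl X sg Hrh ltac:(lra) ltac:(lra) ltac:(lra) ltac:(unfold K; lra) ltac:(unfold F1; lra)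
    ltac:(lra) ltac:(unfold X; lra) Hsg H3 H4).
  specialize (SB ltac:(intros c y Hy Hc; apply Rle_trans with (ln (2 * t) + 3); [apply (FZ_lower t Hrh Ht); [apply Rin, Hy|exact Hc]|lra])).
  specialize (SB ltac:(intros x y Hy Hx; apply (FZ_crude t Hrh Ht); [apply Rin, Hy|exact Hx])).
  specialize (SB ltac:(intros y Hy; replace (/ 2 + X) with (1 + / Dl) by (unfold X; field; lra);
    apply Rabs_le_between in Hy; eapply Rle_trans; [apply FZ_right; lra|unfold F1; rewrite Rinv_inv; lra])).
  set (S := F1 * (3 / 2 + exp (Dl * X) / 2)) in *. set (S3 := K * (Dl * Dl) * exp (Dl * X)) in *.
  set (ex := exp (Dl * X)) in *. assert (Pe : 0 < ex) by apply exp_pos.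
  assert (HF1 : 0 < F1) by (unfold F1; lra).
  assert (HS : 0 <= S) by (unfold S; apply Rmult_le_pos; lra).
  assert (HS3 : 0 <= S3) by (unfold S3, K; apply Rmult_le_pos; [apply Rmult_le_pos; nra|lra]).
  assert (HLq : 0 < L * q) by (apply Rmult_lt_0_compat; lra).
  assert (B1 : S / X <= 1086 / 10000 * L * Dl).
  { apply Rle_trans with (S * 2).
    - apply Rmult_le_compat_l; [exact HS|]. rewrite <- (Rinv_inv 2). apply Rinv_le_contravar; unfold X; lra.
    - assert (F1b : F1 <= 10057 / 10000 * Dl).
      { unfold F1. assert (/ Dl <= 57 / 10000 * Dl); [|lra]. lra. }
      (* [1 = L q^3] turns the constant [3/2] into a small multiple of [L q] as well; then
         [q <= 1/26]. *)
      assert (Sb : 3 / 2 + ex / 2 <= L * (5381 / 100000)).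
      { assert (q * q * q <= / 676 * q).
        { assert (q * q <= / 26 * / 26) by (apply Rmult_le_compat; lra). nra. }
        assert (L * (q * q * q) <= L * (/ 676 * q)) by (apply Rmult_le_compat_l; lra).
        assert (L * q <= L * / 26) by (apply Rmult_le_compat_l; lra). lra. }
      unfold S. apply Rle_trans with ((10057 / 10000 * Dl) * (L * (5381 / 100000)) * 2).
      + apply Rmult_le_compat_r; [lra|]. apply Rmult_le_compat; lra.
      + assert (0 < L * Dl) by (apply Rmult_lt_0_compat; lra). lra. }
  assert (B2 : 2 * S3 / (H * H) <= 24 / 10000 * L * Dl).
  { assert (KH : K <= 832 / 1000000 * (H * H)).
    { assert (t / 8 * (t / 8) <= H * H) by (apply Rmult_le_compat; lra).
      apply Rle_trans with (832 / 1000000 * (t / 8 * (t / 8))); [|lra]. unfold K. nra. }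
    apply Rmult_le_reg_r with (H * H); [nra|]. unfold Rdiv at 1. rewrite Rmult_assoc, Rinv_l by nra. rewrite Rmult_1_r.
    assert (Hex : Dl * ex <= 1433 / 1000 * L).
    { apply Rle_trans with (Dl * (279 / 100 * (L * q))); [apply Rmult_le_compat_l; lra|].
      unfold Dl. replace (4 / 3 * l * (279 / 100 * (L * q))) with (L * (372 / 100 * (l * q))) by field.
      assert (L * (372 / 100 * (l * q)) <= L * (372 / 100 * (385 / 1000))) by (apply Rmult_le_compat_l; lra). lra. }
    unfold S3. replace (2 * (K * (Dl * Dl) * ex)) with ((2 * K * Dl) * (Dl * ex)) by ring.
    apply Rle_trans with ((2 * K * Dl) * (1433 / 1000 * L)).
    - apply Rmult_le_compat_l; [|exact Hex]. apply Rmult_le_pos; [unfold K; lra|lra].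
    - assert (0 < L * Dl) by (apply Rmult_lt_0_compat; lra).
      replace (2 * K * Dl * (1433 / 1000 * L)) with (K * (2866 / 1000 * (L * Dl))) by field.
      apply Rle_trans with (832 / 1000000 * (H * H) * (2866 / 1000 * (L * Dl))); [apply Rmult_le_compat_r; lra|].
      assert (0 <= H * H * (L * Dl)) by (apply Rmult_le_pos; nra). nra. }
  exists ((S / X + 2 * S3 / (H * H)) / Dl). split.
  - split.
    + apply Rmult_le_pos; [|lra]. apply Rplus_le_le_0_compat; (apply Rmult_le_pos; [lra|left; apply Rinv_0_lt_compat]); [unfold X; lra|nra].
    + apply Rmult_le_reg_r with Dl; [lra|]. unfold Rdiv at 1. rewrite Rmult_assoc, Rinv_l by lra. nra.
  - intros x Hx. eapply Rle_trans; [apply SB, Hx|]. right. field. repeat split; try (unfold X; lra); lra.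
Qed.

Let u := fun x => ln (Cmod (Zt (/ 2 + x, t))).

Lemma u_deriv (x : R) : 0 < x -> is_derive u x (fst (FZ (/ 2 + x, t))).
Proof.
  intros Hx. assert (HD : DR (/ 2 + x, t)) by (unfold DR; simpl; lra).
  destruct (hol_Zt 1) as [Hz _]. specialize (Hz _ (DR_DZ _ HD)).
  replace (fst (FZ (/ 2 + x, t))) with (1 * fst (FZ (/ 2 + x, t))) by ring.
  apply (is_derive_comp (fun r => ln (Cmod (Zt (r, t)))) (fun x => / 2 + x)).
  - apply (is_derive_ln_Cmod (fun r => Zt (r, t))); [apply is_Cder_x, Hz|apply Zt_neq_0; assumption].
  - auto_derive; [exact I|ring].
Qed.

Lemma u_right (x : R) : X <= x -> - Dl <= u x <= Dl.
Proof.
  intros Hx. destruct Dl_bounds as [D1 [D2 D3]].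
  assert (HD : DS (/ 2 + x, t)) by (unfold DS, X in *; simpl; lra).
  assert (E : u x = ln (Cmod (ZD (/ 2 + x, t)))).
  { unfold u. rewrite Zt_ZD; [reflexivity|exact HD|]. intro K. apply (f_equal snd) in K. simpl in K. lra. }
  assert (A := ln_ZD_ge _ HD). assert (B := ln_ZD_le _ HD). cbn [fst] in A, B.
  assert (R := ln_rzeta_le (/ 2 + x) Dl ltac:(lra) ltac:(unfold X in Hx; lra)). rewrite E. lra.
Qed.

(** [Dl] bounds [|u|] at the end point [X]. Since [L >= (l^2/8)^2] and [l >= 10], it fits into the
    second term of the first inequality. *)
Lemma Dl_le : Dl <= 251 / 100 * L / l.
Proof.
  assert (Hl' : 10 <= l) by exact Hl.
  assert (EL : L = exp (l / 2) * exp (l / 2)).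
  { rewrite <- exp_plus. replace (l / 2 + l / 2) with l by field. unfold l. rewrite exp_ln; [reflexivity|exact HLp]. }
  assert (A := exp_ge_quadratic (l / 2) ltac:(lra)).
  apply Rmult_le_reg_r with l; [lra|]. unfold Rdiv. rewrite Rmult_assoc, Rinv_l, Rmult_1_r by lra.
  assert (B : l * l / 8 <= exp (l / 2)) by lra.
  assert (B2 : (l * l / 8) * (l * l / 8) <= L) by (rewrite EL; apply Rmult_le_compat; nra).
  assert (100 <= l * l) by nra. unfold Dl. nra.
Qed.

(** Integration of [sinh_type_bound] from [x] to [X]: with [w = Dl * v], the derivative of
    [2 A / Dl * ln (1 + 2 / w)] in [v] is [- 4 A / (w (w + 2))], so adding it to [u] gives a
    nonincreasing function. The coefficient is [(3/2) A / l] with [A <= 1.1667 L]. *)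
Lemma ln_Zt_lower (x : R) : 0 < x ->
  - u x <= Dl + 1756 / 1000 * L / l * ln (1 + 2 / (Dl * x)).
Proof.
  intros Hx. destruct Dl_bounds as [D1 [D2 D3]]. assert (Hl' : 10 <= l) by exact Hl.
  assert (HX0 : 0 < X) by (unfold X; lra).
  assert (Pc : forall v, 0 < v -> 0 < 2 / (Dl * v)) by (intros v Hv; apply Rdiv_lt_0_compat; [lra|apply Rmult_lt_0_compat; lra]).
  assert (Hcoef : 0 <= 1756 / 1000 * L / l) by (apply Rmult_le_pos; [lra|left; apply Rinv_0_lt_compat; lra]).
  destruct (Rle_dec X x) as [HXx|HXx].
  { assert (A := u_right x HXx). assert (0 <= ln (1 + 2 / (Dl * x))) by (apply ln_ge_0; specialize (Pc x Hx); lra).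
    assert (0 <= 1756 / 1000 * L / l * ln (1 + 2 / (Dl * x))) by (apply Rmult_le_pos; assumption). lra. }
  destruct (strip_bound_small_error (-1) ltac:(right; reflexivity)) as [E [[E1 E2] HE]].
  destruct cube_root_bounds as [_ [_ [_ [_ [_ HL]]]]].
  set (A := L + 3 + 3 / 2 * E). assert (HA : 0 <= A <= 11667 / 10000 * L) by (unfold A; lra).
  assert (Mo : u X + 2 * A / Dl * ln (1 + 2 / (Dl * X)) <= u x + 2 * A / Dl * ln (1 + 2 / (Dl * x))).
  { apply (antitone_of_derive (fun v => u v + 2 * A / Dl * ln (1 + 2 / (Dl * v)))
      (fun v => fst (FZ (/ 2 + v, t)) - 4 * A / (Dl * v * (Dl * v + 2)))); [lra| |].
    - intros v Hv. assert (0 < Dl * v) by (apply Rmult_lt_0_compat; lra). assert (P := Pc v ltac:(lra)).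
      replace (fst (FZ (/ 2 + v, t)) - 4 * A / (Dl * v * (Dl * v + 2)))
        with (fst (FZ (/ 2 + v, t)) + 2 * A / Dl * (- (2 * Dl / (Dl * v * (Dl * v))) / (1 + 2 / (Dl * v)))).
      + apply (is_derive_plus u (fun v => 2 * A / Dl * ln (1 + 2 / (Dl * v)))); [apply u_deriv; lra|].
        apply is_derive_scal. auto_derive; [split; [lra|]; split; [|exact I]; unfold Rdiv in P; lra|]. field. lra.
      + field. repeat split; lra.
    - intros v Hv. assert (Hw : 0 < Dl * v) by (apply Rmult_lt_0_compat; lra).
      assert (B := sinh_type_bound (fst (FZ (/ 2 + v, t))) (Dl * v) (L + 3) E Hw ltac:(lra) E1 (HE v ltac:(lra))).
      fold A in B. lra. }
  assert (UX := u_right X (Rle_refl X)).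
  assert (LX : 0 <= 2 * A / Dl * ln (1 + 2 / (Dl * X))).
  { apply Rmult_le_pos; [apply Rmult_le_pos; [lra|lra]|]. apply ln_ge_0. specialize (Pc X HX0). lra. }
  assert (C : 2 * A / Dl <= 1756 / 1000 * L / l).
  { unfold Dl. replace (2 * A / (4 / 3 * l)) with (3 / 2 * A / l) by (field; lra).
    apply Rmult_le_compat_r; [left; apply Rinv_0_lt_compat; lra|]. lra. }
  assert (LP : 0 <= ln (1 + 2 / (Dl * x))) by (apply ln_ge_0; specialize (Pc x Hx); lra).
  assert (2 * A / Dl * ln (1 + 2 / (Dl * x)) <= 1756 / 1000 * L / l * ln (1 + 2 / (Dl * x))) by (apply Rmult_le_compat_r; assumption).
  lra.
Qed.

(** The antiderivative [- (4 A / Dl) / (1 + w/2)] of the bound stays bounded down to [w = 0], so no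
    logarithm appears: the integral costs at most [4 L / l] and the end point [2.51 L / l]. *)
Lemma ln_Zt_upper (x : R) : 0 < x -> u x <= 845 / 100 * L / l.
Proof.
  intros Hx. destruct Dl_bounds as [D1 [D2 D3]]. assert (Hl' : 10 <= l) by exact Hl.
  assert (HX0 : 0 < X) by (unfold X; lra).
  assert (DS0 := Dl_le).
  assert (Hll : 0 <= L / l) by (apply Rmult_le_pos; [lra|left; apply Rinv_0_lt_compat; lra]).
  destruct (Rle_dec X x) as [HXx|HXx].
  { assert (A := u_right x HXx). unfold Rdiv in *. lra. }
  destruct (strip_bound_small_error 1 ltac:(left; reflexivity)) as [E [[E1 E2] HE]].
  destruct cube_root_bounds as [_ [_ [_ [_ [_ HL]]]]].
  set (A := L + 3 + E). assert (HA : 0 <= A <= 12 / 10 * L) by (unfold A; lra).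
  assert (Mo : - (u X - 4 * A / Dl * / (1 + Dl * X / 2)) <= - (u x - 4 * A / Dl * / (1 + Dl * x / 2))).
  { apply (antitone_of_derive (fun v => - (u v - 4 * A / Dl * / (1 + Dl * v / 2)))
      (fun v => - (fst (FZ (/ 2 + v, t)) + 2 * A / ((1 + Dl * v / 2) * (1 + Dl * v / 2))))); [lra| |].
    - intros v Hv. assert (0 < Dl * v) by (apply Rmult_lt_0_compat; lra).
      apply (is_derive_opp (fun v => u v - 4 * A / Dl * / (1 + Dl * v / 2))).
      replace (fst (FZ (/ 2 + v, t)) + 2 * A / ((1 + Dl * v / 2) * (1 + Dl * v / 2)))
        with (fst (FZ (/ 2 + v, t)) - 4 * A / Dl * (- (Dl / 2) / ((1 + Dl * v / 2) * (1 + Dl * v / 2)))).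
      + apply (is_derive_minus u (fun v => 4 * A / Dl * / (1 + Dl * v / 2))); [apply u_deriv; lra|].
        apply is_derive_scal. auto_derive; [lra|]. field. lra.
      + field. lra.
    - intros v Hv. assert (Hw : 0 < Dl * v) by (apply Rmult_lt_0_compat; lra).
      assert (B := cosh_type_bound (fst (FZ (/ 2 + v, t))) (Dl * v) (L + 3) E Hw ltac:(lra) E1 (HE v ltac:(lra))).
      fold A in B. lra. }
  assert (UX := u_right X (Rle_refl X)).
  assert (Hv : forall v, 0 < v -> 0 <= / (1 + Dl * v / 2) <= 1).
  { intros v Hv. assert (0 < Dl * v) by (apply Rmult_lt_0_compat; lra).
    split; [left; apply Rinv_0_lt_compat; lra|]. rewrite <- Rinv_1. apply Rinv_le_contravar; lra. }
  assert (H4 : 0 <= 4 * A / Dl) by (apply Rmult_le_pos; lra).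
  assert (V1 := Hv X HX0). assert (V2 := Hv x Hx).
  assert (0 <= 4 * A / Dl * / (1 + Dl * X / 2)) by (apply Rmult_le_pos; lra).
  assert (4 * A / Dl * / (1 + Dl * x / 2) <= 4 * A / Dl * 1) by (apply Rmult_le_compat_l; lra).
  assert (C : 4 * A / Dl <= 4 * (L / l)).
  { unfold Dl. replace (4 * A / (4 / 3 * l)) with (3 * A / l) by (field; lra).
    replace (4 * (L / l)) with (4 * L / l) by (field; lra).
    apply Rmult_le_compat_r; [left; apply Rinv_0_lt_compat; lra|]. lra. }
  unfold Rdiv in *. lra.
Qed.
End Final.

Theorem theorem1 :
  RH ->
  forall sigma t T : R,
    1 / 2 < sigma <= 3 / 2 ->
    T >= 2 / 3 * exp (exp 10) ->
    2 * exp (exp 2) <= t <= T ->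
    ln (/ Cmod (zeta (sigma, t))) <=
      (1756 / 1000) * ln (2 * T) / ln (ln (2 * T))
        * ln (1 + (37345 / 1000) / ((sigma - 1 / 2) * ln (ln T)))
      + (251 / 100) * ln (2 * T) / ln (ln (2 * T))
    /\
    ln (Cmod (zeta (sigma, t))) <= (845 / 100) * ln (2 * T) / ln (ln (2 * T)).
Proof.
  intros Hrh sigma t T Hsig HT Ht.
  assert (Ht2 := height_ge_2000 t (proj1 Ht)).
  set (L := ln (2 * T)). set (l := ln L). set (l1 := ln (ln T)).
  assert (P := exp_pos (exp 10)). assert (E10 := exp_ineq1_le 10).
  (* [2 T >= (4/3) exp (exp 10)], so [log log (2 T) >= 10]. *)
  assert (HL : exp 10 <= L).
  { rewrite <- (ln_exp (exp 10)). apply ln_le; [exact P|lra]. }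
  assert (HLp : 0 < L) by lra.
  assert (Hl : 10 <= l) by (rewrite <- (ln_exp 10); apply ln_le; [apply exp_pos|exact HL]).
  assert (HtL : ln (2 * t) <= L) by (apply ln_le; lra).
  assert (HlnT : 2 <= ln T).
  { assert (A : ln (T * 2) = ln T + ln 2) by (apply ln_mult; lra).
    replace (T * 2) with (2 * T) in A by ring. fold L in A. generalize ln_2_le. lra. }
  assert (Hl1 : 0 < l1) by (unfold l1; rewrite <- ln_1; apply ln_increasing; lra).
  assert (Hl1l : l1 <= l) by (apply ln_le; [lra|apply ln_le; lra]).
  assert (Hz1 : (sigma, t) <> RtoC 1).
  { intro K. apply (f_equal snd) in K. simpl in K. lra. }
  assert (Hz : zeta (sigma, t) = Zt (/ 2 + (sigma - 1 / 2), t)).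
  { rewrite zeta_Zt; [f_equal; f_equal; field|exact Hz1|simpl; lra]. }
  assert (HD : DR (/ 2 + (sigma - 1 / 2), t)) by (unfold DR; simpl; lra).
  assert (Hpos : 0 < Cmod (zeta (sigma, t))) by (rewrite Hz; apply Cmod_gt_0, Zt_neq_0; assumption).
  rewrite ln_Rinv by exact Hpos. rewrite Hz.
  set (d := sigma - 1 / 2) in *. assert (Hd : 0 < d) by (unfold d; lra).
  split.
  - assert (LB := ln_Zt_lower t L Hrh Ht2 HtL HLp Hl d Hd). assert (DB := Dl_le L HLp Hl).
    cbv zeta in LB, DB. fold l in LB, DB. eapply Rle_trans; [exact LB|].
    rewrite Rplus_comm. apply Rplus_le_compat; [|exact DB].
    apply Rmult_le_compat_l; [apply Rmult_le_pos; [lra|left; apply Rinv_0_lt_compat; lra]|].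
    assert (Hdl : 0 < d * l) by (apply Rmult_lt_0_compat; lra).
    assert (Hdl1 : 0 < d * l1) by (apply Rmult_lt_0_compat; lra).
    assert (I1 : / (d * l) <= / (d * l1)) by (apply Rinv_le_contravar; [exact Hdl1|apply Rmult_le_compat_l; lra]).
    assert (I0 : 0 < / (d * l)) by (apply Rinv_0_lt_compat, Hdl).
    (* The argument of the logarithm comes out with [3/2] and [log log (2 T)]; the statement allows
       [37.345] and the smaller [log log T]. *)
    assert (E : 2 / (4 / 3 * l * d) = 3 / 2 * / (d * l)) by (field; lra).
    rewrite E. apply ln_le; [lra|]. unfold Rdiv at 2. lra.
  - apply (ln_Zt_upper t L Hrh Ht2 HtL HLp Hl d Hd).
Qed.
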